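(* Let $\omega$ be the (possibly meromorphic in $a_\nu$) 1-form on $\widetilde{\mathcal T}\times\mathcal M$ locally defined by $$\omega=\sum_{1\le\nu<\mu\le n}\operatorname{Tr}(A_\mu A_\nu)\,d\ln(a_\mu-a_\nu)+\sum_{\nu=1,\dots,n,\infty}\operatorname{Tr}\left(\Theta_\nu G_\nu^{-1}d_{\mathcal M}G_\nu\right),$$ where $d_{\mathcal M}$ denotes the differential with respect to monodromy data. Then its exterior differential $\Omega:=d\omega$ is a closed 2-form on $\mathcal M$ independent of $a_1,\dots,a_n$ (i.e. $\Omega$ has no components involving $da_1,\dots,da_n$, and its remaining coefficients do not depend on $a_1,\dots,a_n$).
   Context: Consider rank $N$ Fuchsian systems $\partial_z\Phi=\sum_{\nu=1}^n\frac{A_\nu}{z-a_\nu}\Phi$ with $A_1,\dots,A_n\in\mathfrak{sl}_N(\mathbb C)$, $a_{\infty}=\infty$, and $A_\infty:=-\sum_{\nu=1}^nA_\nu$. For each $\nu=1,\dots,n,\infty$ the eigenvalues $\theta_{\nu,1},\dots,\theta_{\nu,N}$ of $A_\nu$ are assumed non-resonant: $\theta_{\nu,k}-\theta_{\nu,l}\notin\mathbb Z$ for $k\neq l$. Fix diagonalizations $A_\nu=G_\nu\Theta_\nu G_\nu^{-1}$, $\Theta_\nu=\operatorname{diag}\{\theta_{\nu,1},\dots,\theta_{\nu,N}\}$. The fundamental solution $\Phi$ behaves near singular points as $$\Phi(z)=G_\nu\Big[\mathbf 1+\sum_{m\ge1}g_{\nu,m}(z-a_\nu)^m\Big](z-a_\nu)^{\Theta_\nu}C_\nu\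 (\nu=1,\dots,n),\qquad \Phi(z)=G_\infty\Big[\mathbf 1+\sum_{m\ge1}g_{\infty,m}z^{-m}\Big]z^{-\Theta_\infty}C_\infty,$$ with connection matrices $C_\nu$. $\mathcal M$ is the space of monodromy data, parameterizing the local monodromy exponents $\Theta_\nu$ and connection matrices $C_\nu$ ($\nu=1,\dots,n,\infty$) and the normalization matrix $G_\infty$. $\mathcal T=\{(a_1,\dots,a_n)\in\mathbb C^n: a_\mu\neq a_\nu\ \text{for}\ \mu\ne\nu\}$ is the space of isomonodromic times and $\widetilde{\mathcal T}$ its universal cover. For given monodromy data the inverse monodromy problem is locally uniquely solvable, and $A_\nu$, $G_\nu$ are regarded as (meromorphic in $a$) functions on $\widetilde{\mathcal T}\times\mathcal M$. For fixed monodromy data ($\Theta_\nu$, $C_\nu$, $G_\infty$ constant) they satisfy, for $\nu=1,\dots,n$, $$\partial_{a_\mu}A_\nu=\frac{[A_\mu,A_\nu]}{a_\mu-a_\nu}\ (\mu\neq\nu),\qquad \partial_{a_\nu}A_\nu=-\sum_{\mu\neq\nu}\frac{[A_\mu,A_\nu]}{a_\mu-a_\nu},$$ $$\partial_{a_\mu}G_\nu\cdot G_\nu^{-1}=\frac{A_\mu}{a_\mu-a_\nu}\ (\mu\ne\nu),\qquad \partial_{a_\nu}G_\nu\cdot G_\nu^{-1}=-\sum_{\mu\neq\nu}\frac{A_\mu}{a_\mu-a_\nu}.$$ Here $d$ is the full exterior differential on $\widetilde{\mathcal T}\times\mathcal M$. *)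

(* Defs.v *)
From HB Require Import structures.
From mathcomp Require Import all_boot all_order all_algebra.
From mathcomp Require Import all_classical all_reals all_analysis.
From mathcomp Require Import complex.

Set Implicit Arguments.
Unset Strict Implicit.
Unset Printing Implicit Defensive.

Import Order.TTheory GRing.Theory Num.Theory.
Import numFieldNormedType.Exports.

Local Open Scope classical_set_scope.
Local Open Scope ring_scope.

(* R[i], packed as a numClosedFieldType so that the normed-module structures of
   numFieldNormedType (on C itself and on matrices over it) are inferred. *)
Definition C (R : realType) : numClosedFieldType := R[i].

Definition expC (R : realType) (w : C R) : C R :=
  ((expR (complex.Re w) * cos (complex.Im w)) +i*
   (expR (complex.Re w) * sin (complex.Im w)))%C.

Definition basis (R : realType) (p : nat) (i : 'I_p) : 'rV[C R]_p :=
  delta_mx 0 i.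

Definition partial (R : realType) (p : nat) (V : normedModType (C R)) (i : 'I_p)
    (f : 'rV[C R]_p -> V) (y : 'rV[C R]_p) : V :=
  'D_(basis R i) f y.

(* Complex differentiable with continuous partial derivatives, i.e. of class C^1
   and satisfying the Cauchy-Riemann equations; meant for open U. *)
Definition holomorphic (R : realType) (p : nat) (V : normedModType (C R))
    (U : set 'rV[C R]_p) (f : 'rV[C R]_p -> V) : Prop :=
  forall y, U y -> differentiable f y /\
    forall i : 'I_p, {for y, continuous (partial i f)}.

(* A 1-form sum_i w_i dy_i is the row (w_i); a 2-form
   sum_(i < j) W_ij dy_i /\ dy_j is the antisymmetric matrix (W_ij). *)
Definition ext_d (R : realType) (p : nat) (w : 'rV[C R]_p -> 'rV[C R]_p)
    (y : 'rV[C R]_p) : 'M[C R]_p :=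
  \matrix_(i, j) (partial i (fun u => w u 0 j : C R) y
                  - partial j (fun u => w u 0 i : C R) y).

Definition closed_2form (R : realType) (p : nat) (U : set 'rV[C R]_p)
    (W : 'rV[C R]_p -> 'M[C R]_p) : Prop :=
  forall y, U y -> forall i j k : 'I_p,
    partial i (fun u => W u j k : C R) y + partial j (fun u => W u k i : C R) y
    + partial k (fun u => W u i j : C R) y = 0.

Definition local_section (X B : topologicalType) (p : X -> B) (V : set B)
    (s : B -> X) : Prop :=
  [/\ open V, {within V, continuous s} & forall b, V b -> p (s b) = b].

Definition covering_map (X B : topologicalType) (p : X -> B) (T : set B) : Prop :=
  [/\ continuous p, range p = T &
    forall b, T b -> exists V : set B, [/\ V b, V `<=` T &
      exists (I : Type) (s : I -> B -> X),
        [/\ forall i, local_section p V (s i),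
            forall i, open (s i @` V) &
            forall x, V (p x) -> exists! i, (s i @` V) x]]].

Definition simply_connected (R : realType) (X : topologicalType) : Prop :=
  [/\ [set: X] !=set0,
      forall x y : X, exists g : R -> X,
        [/\ {within `[0, 1], continuous g}, g 0 = x & g 1 = y] &
      forall g : R -> X, {within `[0, 1], continuous g} -> g 0 = g 1 ->
        exists H : R * R -> X,
          [/\ {within `[0, 1] `*` `[0, 1], continuous H},
              forall t, t \in `[0, 1] -> H (t, 0) = g t,
              forall t, t \in `[0, 1] -> H (t, 1) = g 0 &
              forall u, u \in `[0, 1] -> H (0, u) = g 0 /\ H (1, u) = g 0]].

Definition universal_cover (R : realType) (X B : topologicalType) (p : X -> B)
    (T : set B) : Prop :=
  covering_map p T /\ simply_connected R X.

Definition times (R : realType) (n : nat) : set 'rV[C R]_n :=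
  [set a | forall mu nu : 'I_n, mu != nu -> a 0 mu != a 0 nu].

Definition times_and_point (R : realType) (n : nat) : set ('rV[C R]_n * C R) :=
  [set az | times az.1 /\ forall nu : 'I_n, az.2 != az.1 0 nu].

(* Singular points are indexed by option 'I_n: Some nu is a_nu and None is
   infinity.  w is a logarithm of the local parameter at the singular point: z - a_nu at
   a_nu, and 1/z at infinity.  With this choice the two local expansions of Phi
   have the same shape. *)
Definition spectral_pt (R : realType) (n : nat) (nu : option 'I_n)
    (a : 'rV[C R]_n) (w : C R) : C R :=
  if nu is Some k then a 0 k + expC w else expC (- w).

(* Largest punctured disc around the singular point that avoids the others. *)
Definition near_singularity (R : realType) (n : nat) (nu : option 'I_n)
    (a : 'rV[C R]_n) (w : C R) : Prop :=
  if nu is Some k then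
    forall mu : 'I_n, mu != k -> `|expC w| < `|a 0 mu - a 0 k|
  else forall mu : 'I_n, `|a 0 mu| < `|expC (- w)|.

(* pi : X -> C^n is the universal cover of the space of times and rho that of
   the space of pairs (a, z), on which Phi is single-valued; q forgets z, and
   for fixed x its fibre is the universal cover of the z-plane punctured at the
   a_nu.  ell nu selects, continuously in x, the branch of Phi near the singular
   point nu with respect to which the connection matrix is defined. *)
Record marking (R : realType) (n : nat) (X Y : topologicalType)
    (pi : X -> 'rV[C R]_n) (rho : Y -> 'rV[C R]_n * C R) (q : Y -> X)
    (ell : option 'I_n -> X * C R -> Y) : Prop := Marking {
  mk_times : universal_cover R pi (@times R n);
  mk_points : universal_cover R rho (@times_and_point R n);
  mk_q : continuous q;
  mk_pi_q : forall y, pi (q y) = (rho y).1;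
  mk_ell : forall nu,
    {within [set xw | near_singularity nu (pi xw.1) xw.2], continuous (ell nu)};
  mk_rho_ell : forall nu x w, near_singularity nu (pi x) w ->
    rho (ell nu (x, w)) = (pi x, spectral_pt nu (pi x) w);
  mk_q_ell : forall nu x w, near_singularity nu (pi x) w ->
    q (ell nu (x, w)) = x
}.

(* Functions on X x C^d are read on C^(n + d) through a local inverse s of pi;
   the coordinates are (a_1, ..., a_n, m_1, ..., m_d). *)
Definition in_chart (R : realType) (n d : nat) (X : Type) (V : Type)
    (f : X -> 'rV[C R]_d -> V) (s : 'rV[C R]_n -> X) (y : 'rV[C R]_(n + d)) : V :=
  f (s (lsubmx y)) (rsubmx y).

Definition chart_dom (R : realType) (n d : nat) (X : Type)
    (D : set (X * 'rV[C R]_d)) (V : set 'rV[C R]_n) (s : 'rV[C R]_n -> X) :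
    set 'rV[C R]_(n + d) :=
  [set y | V (lsubmx y) /\ D (s (lsubmx y), rsubmx y)].

Definition partial_a (R : realType) (n d : nat) (V : normedModType (C R))
    (mu : 'I_n) (f : 'rV[C R]_(n + d) -> V) (y : 'rV[C R]_(n + d)) : V :=
  partial (lshift d mu) f y.

Definition partial_m (R : realType) (n d : nat) (V : normedModType (C R))
    (k : 'I_d) (f : 'rV[C R]_(n + d) -> V) (y : 'rV[C R]_(n + d)) : V :=
  partial (rshift n k) f y.

(* W is the range of local coordinates on the space of monodromy data, whose
   point m has exponents theta nu m, connection matrices Cm nu m and
   normalization Ginf m.  D is the set of (x, m) at which the inverse monodromy
   problem is solvable; its complement in X x W is the polar locus of A and G. *)
Record isomonodromic_family (R : realType) (n N d : nat) (X Y : topologicalType)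
    (pi : X -> 'rV[C R]_n) (rho : Y -> 'rV[C R]_n * C R) (q : Y -> X)
    (ell : option 'I_n -> X * C R -> Y)
    (W : set 'rV[C R]_d) (D : set (X * 'rV[C R]_d))
    (theta : option 'I_n -> 'rV[C R]_d -> 'rV[C R]_N)
    (Cm : option 'I_n -> 'rV[C R]_d -> 'M[C R]_N)
    (Ginf : 'rV[C R]_d -> 'M[C R]_N)
    (A G : option 'I_n -> X -> 'rV[C R]_d -> 'M[C R]_N)
    (Phi : Y -> 'rV[C R]_d -> 'M[C R]_N) : Prop := IsomonodromicFamily {
  im_W : open W;
  im_D : open D;
  im_DW : forall x m, D (x, m) -> W m;
  im_theta_hol : forall nu, holomorphic W (theta nu);
  im_Cm_hol : forall nu, holomorphic W (Cm nu);
  im_Ginf_hol : holomorphic W Ginf;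
  im_A_hol : forall nu V s, local_section pi V s ->
    holomorphic (chart_dom D V s) (in_chart (A nu) s);
  im_G_hol : forall nu V s, local_section pi V s ->
    holomorphic (chart_dom D V s) (in_chart (G nu) s);
  (* for each m, A and G are meromorphic on X, with common local denominator h *)
  im_mero : forall m x0, W m -> exists V s (h : 'rV[C R]_n -> C R),
    [/\ local_section pi V s, V (pi x0) /\ s (pi x0) = x0,
        holomorphic V h,
        V `<=` closure [set a | V a /\ h a != 0] /\
        (forall a, V a -> h a != 0 -> D (s a, m)) &
        forall nu, exists P Q : 'rV[C R]_n -> 'M[C R]_N,
          [/\ holomorphic V P, holomorphic V Q &
              forall a, V a -> h a != 0 ->
                A nu (s a) m = (h a)^-1 *: P a /\
                G nu (s a) m = (h a)^-1 *: Q a]];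
  im_sl : forall nu x m, D (x, m) -> \tr (A nu x m) = 0;
  im_Ainf : forall x m, D (x, m) ->
    A None x m = - \sum_(nu < n) A (Some nu) x m;
  im_nonres : forall nu m, W m -> forall k l : 'I_N, k != l ->
    forall z : int, theta nu m 0 k - theta nu m 0 l != z%:~R;
  im_G_unit : forall nu x m, D (x, m) -> G nu x m \in unitmx;
  im_diag : forall nu x m, D (x, m) ->
    A nu x m = G nu x m *m diag_mx (theta nu m) *m invmx (G nu x m);
  im_Ginf : forall x m, D (x, m) -> G None x m = Ginf m;
  im_Phi_unit : forall y m, D (q y, m) -> Phi y m \in unitmx;
  im_Phi_ode : forall U (t : 'rV[C R]_n * C R -> Y) a z m,
    local_section rho U t -> U (a, z) -> D (q (t (a, z)), m) ->
    is_derive (z : C R) (1 : C R) (fun z' : C R => Phi (t (a, z')) m)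
      ((\sum_(nu < n) (z - a 0 nu)^-1 *: A (Some nu) (q (t (a, z))) m)
         *m Phi (t (a, z)) m);
  im_Cm_unit : forall nu m, W m -> Cm nu m \in unitmx;
  im_Phi_loc : forall nu x m, D (x, m) ->
    exists (g : nat -> 'M[C R]_N) (eps : C R), 0 < eps /\
      forall w, near_singularity nu (pi x) w -> `|expC w| < eps ->
        let S := series (fun j : nat => expC w ^+ j.+1 *: g j.+1) in
        cvgn S /\
        Phi (ell nu (x, w)) m =
          G nu x m *m (1%:M + limn S)
          *m diag_mx (\row_k expC (w * theta nu m 0 k)) *m Cm nu m;
  im_dA : forall V s y (mu nu : 'I_n),
    local_section pi V s -> chart_dom D V s y -> mu != nu ->
    let a := lsubmx y in
    let B k := in_chart (A (Some k)) s y in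
    partial_a mu (in_chart (A (Some nu)) s) y =
      (a 0 mu - a 0 nu)^-1 *: (B mu *m B nu - B nu *m B mu);
  im_dA_diag : forall V s y (nu : 'I_n),
    local_section pi V s -> chart_dom D V s y ->
    let a := lsubmx y in
    let B k := in_chart (A (Some k)) s y in
    partial_a nu (in_chart (A (Some nu)) s) y =
      - \sum_(mu < n | mu != nu)
          (a 0 mu - a 0 nu)^-1 *: (B mu *m B nu - B nu *m B mu);
  im_dG : forall V s y (mu nu : 'I_n),
    local_section pi V s -> chart_dom D V s y -> mu != nu ->
    let a := lsubmx y in
    partial_a mu (in_chart (G (Some nu)) s) y
      *m invmx (in_chart (G (Some nu)) s y) =
      (a 0 mu - a 0 nu)^-1 *: in_chart (A (Some mu)) s y;
  im_dG_diag : forall V s y (nu : 'I_n),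
    local_section pi V s -> chart_dom D V s y ->
    let a := lsubmx y in
    partial_a nu (in_chart (G (Some nu)) s) y
      *m invmx (in_chart (G (Some nu)) s y) =
      - \sum_(mu < n | mu != nu)
          (a 0 mu - a 0 nu)^-1 *: in_chart (A (Some mu)) s y
}.

(* d ln (a_mu - a_nu) *)
Definition dln_diff (R : realType) (n d : nat) (mu nu : 'I_n)
    (y : 'rV[C R]_(n + d)) : 'rV[C R]_(n + d) :=
  (lsubmx y 0 mu - lsubmx y 0 nu)^-1 *:
    (basis R (lshift d mu) - basis R (lshift d nu)).

(* Tr (Theta g^-1 d_M g): no components along the da_mu *)
Definition Tr_Theta_GdG (R : realType) (n N d : nat) (theta : 'rV[C R]_d -> 'rV[C R]_N)
    (g : 'rV[C R]_(n + d) -> 'M[C R]_N) (y : 'rV[C R]_(n + d)) :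
    'rV[C R]_(n + d) :=
  row_mx 0 (\row_(k < d)
    \tr (diag_mx (theta (rsubmx y)) *m invmx (g y) *m partial_m k g y)).

Definition omega (R : realType) (n N d : nat) (X : Type)
    (theta : option 'I_n -> 'rV[C R]_d -> 'rV[C R]_N)
    (A G : option 'I_n -> X -> 'rV[C R]_d -> 'M[C R]_N)
    (s : 'rV[C R]_n -> X) (y : 'rV[C R]_(n + d)) : 'rV[C R]_(n + d) :=
  \sum_(mu < n) \sum_(nu < n | (nu < mu)%N)
    \tr (in_chart (A (Some mu)) s y *m in_chart (A (Some nu)) s y)
      *: dln_diff mu nu y
  + \sum_(nu : option 'I_n) Tr_Theta_GdG (theta nu) (in_chart (G nu) s) y.

Definition pullback_M (R : realType) (n d : nat) (Om : 'rV[C R]_d -> 'M[C R]_d)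
    (y : 'rV[C R]_(n + d)) : 'M[C R]_(n + d) :=
  block_mx 0 0 0 (Om (rsubmx y)).

(* Main.v *)
(* In a chart write omega = sum_k H_k da_k + sum_k J_k dm_k.  The equations for
   the a-derivatives of A and G give dH_k/da_l = dH_l/da_k and
   dJ_k/da_l = dH_l/dm_k, so d omega has only dm /\ dm components
   dJ_l/dm_k - dJ_k/dm_l.  By the second identity and the symmetry of second
   derivatives, these have zero a-derivative, and they are closed.

   Second derivatives exist because the partial derivatives of a holomorphic
   (C^1) function are again holomorphic, which is Cauchy's formula: the average
   J(s) of f(y + s e^{i t} e_k) e^{-i t} over t satisfies s J'(s) = J(s), whence
   J(r) = r df/dy_k (y).

   For fixed m, the components are locally constant on the set D_m of x where
   the inverse monodromy problem is solvable.  Locally D_m contains the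
   complement of the zeros of a holomorphic function h, and there a locally
   constant function takes the same value at two nearby points a and b: otherwise h^2 on the part
   of the disc through a and b where it has the value at b, extended by 0, would
   be a holomorphic function contradicting the identity theorem.  The universal
   cover being path connected, the value is then the same on all of D_m. *)
Require Import Defs.
From HB Require Import structures.
From mathcomp Require Import all_boot all_order all_algebra.
From mathcomp Require Import all_classical all_reals all_analysis.
From mathcomp Require Import complex perm.
From mathcomp Require Import ring lra.

Set Implicit Arguments.
Unset Strict Implicit.
Unset Printing Implicit Defensive.

Import Order.TTheory GRing.Theory Num.Theory.
Import numFieldNormedType.Exports.

Local Open Scope classical_set_scope.
Local Open Scope ring_scope.

(** The set D_m is not known to be connected, so local constancy on it does not yet give a single
    value: the poles have to be crossed. For this a local value is attached to every point of the
    cover, poles included, and a path needs no detour around the polar locus. The crossing itself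
    takes place in one complex variable, on the line through two points. The field [C R] is used as
    a normed module over itself, so functions of a real parameter have their own derivative
    [rderive], and an integral over [0, 1] is the increment of an antiderivative. Integrals are
    estimated by the mean value theorem on real and imaginary parts, at the price of a factor 2 that
    recurs in the constants. Two algebraic facts make the components along the times vanish. In
    dJ_k/da_l the terms with an undifferentiated coefficient matrix of the equation for G cancel,
    and the rest is a trace against the residues. In dH_k/da_l, for l different from k, the motion
    of the residues contributes nothing, by partial fractions, and Tr(A_l A_k) / (a_l - a_k)^2
    remains, which is symmetric. *)

Local Notation re := (@complex.Re _).
Local Notation im := (@complex.Im _).

(** * Complex numbers over R and derivatives in a real parameter *)

Section ComplexPlane.
Variable R : realType.
Local Notation C := (C R).

Definition rC (x : R) : C := (x%:C)%C.

Lemma rCD x y : rC (x + y) = rC x + rC y.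
Proof. exact: (rmorphD (real_complex R)). Qed.

Lemma rCM x y : rC (x * y) = rC x * rC y.
Proof. exact: (rmorphM (real_complex R)). Qed.

Lemma rCN x : rC (- x) = - rC x.
Proof. exact: (rmorphN (real_complex R)). Qed.

Lemma rCB x y : rC (x - y) = rC x - rC y.
Proof. exact: (rmorphB (real_complex R)). Qed.

Lemma rCV x : rC x^-1 = (rC x)^-1.
Proof. exact: (fmorphV (real_complex R)). Qed.

Lemma rC0 : rC 0 = 0. Proof. by []. Qed.

Lemma rC1 : rC 1 = 1. Proof. by []. Qed.

Lemma rC_eq0 x : (rC x == 0) = (x == 0).
Proof. exact: (fmorph_eq0 (real_complex R)). Qed.

Lemma ler_rC x y : (rC x <= rC y) = (x <= y).
Proof. by rewrite (_ : (rC x <= rC y) = (x%:C <= y%:C)%C) // lecR. Qed.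

Lemma ltr_rC x y : (rC x < rC y) = (x < y).
Proof. by rewrite (_ : (rC x < rC y) = (x%:C < y%:C)%C) // ltcR. Qed.

Lemma norm_rC x : `|rC x| = rC `|x|.
Proof.
have [x0|/ltW x0] := leP 0 x.
  by rewrite (ger0_norm x0) ger0_norm // -rC0 ler_rC.
by rewrite (ler0_norm x0) rCN ler0_norm // -rC0 ler_rC.
Qed.

Lemma rC_re (e : C) : 0 < e -> e = rC (re e).
Proof. by move=> /gtr0_real; move/RRe_real => /esym. Qed.

Lemma re_gt0 (e : C) : 0 < e -> 0 < re e.
Proof. by move=> e0; rewrite -ltr_rC -(rC_re e0). Qed.

Lemma re_rCM x z : re (rC x * z) = x * re z.
Proof. by case: z => a b /=; rewrite mul0r subr0. Qed.

Lemma im_rCM x z : im (rC x * z) = x * im z.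
Proof. by case: z => a b /=; rewrite mul0r addr0. Qed.

Lemma reB (z w : C) : re (z - w) = re z - re w.
Proof. by case: z w => a b [c d]. Qed.

Lemma imB (z w : C) : im (z - w) = im z - im w.
Proof. by case: z w => a b [c d]. Qed.

Lemma norm_re (z : C) (M : R) : `|z| <= rC M -> `|re z| <= M.
Proof. by move=> zM; rewrite -ler_rC; apply: le_trans zM; exact: normc_ge_Re. Qed.

Lemma norm_i : `|'i%C : C| = 1.
Proof. by rewrite normc_def /= expr0n expr1n add0r sqrtr1. Qed.

Lemma norm_im (z : C) (M : R) : `|z| <= rC M -> `|im z| <= M.
Proof.
move=> zM; have := @norm_re (z * 'i%C) M.
by rewrite normrM norm_i mulr1 => /(_ zM); case: z zM => a b /=; rewrite mulr0 mulr1 sub0r normrN.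
Qed.

Lemma reimE (z : C) : z = rC (re z) + 'i%C * rC (im z).
Proof. exact: complexE. Qed.

Lemma norm_reim (z : C) : `|z| <= rC (`|re z| + `|im z|).
Proof.
rewrite {1}(reimE z); apply: le_trans (ler_normD _ _) _.
by rewrite normrM norm_i mul1r !norm_rC rCD.
Qed.

Lemma continuous_rC : continuous (rC : R -> C).
Proof.
move=> x; apply/cvgrPdist_lt => e e0.
have r0 := re_gt0 e0.
near=> y; rewrite -rCB norm_rC (rC_re e0) ltr_rC.
near: y; exact: (@cvgr_dist_lt _ R^o).
Unshelve. all: by end_near. Qed.

Lemma continuous_re : continuous (re : C -> R).
Proof.
move=> x; apply/(@cvgrPdist_lt _ R^o _ (nbhs x) _) => e e0.
have r0 : 0 < rC e by rewrite -rC0 ltr_rC.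
near=> y; rewrite -reB -ltr_rC; apply: le_lt_trans (normc_ge_Re _) _.
near: y; exact: (@cvgr_dist_lt _ _ _ (nbhs x) _ id).
Unshelve. all: by end_near. Qed.

Lemma continuous_im : continuous (im : C -> R).
Proof.
have -> : (im : C -> R) = (fun z => re (- 'i%C * z)).
  by apply/funext => -[a b] /=; rewrite oppr0 mul0r sub0r mulN1r opprK.
move=> x; have mc : {for x, continuous (fun z : C => (- 'i%C * z : C))}.
  by apply: (@cvgM _ _ (nbhs x)); [exact: cvg_cst|exact: cvg_id].
exact: (continuous_comp mc (@continuous_re _)).
Qed.

Lemma cvg_reim (T : Type) (F : set_system T) {FF : Filter F} (f : T -> C) (z : C) :
  (fun t => re (f t)) @ F --> re z -> (fun t => im (f t)) @ F --> im z -> f @ F --> z.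
Proof.
move=> fr fi; rewrite (reimE z).
have -> : f = (fun t => rC (re (f t)) + 'i%C * rC (im (f t))).
  by apply/funext => t; exact: reimE.
apply: cvgD; first by apply: continuous_cvg fr; exact: continuous_rC.
apply: cvgM; first exact: cvg_cst.
by apply: continuous_cvg fi; exact: continuous_rC.
Qed.

Lemma cvgCD (T : Type) (F : set_system T) {FF : Filter F} (f g : T -> C) (a b : C) :
  f @ F --> a -> g @ F --> b -> (fun t => f t + g t) @ F --> a + b.
Proof. by move=> fa gb; exact: (cvgD fa gb). Qed.

Lemma cvgCB (T : Type) (F : set_system T) {FF : Filter F} (f g : T -> C) (a b : C) :
  f @ F --> a -> g @ F --> b -> (fun t => f t - g t) @ F --> a - b.
Proof. by move=> fa gb; exact: (cvgB fa gb). Qed.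

Lemma cvgCM (T : Type) (F : set_system T) {FF : Filter F} (f g : T -> C) (a b : C) :
  f @ F --> a -> g @ F --> b -> (fun t => f t * g t) @ F --> a * b.
Proof. by move=> fa gb; exact: (cvgM fa gb). Qed.

(** Derivative of a complex-valued function of a real variable. As [C R] is treated as a normed
    module over itself and not over [R], the real step enters through [rC]. *)
Definition rderive (g : R -> C) (t : R) (g' : C) : Prop :=
  (fun h => rC h^-1 * (g (t + h) - g t)) @ 0^' --> g'.

(** A continuous real-linear functional passes through the difference quotient. It is used with the
    real and the imaginary part, to which the real mean value theorem applies. *)
Lemma rderive_is_derive (g : R -> C) t g' (l : C -> R) :
  continuous l -> (forall x z w, l (rC x * (z - w)) = x * (l z - l w)) ->
  rderive g t g' -> is_derive t (1 : R) (fun u => l (g u) : R^o) (l g' : R^o).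
Proof.
move=> lc ll gg.
have H : (fun h : R => h^-1 *: (((fun u => l (g u) : R^o) \o shift t) (h *: (1:R)) - l (g t))) @ 0^' --> (l g' : R^o).
  have -> : (fun h : R => h^-1 *: (((fun u => l (g u) : R^o) \o shift t) (h *: (1:R)) - l (g t)))
     = (fun h => l (rC h^-1 * (g (t + h) - g t))).
    by apply/funext => h; rewrite ll /= [h *: 1]mulr1 [h + t]addrC.
  by apply: continuous_cvg gg; exact: lc.
by apply: DeriveDef; [apply/cvg_ex; eexists; exact: H|exact: cvg_lim H].
Qed.

Lemma rderive_re (g : R -> C) t g' : rderive g t g' ->
  is_derive t (1 : R) (fun u => re (g u) : R^o) (re g' : R^o).
Proof.
apply: rderive_is_derive; first exact: continuous_re.
by move=> x z w; rewrite re_rCM reB.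
Qed.

Lemma rderive_im (g : R -> C) t g' : rderive g t g' ->
  is_derive t (1 : R) (fun u => im (g u) : R^o) (im g' : R^o).
Proof.
apply: rderive_is_derive; first exact: continuous_im.
by move=> x z w; rewrite im_rCM imB.
Qed.

Lemma rderive_reim (g : R -> C) t (g' : C) :
  is_derive t (1 : R) (fun u => re (g u) : R^o) (re g' : R^o) ->
  is_derive t (1 : R) (fun u => im (g u) : R^o) (im g' : R^o) -> rderive g t g'.
Proof.
move=> [/cvg_ex [a ha] ra] [/cvg_ex [b hb] rb].
have ea : a = re g' by rewrite -ra; apply/esym; exact: cvg_lim ha.
have eb : b = im g' by rewrite -rb; apply/esym; exact: cvg_lim hb.
apply: cvg_reim.
  rewrite -ea; move: ha; set F := (X in X @ _ --> _ -> _); suff -> : F = (fun h => re (rC h^-1 * (g (t + h) - g t))) by [].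
  by apply/funext => h; rewrite /F re_rCM reB /= [h *: 1]mulr1 [h + t]addrC.
rewrite -eb; move: hb; set F := (X in X @ _ --> _ -> _); suff -> : F = (fun h => im (rC h^-1 * (g (t + h) - g t))) by [].
by apply/funext => h; rewrite /F im_rCM imB /= [h *: 1]mulr1 [h + t]addrC.
Qed.

Lemma rderive_cvg (g : R -> C) t g' : rderive g t g' ->
  (fun h => g (t + h)) @ (0 : R)^' --> g t.
Proof.
move=> gg.
apply: (@cvg_trans _ ((fun h => g t + rC h * (rC h^-1 * (g (t + h) - g t))) @ (0 : R)^')).
  apply: near_eq_cvg; near=> h; rewrite mulrA -rCM divff; last first.
    by near: h; exact: nbhs_dnbhs_neq.
  by rewrite rC1 mul1r addrC subrK.
have rc : (fun h => rC h) @ (0 : R)^' --> (0 : C).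
  have id0 : (fun h : R => h) @ (0 : R)^' --> (0 : R) by exact: nbhs_dnbhs.
  exact: (@cvg_comp _ _ _ (fun h : R => h) rC _ _ _ id0 (@continuous_rC 0)).
have gc : (fun _ : R => g t) @ (0 : R)^' --> g t by exact: cvg_cst.
have H : (fun h => g t + rC h * (rC h^-1 * (g (t + h) - g t))) @ (0 : R)^' --> g t + 0 * g'.
  exact: cvgCD gc (cvgCM rc gg).
move: H; rewrite mul0r addr0; exact.
Unshelve. all: by end_near. Qed.

Lemma rderive_continuous (g : R -> C) t g' : rderive g t g' -> g @ t --> g t.
Proof.
move=> /rderive_cvg gt.
apply/cvgrPdist_lt => e e0; have := gt; move/cvgrPdist_lt => /(_ e e0).
rewrite near_withinE => H.
have [d d0 dP] := (iffLR (@nbhs_ballP _ R^o _ _)) H.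
apply/(@nbhs_ballP _ R^o); exists d => // s /= ts.
have [->|st] := eqVneq s t; first by rewrite subrr normr0.
have := dP (s - t); rewrite [t + _]addrC subrK; apply.
  by move: ts; rewrite -!ball_normE /= sub0r normrN distrC.
by rewrite subr_eq0.
Qed.

Lemma rderive_cst (c : C) t : rderive (fun=> c) t 0.
Proof.
rewrite /rderive (_ : (fun _ => _) = (fun=> 0)); first exact: cvg_cst.
by apply/funext => h; rewrite subrr mulr0.
Qed.

Lemma rderive_rC t : rderive rC t 1.
Proof.
rewrite /rderive; apply: (@cvg_trans _ ((fun=> 1 : C) @ (0:R)^')); last exact: cvg_cst.
apply: near_eq_cvg; near=> h.
rewrite rCD [_ + rC h]addrC addrK -rCM mulVf //.
by near: h; exact: nbhs_dnbhs_neq.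
Unshelve. all: by end_near. Qed.

Lemma rderiveD f g t f' g' : rderive f t f' -> rderive g t g' ->
  rderive (fun u => f u + g u) t (f' + g').
Proof.
move=> ff gg; rewrite /rderive.
rewrite (_ : (fun _ => _) = (fun h => rC h^-1 * (f (t + h) - f t) + rC h^-1 * (g (t + h) - g t))).
  exact: cvgCD ff gg.
by apply/funext => h; rewrite -mulrDr opprD addrACA.
Qed.

Lemma rderiveM f g t f' g' : rderive f t f' -> rderive g t g' ->
  rderive (fun u => f u * g u) t (f' * g t + f t * g').
Proof.
move=> ff gg; rewrite /rderive.
rewrite (_ : (fun _ => _) = (fun h => rC h^-1 * (f (t + h) - f t) * g (t + h) + f t * (rC h^-1 * (g (t + h) - g t)))).
  apply: cvgCD; first exact: cvgCM ff (rderive_cvg gg).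
  have fc : (fun _ : R => f t) @ (0:R)^' --> f t by exact: cvg_cst.
  exact: cvgCM fc gg.
by apply/funext => h; ring.
Qed.

Lemma rderiveMc f t f' c : rderive f t f' -> rderive (fun u => f u * c) t (f' * c).
Proof.
by move=> ff; have := rderiveM ff (rderive_cst c t); rewrite mulr0 addr0.
Qed.

Lemma rderive_comp (f : C -> C) (g : R -> C) t (f' g' : C) :
  is_derive (g t) (1 : C) f f' -> rderive g t g' -> rderive (f \o g) t (f' * g').
Proof.
move=> [/cvg_ex [l fl] lf] gg.
have el : l = f' by rewrite -lf; apply/esym; exact: cvg_lim fl.
rewrite {}el in fl.
(* The difference quotient of [f], completed by [f'] at 0, is continuous at 0, so steps with
   [g (t + h) = g t] need no separate treatment. *)
pose q (w : C) := if w == 0 then f' else w^-1 * (f (w + g t) - f (g t)).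
have qc : q @ (0 : C) --> f'.
  apply/(@cvgrPdist_lt _ _ _ (nbhs (0 : C)) _) => e e0.
  have := fl; move/(@cvgrPdist_lt _ _ _ (0 : C)^' _) => /(_ e e0).
  rewrite near_withinE; apply: filterS => w H; rewrite /q.
  have [_|w0] := eqVneq w 0; first by rewrite subrr normr0.
  by have := H w0; rewrite /= [w *: 1]mulr1.
rewrite /rderive (_ : (fun _ => _) =
    (fun h => q (g (t + h) - g t) * (rC h^-1 * (g (t + h) - g t)))).
  have gc : (fun _ : R => g t) @ (0 : R)^' --> g t by exact: cvg_cst.
  have dc : (fun h => g (t + h) - g t) @ (0 : R)^' --> (0 : C).
    rewrite -(subrr (g t)); exact: cvgCB (rderive_cvg gg) gc.
  have qd : (fun h => q (g (t + h) - g t)) @ (0 : R)^' --> f'.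
    exact: (@cvg_comp _ _ _ (fun h => g (t + h) - g t) q _ (nbhs (0 : C)) _ dc qc).
  exact: cvgCM qd gg.
apply/funext => h; rewrite /q; have [w0|w0] := eqVneq.
  by rewrite w0 mulr0 mulr0 /= (subr0_eq w0) subrr mulr0.
by rewrite subrK /= [RHS]mulrCA mulrAC mulVf // mul1r.
Qed.

End ComplexPlane.

(** * Integration over the unit interval by antiderivatives *)

Section UnitIntervalIntegral.
Variable R : realType.
Local Notation C := (C R).
Implicit Types (f g h : R -> C).

Lemma rderive_MVT (l : C -> R) (g g' : R -> C) :
  (forall t : R, 0 <= t <= 1 -> rderive g t (g' t)) ->
  (forall t d, rderive g t d -> is_derive t (1 : R) (fun u => l (g u) : R^o) (l d : R^o)) ->
  exists2 c, 0 <= c <= 1 & l (g 1) - l (g 0) = l (g' c).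
Proof.
move=> gg lg.
have [||c] := @MVT_segment R (fun u => l (g u)) (fun u => l (g' u)) 0 1 ler01.
- move=> x; rewrite in_itv /= => /andP[x0 x1]; apply: lg; apply: gg.
  by rewrite (ltW x0) (ltW x1).
- apply: derivable_within_continuous => x; rewrite in_itv /= => x01.
  by have [] := lg _ _ (gg _ x01).
by rewrite in_itv /= subr0 mulr1 => c01 ->; exists c.
Qed.

(** The factor 2 arises because the mean value theorem is applied to the real and the imaginary part
    separately, at two different points. *)
Lemma rderive_MVI (g g' : R -> C) (M : R) :
  (forall t : R, 0 <= t <= 1 -> rderive g t (g' t)) ->
  (forall t : R, 0 <= t <= 1 -> `|g' t| <= rC M) -> `|g 1 - g 0| <= rC (2 * M).
Proof.
move=> gg gM; apply: le_trans (norm_reim _) _; rewrite ler_rC mulr2n mulrDl mul1r.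
have [c c01 rc] := rderive_MVT gg (@rderive_re R g).
have [d d01 ic] := rderive_MVT gg (@rderive_im R g).
rewrite reB imB rc ic; apply: lerD; [exact/norm_re/gM|exact/norm_im/gM].
Qed.

Lemma rderive_cst01 (g : R -> C) :
  (forall t : R, 0 <= t <= 1 -> rderive g t 0) -> g 1 = g 0.
Proof.
move=> gg; apply/eqP; rewrite -subr_eq0 -normr_le0.
have := @rderive_MVI g (fun=> 0) 0 gg; rewrite mulr0; apply => t _.
by rewrite normr0.
Qed.

Lemma real_antiderivative (f : R -> R) : continuous f ->
  exists F : R -> R, forall t : R, 0 <= t <= 1 -> is_derive t (1 : R) (F : R -> R^o) (f t : R^o).
Proof.
(* Integrating from -1, inside an interval that ends at 2, puts all of [0, 1] in the interior, so
   the derivative is two-sided at both ends. *)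
move=> fc; pose a : itv_bound R := BLeft (-1).
pose F (x : R) := (\int[lebesgue_measure]_(t in [set` Interval a (BRight x)]) f t)%R.
exists F => t /andP[t0 t1].
have int : lebesgue_measure.-integrable [set` Interval a (BRight (2 : R))] (EFin \o f).
  apply: continuous_compact_integrable; first exact: segment_compact.
  exact: continuous_subspaceT.
have t2 : t < 2 by apply: le_lt_trans t1 _; rewrite ltr1n.
have at_ : (a < BRight t)%E by rewrite /a /= lte_fin; apply: lt_le_trans t0; rewrite ltrN10.
have [d1 d2] := continuous_FTC1 t2 int at_ (fc t).
apply: DeriveDef; first exact: d1.
rewrite -d2 derive1E; exact: erefl.
Qed.

Definition antiderivative (g : R -> C) (G : R -> C) :=
  forall t : R, 0 <= t <= 1 -> rderive G t (g t).

Lemma antiderivative_ex g : continuous g -> exists G, antiderivative g G.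
Proof.
move=> gc.
have rc : continuous (fun t => re (g t)).
  by move=> t; exact: (continuous_comp (gc t) (@continuous_re R (g t))).
have ic : continuous (fun t => im (g t)).
  by move=> t; exact: (continuous_comp (gc t) (@continuous_im R (g t))).
have [F FP] := real_antiderivative rc.
have [G GP] := real_antiderivative ic.
exists (fun t => (F t +i* G t)%C) => t t01.
by apply: rderive_reim; [exact: FP|exact: GP].
Qed.

(* The integral of g over [0, 1]; junk when g has no antiderivative. *)
Definition cI (g : R -> C) : C :=
  let G := xget (fun=> 0) (antiderivative g) in G 1 - G 0.

(** Two antiderivatives differ by a function with derivative 0, hence have the same increment,
    whichever one the choice operator picks. *)
Lemma cI_FTC g G : antiderivative g G -> cI g = G 1 - G 0.
Proof.
move=> gG; rewrite /cI; set H := xget _ _.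
have gH : antiderivative g H by apply: xgetPex; exists G.
have E t : 0 <= t <= 1 -> rderive (fun u => H u + G u * (-1)) t 0.
  move=> t01; rewrite -[X in rderive _ _ X](subrr (g t)) -[X in _ - X]mulr1 -mulrN.
  by apply: rderiveD; [exact: gH|apply: rderiveMc; exact: gG].
have := rderive_cst01 E; rewrite !mulrN1 => /eqP.
rewrite subr_eq addrAC -addrA => /eqP ->.
by rewrite [H 0 + _]addrC addrK.
Qed.

Lemma cI_D f g : continuous f -> continuous g -> cI (fun t => f t + g t) = cI f + cI g.
Proof.
move=> /antiderivative_ex[F FP] /antiderivative_ex[G GP].
rewrite (cI_FTC FP) (cI_FTC GP) (@cI_FTC _ (fun t => F t + G t)).
  by rewrite opprD addrACA.
by move=> t t01; apply: rderiveD; [exact: FP|exact: GP].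
Qed.

Lemma cI_Mc f c : continuous f -> cI (fun t => f t * c) = cI f * c.
Proof.
move=> /antiderivative_ex[F FP]; rewrite (cI_FTC FP) (@cI_FTC _ (fun t => F t * c)).
  by rewrite mulrBl.
by move=> t t01; apply: rderiveMc; exact: FP.
Qed.

Lemma cI_cst c : cI (fun=> c) = c.
Proof.
rewrite (@cI_FTC _ (fun t => rC t * c)); first by rewrite mul1r mul0r subr0.
move=> t _; rewrite -[X in rderive _ _ X]mul1r; exact/rderiveMc/rderive_rC.
Qed.

Lemma continuousCM f g : continuous f -> continuous g -> continuous (fun t => f t * g t).
Proof. by move=> fc gc t; exact: (cvgCM (fc t) (gc t)). Qed.

Lemma continuousCD f g : continuous f -> continuous g -> continuous (fun t => f t + g t).
Proof. by move=> fc gc t; exact: (cvgCD (fc t) (gc t)). Qed.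

Lemma continuousCB f g : continuous f -> continuous g -> continuous (fun t => f t - g t).
Proof. by move=> fc gc t; exact: (cvgCB (fc t) (gc t)). Qed.

Lemma continuousCc (c : C) : continuous (fun _ : R => c).
Proof. by move=> t; exact: cvg_cst. Qed.

Lemma cI_B f g : continuous f -> continuous g -> cI (fun t => f t - g t) = cI f - cI g.
Proof.
move=> fc gc; have gN := continuousCM gc (@continuousCc (-1)).
rewrite -mulrN1 -(cI_Mc _ gc) -(cI_D fc gN); congr cI; apply/funext => t.
by rewrite mulrN1.
Qed.

Lemma cI_sum n (f : 'I_n -> R -> C) : (forall i, continuous (f i)) ->
  cI (fun t => \sum_(i < n) f i t) = \sum_(i < n) cI (f i) /\
  continuous (fun t => \sum_(i < n) f i t).
Proof.
elim: n f => [|n IH] f fc.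
  rewrite big_ord0 -[RHS](cI_cst 0); split.
    by congr cI; apply/funext => t; rewrite big_ord0.
  rewrite (_ : (fun _ => _) = (fun=> 0)); first exact: continuousCc.
  by apply/funext => t; rewrite big_ord0.
have [E1 E2] := IH (fun i => f (widen_ord (leqnSn n) i)) (fun i => fc _).
rewrite (_ : (fun _ => _) = (fun t => \sum_(i < n) f (widen_ord (leqnSn n) i) t + f ord_max t)).
  rewrite (cI_D E2 (fc _)) E1 big_ord_recr; split; first by [].
  exact: (continuousCD E2 (fc _)).
by apply/funext => t; rewrite big_ord_recr.
Qed.

Lemma cI_norm g (M : R) : continuous g ->
  (forall t : R, 0 <= t <= 1 -> `|g t| <= rC M) -> `|cI g| <= rC (2 * M).
Proof.
move=> /antiderivative_ex[G GP] gM; rewrite (cI_FTC GP).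
exact: rderive_MVI GP gM.
Qed.

(** A single real mean value is involved, so no factor is lost. The bound will show that an integral
    is nonzero without evaluating it. *)
Lemma cI_re_ge g (m : R) : continuous g ->
  (forall t : R, 0 <= t <= 1 -> m <= re (g t)) -> m <= re (cI g).
Proof.
move=> /antiderivative_ex[G GP] gM; rewrite (cI_FTC GP) reB.
by have [c c01 ->] := rderive_MVT GP (@rderive_re R G); exact: gM.
Qed.

(** The unit circle e^(2 pi i t), with period 1 to match the interval of integration. *)
Definition circ (t : R) : C := (cos (2 * pi * t) +i* sin (2 * pi * t))%C.

Lemma rderive_circ t : rderive circ t (rC (2 * pi) * 'i%C * circ t).
Proof.
have dl : is_derive t (1 : R) (fun u : R => 2 * pi * u : R^o) (2 * pi).
  by apply: is_derive_eq; rewrite [LHS]mulr1.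
apply: rderive_reim.
  have H := is_derive1_comp (is_derive_cos (2 * pi * t)) dl.
  by apply: (is_derive_eq H) => /=; ring.
have H := is_derive1_comp (is_derive_sin (2 * pi * t)) dl.
by apply: (is_derive_eq H) => /=; ring.
Qed.

Lemma continuous_circ : continuous circ.
Proof. move=> t; exact: rderive_continuous (@rderive_circ t). Qed.

Lemma norm_circ t : `|circ t| = 1.
Proof. by rewrite normc_def /= cos2Dsin2 sqrtr1. Qed.

Lemma circ_neq0 t : circ t != 0.
Proof. by rewrite -normr_eq0 norm_circ oner_eq0. Qed.

Lemma circ1 : circ 1 = circ 0.
Proof. by rewrite /circ mulr1 mulr0 cos0 sin0 mulr_natl cos2pi sin2pi. Qed.

End UnitIntervalIntegral.

(** * Differentiability uniform in the base point *)

Section StrictDifferentiability.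
Variable R : realType.
Local Notation C := (C R).

Lemma is_derive_line (V : normedModType C) (f : V -> C) (y h : V) (z : C) :
  derivable f (y + z *: h) h ->
  is_derive (z : C) (1 : C) (fun w : C => f (y + w *: h)) ('D_h f (y + z *: h)).
Proof.
move=> df.
have E : (fun k : C => k^-1 *: (((fun w : C => f (y + w *: h)) \o shift z) (k *: (1 : C)) - f (y + z *: h)))
  = (fun k : C => k^-1 *: ((f \o shift (y + z *: h)) (k *: h) - f (y + z *: h))).
  by apply/funext => k /=; rewrite [k *: 1]mulr1 scalerDl addrCA.
by apply: DeriveDef; rewrite /derivable /derive E.
Qed.

Lemma MVI_line (V : normedModType C) (f : V -> C) (y h : V) (c : C) (M : R) :
  (forall s : R, 0 <= s <= 1 -> derivable f (y + rC s *: h) h) ->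
  (forall s : R, 0 <= s <= 1 -> `|'D_h f (y + rC s *: h) - c| <= rC M) ->
  `|f (y + h) - f y - c| <= rC (2 * M).
Proof.
move=> df dM.
have H := @rderive_MVI R (fun s => f (y + rC s *: h) + rC s * - c)
  (fun s => 'D_h f (y + rC s *: h) * 1 + 1 * - c) M.
move: H; rewrite rC1 rC0 scale1r scale0r addr0 !mul1r mul0r addr0 addrAC; apply.
  move=> s s01; apply: rderiveD.
    apply: (@rderive_comp R (fun w : C => f (y + w *: h)) (@rC R)).
      exact: is_derive_line (df _ s01).
    exact: rderive_rC.
  rewrite -[X in rderive _ _ X]mul1r.
  exact: rderiveMc (@rderive_rC R s).
by move=> s s01; rewrite mulr1; exact: dM.
Qed.

(** First-order expansion whose error is uniform in the base point [y'] near [y]. Under an integral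
    sign the base point moves with the variable of integration, so an expansion at one point would
    not suffice. *)
Definition sdiff (V : normedModType C) (f : V -> C) (L : V -> V -> C) (y : V) : Prop :=
  forall e : R, 0 < e -> exists2 d : R, 0 < d & forall y' h,
    `|y' - y| < rC d -> `|h| < rC d -> `|f (y' + h) - f y' - L y' h| <= rC e * `|h|.

Lemma rC_norm (V : normedModType C) (h : V) : `|h| = rC (re `|h|).
Proof. by apply/esym/RRe_real/normr_real. Qed.

Lemma re_norm_ge0 (V : normedModType C) (h : V) : 0 <= re `|h|.
Proof. by rewrite -ler_rC rC0 -rC_norm. Qed.

Lemma sdiff_C1 (V : normedModType C) (f : V -> C) (y : V) :
  (exists2 d : R, 0 < d & forall y' h, `|y' - y| < rC d -> derivable f y' h) ->
  (forall e : R, 0 < e -> exists2 d : R, 0 < d & forall y' h, `|y' - y| < rC d ->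
     `|'D_h f y' - 'D_h f y| <= rC e * `|h|) ->
  sdiff f (fun y' h => 'D_h f y') y.
Proof.
move=> [d1 d10 df] dc e e0.
(* The derivatives at a point of the segment and at [y'] are both compared with the one at [y],
   which gives e/4 + e/4; the mean value inequality doubles the sum. *)
have [d2 d20 dM] := dc (e / 4) (divr_gt0 e0 (ltr0n _ 4)).
exists (Num.min d1 d2 / 2); first by rewrite divr_gt0 // lt_min d10.
move=> y' h yy' hd.
have near_s (s : R) : 0 <= s <= 1 -> `|y' + rC s *: h - y| < rC (Num.min d1 d2).
  move=> /andP[s0 s1]; rewrite addrAC; apply: le_lt_trans (ler_normD _ _) _.
  rewrite (splitr (Num.min d1 d2)) rCD; apply: ltrD => //.
  rewrite normrZ norm_rC ger0_norm //; apply: le_lt_trans hd.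
  by rewrite -[leRHS]mul1r ler_wpM2r // -rC1 ler_rC.
have [m1 m2] : rC (Num.min d1 d2) <= rC d1 /\ rC (Num.min d1 d2) <= rC d2.
  by rewrite !ler_rC !ge_min !lexx orbT.
have m0 : `|y' - y| < rC d2.
  have := near_s 0; rewrite rC0 scale0r addr0 lexx ler01 => /(_ isT).
  by move/lt_le_trans; apply.
rewrite (rC_norm h) -rCM.
have -> : e * re `|h| = 2 * (e / 2 * re `|h|) by field.
apply: MVI_line => s s01.
  by apply: df; apply: lt_le_trans (near_s _ s01) m1.
have e2 : e / 2 = e / 4 + e / 4 by field.
rewrite rCM -rC_norm e2 rCD mulrDl.
apply: le_trans (ler_distD ('D_h f y) _ _) _; apply: lerD.
  by apply: dM; apply: lt_le_trans (near_s _ s01) m2.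
by rewrite distrC; apply: dM.
Qed.

(** Balls have radii in [C]; this passes to real radii embedded by [rC]. *)
Lemma near_ball (V : normedModType C) (y : V) (P : V -> Prop) :
  (\forall y' \near y, P y') <->
  exists2 d : R, 0 < d & forall y', `|y' - y| < rC d -> P y'.
Proof.
split.
  move=> /nbhs_ballP[d d0 dP]; exists (re d); first exact: re_gt0.
  move=> y' yd; apply: dP; rewrite -ball_normE /ball_ /= distrC.
  by rewrite (rC_re d0).
move=> [d d0 dP]; apply/nbhs_ballP; exists (rC d); first by rewrite /= -rC0 ltr_rC.
by move=> y'; rewrite -ball_normE /ball_ /= distrC; exact: dP.
Qed.

Lemma continuous_at_dist (V W : normedModType C) (F : V -> W) (y : V) :
  {for y, continuous F} -> forall e : R, 0 < e ->
  exists2 d : R, 0 < d & forall y', `|y' - y| < rC d -> `|F y' - F y| < rC e.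
Proof.
move=> Fc e e0; apply/near_ball.
have e0' : 0 < rC e by rewrite -rC0 ltr_rC.
move/cvgrPdist_lt : Fc => /(_ _ e0').
by apply: filterS => y'; rewrite distrC.
Qed.

Lemma ler_coord_norm p (h : 'rV[C]_p) j : `|h 0 j| <= `|h|.
Proof.
rewrite [leRHS]/Num.Def.normr /= mx_normE.
exact: (le_bigmax _ (fun i : 'I_1 * 'I_p => `|h i.1 i.2|%:nng) (0, j)).
Qed.

Lemma row_basisE p (h : 'rV[C]_p) : h = \sum_j h 0 j *: Defs.basis R j.
Proof. by rewrite {1}(row_sum_delta h). Qed.

Lemma derive_rowE p (f : 'rV[C]_p -> C) y h : differentiable f y ->
  'D_h f y = \sum_j h 0 j * partial j f y.
Proof.
move=> df; rewrite deriveE // {1}(row_basisE h) linear_sum.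
by apply: eq_bigr => j _; rewrite linearZ /partial deriveE.
Qed.

Lemma ler_sum_coord p (a b : 'I_p -> C) (h : 'rV[C]_p) (e : R) : 0 <= e ->
  (forall j, `|a j - b j| <= rC e) ->
  `|\sum_j h 0 j * a j - \sum_j h 0 j * b j| <= rC (e * p%:R) * `|h|.
Proof.
move=> e0 ab; rewrite -sumrB.
apply: le_trans (ler_norm_sum _ _ _) _.
have -> : rC (e * p%:R) * `|h| = \sum_(j < p) rC e * `|h|.
  rewrite sumr_const card_ord rCM mulrAC -[RHS]mulr_natr.
  by have -> : rC (p%:R : R) = p%:R by rewrite /rC rmorph_nat.
apply: ler_sum => j _; rewrite -mulrBr normrM mulrC.
by apply: ler_pM => //; exact: ler_coord_norm.
Qed.

Lemma near_forall_fin (I : finType) (V : normedModType C) (y : V) (P : I -> V -> Prop) :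
  (forall j, exists2 d : R, 0 < d & forall y', `|y' - y| < rC d -> P j y') ->
  exists2 d : R, 0 < d & forall y', `|y' - y| < rC d -> forall j, P j y'.
Proof.
move=> H; apply/(near_ball y (fun y' => forall j, P j y')).
apply: filter_forall => j; exact/near_ball.
Qed.

Lemma sdiff_holomorphic p (U : set 'rV[C]_p) (f : 'rV[C]_p -> C) y :
  open U -> holomorphic U f -> U y ->
  sdiff f (fun y' h => \sum_j h 0 j * partial j f y') y.
Proof.
move=> oU hf Uy.
have /near_ball[d1 d10 d1P] : \forall y' \near y, U y' by exact: open_nbhs_nbhs.
have dc e : 0 < e -> exists2 d : R, 0 < d & forall y', `|y' - y| < rC d ->
    forall h, `|'D_h f y' - 'D_h f y| <= rC e * `|h|.
  move=> e0.
  have e1 : 0 < e / (p.+1)%:R by rewrite divr_gt0 // ltr0n.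
  have [d d0 dP] := @near_forall_fin 'I_p _ y (fun j y' => `|partial j f y' - partial j f y| < rC (e / p.+1%:R))
    (fun j => continuous_at_dist ((hf y Uy).2 j) e1).
  exists (Num.min d1 d); first by rewrite lt_min d10.
  move=> y' yd h.
  have [m1 m2] : `|y' - y| < rC d1 /\ `|y' - y| < rC d.
    by split; apply: lt_le_trans yd _; rewrite ler_rC ge_min lexx ?orbT.
  rewrite !derive_rowE; [|exact: (hf _ Uy).1|exact: (hf _ (d1P _ m1)).1].
  apply: le_trans (@ler_sum_coord _ _ _ _ (e / p.+1%:R) _ _) _.
  - exact: ltW.
  - by move=> j; apply: ltW; apply: dP.
  - apply: ler_wpM2r => //; rewrite ler_rC -mulrA ler_piMr ?(ltW e0) //.
    by rewrite mulrC ler_pdivrMr ?ltr0n // mul1r ler_nat.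
have := @sdiff_C1 _ f y.
move=> H e e0; have [||d d0 dP] := H _ _ e e0.
- exists d1 => // y' h yd; apply: diff_derivable; exact: (hf _ (d1P _ yd)).1.
- by move=> e1 /dc[d d0 dP]; exists d => // y' h yd; exact: dP.
exists (Num.min d1 d); first by rewrite lt_min d10.
move=> y' h yd hd.
have [m1 m2] : `|y' - y| < rC d1 /\ `|y' - y| < rC d.
  by split; apply: lt_le_trans yd _; rewrite ler_rC ge_min lexx ?orbT.
have m3 : `|h| < rC d by apply: lt_le_trans hd _; rewrite ler_rC ge_min lexx orbT.
by have := dP y' h m2 m3; rewrite derive_rowE //; exact: (hf _ (d1P _ m1)).1.
Qed.

(** The sum over the coordinates is a bounded linear map, so the estimate identifies it as the
    differential. This criterion serves integrals with a parameter, affine substitutions and glued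
    functions. *)
Lemma differentiable_row p (f : 'rV[C]_p -> C) y (c : 'I_p -> C) :
  (forall e : R, 0 < e -> exists2 d : R, 0 < d & forall h, `|h| < rC d ->
     `|f (y + h) - f y - \sum_j h 0 j * c j| <= rC e * `|h|) ->
  differentiable f y /\ forall j, partial j f y = c j.
Proof.
move=> H.
have [df dfE] : exists df : {linear 'rV[C]_p -> C}, forall h, df h = \sum_j h 0 j * c j.
  have @df : {linear 'rV[C]_p -> C}.
    exists (fun h : 'rV[C]_p => \sum_j h 0 j * c j).
    do 2![eexists]; do ?[constructor].
    - by rewrite big1 // => j _; rewrite mxE mul0r.
    - move=> h k; rewrite -big_split; apply: eq_bigr => j _.
      by rewrite mxE mulrDl.
    - move=> a h; rewrite scaler_sumr; apply: eq_bigr => j _.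
      by rewrite mxE -mulrA.
  by exists df.
have [M M0 dfM] : exists2 M : R, 0 < M & forall h, `|df h| <= rC M * `|h|.
  exists ((\sum_j re `|c j| + 1) * p.+1%:R).
    rewrite mulr_gt0 ?ltr0n // ltr_wpDl // sumr_ge0 // => j _.
    exact: re_norm_ge0.
  move=> h; have := @ler_sum_coord p c (fun=> 0) h (\sum_j re `|c j| + 1).
  rewrite [X in _ - X]big1 ?subr0 => [H1|j _]; last by rewrite mulr0.
  have Mj j : re `|c j| <= \sum_j re `|c j| + 1.
    rewrite (bigD1 j) // -addrA lerDl addr_ge0 // sumr_ge0 // => k _.
    exact: re_norm_ge0.
  rewrite dfE; apply: le_trans (H1 _ _) _.
  - rewrite addr_ge0 // sumr_ge0 // => k _; exact: re_norm_ge0.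
  - by move=> j; rewrite subr0 rC_norm ler_rC.
  - rewrite ler_wpM2r // ler_rC ler_wpM2l ?ler_nat //.
    rewrite addr_ge0 // sumr_ge0 // => k _; exact: re_norm_ge0.
have cdf : continuous df.
  move=> h; apply/(@cvgrPdist_lt _ _ _ (nbhs (h : 'rV[C]_p)) _) => e e0.
  have e1 := re_gt0 e0.
  apply: (near_ball (h : 'rV[C]_p) _).2; exists (re e / M); first by rewrite divr_gt0.
  move=> k kh; rewrite -linearB distrC in kh *.
  rewrite distrC in kh; apply: le_lt_trans (dfM _) _.
  by rewrite (rC_re e0) (rC_norm (h - k)) -rCM ltr_rC mulrC -ltr_pdivlMr // -ltr_rC -rC_norm distrC.
have E : f \o shift y = cst (f y) + df +o_ (0 : 'rV[C]_p) id.
  apply/eqaddoP => e e0; have [d d0 dP] := H _ (re_gt0 e0).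
  apply: (near_ball (0 : 'rV[C]_p) _).2; exists d => // h; rewrite subr0 => hd.
  have := dP h hd; rewrite -(rC_re e0) -dfE; set X := f _ - _ - _.
  suff -> : (f \o shift y - (cst (f y) + df)) h = X by [].
  by rewrite /X !fctE /= opprD addrA [h + y]addrC.
have dE := diff_unique cdf E.
have dfy : differentiable f y by apply/diff_locallyP; rewrite dE.
split=> // j; rewrite /partial deriveE // dE.
rewrite dfE (bigD1 j) //= mxE !eqxx mul1r big1 ?addr0 // => k kj.
by rewrite mxE eqxx (negPf kj) mul0r.
Qed.

End StrictDifferentiability.

(** * Integrals depending on a parameter *)

Section ParametricIntegral.
Variable R : realType.
Local Notation C := (C R).

Lemma continuous_dist_real (V : normedModType C) (b : R -> V) (t : R) :
  b @ t --> b t -> forall e : R, 0 < e ->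
  exists2 d : R, 0 < d & forall t', `|t' - t| < d -> `|b t' - b t| < rC e.
Proof.
move=> bc e e0; have e0' : 0 < rC e by rewrite -rC0 ltr_rC.
have H := (iffLR (cvgrPdist_lt _ _) bc) _ e0'.
have [d d0 dP] := (iffLR (@nbhs_ballP _ R^o _ _)) (H _).
exists d => // t' tt; rewrite distrC; apply: dP.
by rewrite -ball_normE /ball_ /= distrC.
Qed.

(** Compactness of [0, 1] turns the local radii into a common one. *)
Lemma uniform_in_segment (V : normedModType C) (P : R -> V -> Prop) :
  (forall t : R, 0 <= t <= 1 -> exists2 d : R, 0 < d &
     forall t' h, `|t' - t| < d -> `|h| < rC d -> P t' h) ->
  exists2 d : R, 0 < d & forall h, `|h| < rC d -> forall t : R, 0 <= t <= 1 -> P t h.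
Proof.
move=> H.
have /compact_near_coveringP cov := @segment_compact R 0 1.
have := cov V (nbhs (0 : V)) (fun h t => P t h) _.
move=> K; have /near_ball[d d0 dP] : \forall h \near (0 : V), `[(0 : R), 1] `<=` (fun t => P t h).
  apply: K => t /=; rewrite in_itv /= => /H[d d0 dP].
  exists ([set t' | `|t' - t| < d], [set h | `|h| < rC d]).
    split=> /=.
      apply/(@nbhs_ballP _ R^o); exists d => // t'.
      by rewrite -ball_normE /ball_ /= distrC.
    by apply/near_ball; exists d => // h; rewrite subr0.
  by move=> [t' h] /= [? ?]; exact: dP.
exists d => // h hd t t01; apply: dP; first by rewrite subr0.
by rewrite /= in_itv.
Qed.

Lemma continuous_cI_param (V : normedModType C) (G : V -> R -> C) (d0 : R) : 0 < d0 ->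
  (forall h, `|h| < rC d0 -> continuous (G h)) ->
  (forall e : R, 0 < e -> forall t : R, 0 <= t <= 1 -> exists2 d : R, 0 < d &
     forall t' h, `|t' - t| < d -> `|h| < rC d -> `|G h t' - G 0 t'| <= rC e) ->
  forall e : R, 0 < e -> exists2 d : R, 0 < d &
    forall h, `|h| < rC d -> `|cI (G h) - cI (G 0)| <= rC e.
Proof.
move=> d00 Gc H e e0.
have [d d1 dP] := uniform_in_segment (H _ (divr_gt0 e0 (ltr0n _ 2))).
have G0c : continuous (G 0) by apply: Gc; rewrite normr0 -rC0 ltr_rC.
exists (Num.min d0 d); first by rewrite lt_min d00.
move=> h hd.
have [m1 m2] : `|h| < rC d0 /\ `|h| < rC d.
  by split; apply: lt_le_trans hd _; rewrite ler_rC ge_min lexx ?orbT.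
rewrite -(cI_B (Gc h m1) G0c) (_ : e = 2 * (e / 2)); last by field.
apply: cI_norm; last exact: dP.
exact: continuousCB (Gc h m1) G0c.
Qed.

(** Differentiation under the integral sign: compactness makes the pointwise expansion uniform, and
    e / 2 absorbs the factor 2 of [cI_norm]. *)
Lemma cI_param (V : normedModType C) (G DG : V -> R -> C) (d0 : R) : 0 < d0 ->
  (forall h, `|h| < rC d0 -> continuous (G h)) -> (forall h, continuous (DG h)) ->
  (forall e : R, 0 < e -> forall t : R, 0 <= t <= 1 -> exists2 d : R, 0 < d &
     forall t' h, `|t' - t| < d -> `|h| < rC d ->
       `|G h t' - G 0 t' - DG h t'| <= rC e * `|h|) ->
  forall e : R, 0 < e -> exists2 d : R, 0 < d &
    forall h, `|h| < rC d -> `|cI (G h) - cI (G 0) - cI (DG h)| <= rC e * `|h|.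
Proof.
move=> d00 Gc DGc H e e0.
have [d d1 dP] := uniform_in_segment (H _ (divr_gt0 e0 (ltr0n _ 2))).
have G0c : continuous (G 0) by apply: Gc; rewrite normr0 -rC0 ltr_rC.
exists (Num.min d0 d); first by rewrite lt_min d00.
move=> h hd.
have [m1 m2] : `|h| < rC d0 /\ `|h| < rC d.
  by split; apply: lt_le_trans hd _; rewrite ler_rC ge_min lexx ?orbT.
have GBc := continuousCB (Gc h m1) G0c.
rewrite -(cI_B (Gc h m1) G0c) -(cI_B GBc (DGc h)) (rC_norm h) -rCM.
rewrite (_ : e * _ = 2 * (e / 2 * re `|h|)); last by field.
apply: cI_norm; first exact: continuousCB GBc (DGc h).
by move=> t t01; rewrite rCM -rC_norm; exact: dP.
Qed.

Section Holomorphic.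
Variables (p : nat) (U : set 'rV[C]_p) (f : 'rV[C]_p -> C).
Hypotheses (oU : open U) (hf : holomorphic U f).

Lemma holomorphic_continuous_comp (b : R -> 'rV[C]_p) : continuous b ->
  (forall t, U (b t)) -> continuous (fun t => f (b t)).
Proof.
move=> bc Ub t.
have fc := differentiable_continuous (hf (Ub t)).1.
exact: (continuous_comp (bc t) fc).
Qed.

Lemma partial_continuous_comp (b : R -> 'rV[C]_p) j : continuous b ->
  (forall t, U (b t)) -> continuous (fun t => partial j f (b t)).
Proof. by move=> bc Ub t; exact: (continuous_comp (bc t) ((hf (Ub t)).2 j)). Qed.

Lemma coord_continuous_comp (b : R -> 'rV[C]_p) j : continuous b ->
  continuous (fun t => b t 0 j).
Proof.
move=> bc t; exact: (continuous_comp (bc t) (@coord_continuous C 1 p 0 j (b t))).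
Qed.

Lemma continuous_near_bound (u : R -> C) t : u @ t --> u t ->
  exists2 d : R, 0 < d & forall t', `|t' - t| < d -> `|u t'| <= rC (re `|u t| + 1).
Proof.
move=> /continuous_dist_real /(_ 1 ltr01)[d d0 dP]; exists d => // t' /dP ut.
rewrite rCD -rC_norm -[u t'](subrK (u t)) addrC.
by apply: le_trans (ler_normD _ _) _; rewrite lerD2l ltW.
Qed.

Lemma continuousVD (V : normedModType C) (b c : R -> V) : continuous b -> continuous c ->
  continuous (fun t => b t + c t).
Proof. by move=> bc cc t; exact: (cvgD (bc t) (cc t)). Qed.

Variables (V : normedModType C) (b : R -> 'rV[C]_p) (L : R -> V -> 'rV[C]_p) (u : R -> C).
Variables (d0 K : R).
Hypotheses (d00 : 0 < d0) (K0 : 0 < K) (bc : continuous b) (uc : continuous u).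
Hypotheses (Lc : forall h, continuous (fun t => L t h)).
Hypotheses (LK : forall t h, `|L t h| <= rC K * `|h|).
Hypotheses (UL : forall t h, `|h| < rC d0 -> U (b t + L t h)).

(** The integrand is [f] along a path [b] displaced by [L t h], with weight [u]. This shape covers a
    varying radius of a circle, a varying centre, and the contraction of a circle to a point. *)
Lemma cI_param_holomorphic (e : R) : 0 < e -> exists2 d : R, 0 < d &
  forall h, `|h| < rC d ->
    `|cI (fun t => f (b t + L t h) * u t) - cI (fun t => f (b t) * u t)
      - \sum_j cI (fun t => L t h 0 j * (partial j f (b t) * u t))| <= rC e * `|h|.
Proof.
move=> e0; have L0 t : L t 0 = 0.
  by apply/eqP; rewrite -normr_le0; have := LK t 0; rewrite normr0 mulr0.
have Ub t : U (b t).
  by have := @UL t 0; rewrite L0 addr0; apply; rewrite normr0 -rC0 ltr_rC.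
have DGc h j : continuous (fun t => L t h 0 j * (partial j f (b t) * u t)).
  have Lj := @coord_continuous_comp (fun t => L t h) j (@Lc h).
  apply: (continuousCM Lj).
  have pc := @partial_continuous_comp b j (@bc) Ub.
  exact: (continuousCM pc (@uc)).
have [|||d d1 dP] := @cI_param V (fun h t => f (b t + L t h) * u t)
  (fun h t => \sum_j L t h 0 j * (partial j f (b t) * u t)) d0 d00 _ _ _ e e0.
- move=> h hd; apply: continuousCM (@uc).
  apply: holomorphic_continuous_comp; first exact: continuousVD (@bc) (@Lc h).
  by move=> t; exact: UL.
- by move=> h; have [_] := cI_sum (DGc h).
- move=> {e0} {}e e0 t t01.
  have u0 : 0 < re `|u t| + 1 by rewrite ltr_wpDl ?re_norm_ge0.
  (* Near [t] the weight is at most |u t| + 1 and the displacement at most K |h|, so this choice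
     leaves exactly e |h|. *)
  have e1 : 0 < e / ((re `|u t| + 1) * K) by rewrite divr_gt0 ?mulr_gt0.
  have [d1 d10 d1P] := sdiff_holomorphic oU hf (Ub t) e1.
  have [d2 d20 d2P] := continuous_dist_real (@bc t) d10.
  have [d3 d30 d3P] := continuous_near_bound (@uc t).
  exists (Num.min (Num.min d2 d3) (d1 / K)).
    by rewrite !lt_min d20 d30 divr_gt0.
  move=> t' h; rewrite !lt_min => /andP[/andP[/d2P bt /d3P ut] _] hd.
  have hd1 : `|h| < rC (d1 / K).
    by apply: lt_le_trans hd _; rewrite ler_rC ge_min lexx orbT.
  have Ld : `|L t' h| < rC d1.
    apply: le_lt_trans (LK _ _) _; rewrite (rC_norm h) -rCM ltr_rC mulrC.
    by rewrite -ltr_pdivlMr // -ltr_rC -rC_norm.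
  rewrite L0 addr0.
  have -> : f (b t' + L t' h) * u t' - f (b t') * u t'
      - \sum_j L t' h 0 j * (partial j f (b t') * u t')
    = (f (b t' + L t' h) - f (b t') - \sum_j L t' h 0 j * partial j f (b t')) * u t'.
    rewrite mulrBl mulrBl mulr_suml; congr (_ - _).
    by apply: eq_bigr => j _; rewrite mulrA.
  rewrite normrM.
  have HX := d1P _ _ bt Ld.
  apply: le_trans (_ : rC (e / ((re `|u t| + 1) * K)) * (rC K * `|h|) * rC (re `|u t| + 1) <= _).
    apply: ler_pM => //; apply: (le_trans HX); apply: ler_wpM2l => //.
    by rewrite -rC0 ler_rC ltW.
  rewrite (rC_norm h) -!rCM ler_rC le_eqVlt; apply/orP; left; apply/eqP.
  by field; rewrite !gt_eqF.
exists d => // h hd.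
rewrite -(cI_sum (DGc h)).1.
have -> : (fun t => f (b t) * u t) = (fun t => f (b t + L t 0) * u t).
  by apply/funext => t; rewrite L0 addr0.
exact: dP h hd.
Qed.

End Holomorphic.

End ParametricIntegral.

(** * Cauchy's formula for first derivatives *)

Section CauchyFormula.
Variable R : realType.
Local Notation C := (C R).

Lemma is_derive_dist (J : C -> C) (s D : C) :
  (forall e : R, 0 < e -> exists2 d : R, 0 < d & forall k : C, `|k| < rC d ->
     `|J (s + k) - J s - k * D| <= rC e * `|k|) ->
  is_derive (s : C) (1 : C) J D.
Proof.
move=> H.
have cv : (fun h : C => h^-1 *: ((J \o shift s) (h *: (1 : C)) - J s)) @ (0 : C)^' --> D.
  apply/(@cvgrPdist_le _ _ _ ((0 : C)^') _) => e e0.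
  have [d d0 dP] := H _ (re_gt0 e0).
  rewrite near_withinE; apply: (near_ball (0 : C) _).2; exists d => // k.
  rewrite subr0 => kd k0; have := dP k kd.
  rewrite /= [k *: 1]mulr1 [k + s]addrC -(rC_re e0) => K.
  have -> : D - k^-1 *: (J (s + k) - J s) = - (k^-1 * (J (s + k) - J s - k * D)).
    by rewrite /GRing.scale /= [in RHS]mulrBr mulrA mulVf // mul1r opprB.
  by rewrite normrN normrM normfV ler_pdivrMl ?normr_gt0 // [_ * e]mulrC.
by apply: DeriveDef; [apply/cvg_ex; eexists; exact: cv|exact: cvg_lim cv].
Qed.

Lemma is_derive_inv (z : C) : z != 0 ->
  is_derive (z : C) (1 : C) (fun w : C => w^-1) (- (z^-1 * z^-1)).
Proof.
move=> z0.
have dz : derivable (id : C -> C) z 1 by exact: derivable_id.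
apply: DeriveDef; first exact: (@derivableV _ _ id z 1 z0 dz).
rewrite (@deriveV _ _ id z 1 z0 dz) derive_id.
by rewrite [_ *: 1]mulr1 expr2 invfM.
Qed.

Lemma rderive_circV t : rderive (fun t : R => (circ t)^-1) t
  (- (rC (2 * pi) * 'i%C * (circ t)^-1)).
Proof.
have dV := is_derive_inv (circ_neq0 t).
have := rderive_comp dV (@rderive_circ R t); congr (rderive _ _ _).
have := circ_neq0 t; set c := circ t => c0.
by field.
Qed.

Lemma continuous_circV : continuous (fun t : R => (circ t)^-1 : C).
Proof. by move=> t; exact: rderive_continuous (@rderive_circV t). Qed.

(* The homogeneous equation s J' = J forces J to be linear along the real axis. *)
Lemma linear_of_homogeneous (J D : C -> C) (r : R) : 0 < r ->
  (forall s : C, `|s| < rC (2 * r) -> is_derive (s : C) (1 : C) J (D s)) ->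
  (forall s : C, `|s| < rC (2 * r) -> s * D s = J s) ->
  D 0 = J (rC r) * rC r^-1.
Proof.
move=> r0 J_derive J_ode.
have n0 : `|0 : C| < rC (2 * r) by rewrite normr0 -rC0 ltr_rC mulr_gt0.
have J0 : J (rC 0) = 0 by rewrite -(J_ode _ n0) mul0r.
(* J(s) / s has derivative 0 along the real segment from a to r. *)
have Hc (a : R) : 0 < a -> a <= r -> J (rC a) * rC a^-1 = J (rC r) * rC r^-1.
  move=> a0 ar; rewrite !rCV.
  pose sg (t : R) := rC a + rC t * rC (r - a).
  have sE t : sg t = rC (a + t * (r - a)) by rewrite rCD rCM.
  have dsg t : rderive sg t (rC (r - a)).
    have := rderiveD (rderive_cst (rC a) t) (rderiveMc (c := rC (r - a)) (@rderive_rC R t)).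
    by rewrite add0r mul1r.
  have E1 : sg 1 = rC r by rewrite sE mul1r addrC subrK.
  have E0 : sg 0 = rC a by rewrite sE mul0r addr0.
  suff Z : forall t : R, 0 <= t <= 1 -> rderive (fun t : R => J (sg t) * (sg t)^-1) t 0.
    have := rderive_cst01 Z; rewrite E1 E0 => E; apply/esym; exact: E.
  move=> t /andP[t0 t1].
  have s0 : 0 < a + t * (r - a) by rewrite ltr_pwDl // mulr_ge0 // subr_ge0.
  have s1 : a + t * (r - a) <= r.
    by rewrite -lerBrDl ler_piMl // subr_ge0.
  have sr : `|sg t| < rC (2 * r).
    rewrite sE norm_rC ltr_rC gtr0_norm //; apply: le_lt_trans s1 _.
    by rewrite ltr_pMl // ltr1n.
  have sn0 : sg t != 0 by rewrite sE rC_eq0 gt_eqF.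
  have dJ := rderive_comp (J_derive _ sr) (dsg t).
  have := rderiveM dJ (rderive_comp (is_derive_inv sn0) (dsg t)).
  rewrite /comp -(J_ode _ sr); congr (rderive _ _ _); move: sn0.
  by set w := sg t; set v := D w; set x := rC _ => w0; field.
(* Since J(0) = 0, the quotient J(h) / h tends to D(0) as h decreases to 0, while by [Hc] it equals
   J(r) / r for all positive h up to r. *)
have H (e : R) : 0 < e -> `|J (rC r) * rC r^-1 - D 0| <= rC e.
  move=> e0; have e0' : 0 < rC e by rewrite -rC0 ltr_rC.
  have := rderive_comp (J_derive 0 n0 : is_derive (rC 0 : C) (1 : C) J (D 0)) (@rderive_rC R 0).
  move=> /(@cvgrPdist_lt _ _ _ ((0 : R)^') _) /(_ _ e0'); rewrite near_withinE => K.
  have [d d0 dP] := (iffLR (@nbhs_ballP _ R^o _ _)) K.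
  pose h := Num.min d r / 2.
  have h0 : 0 < h by rewrite divr_gt0 // lt_min d0.
  have hd : h < d.
    by rewrite ltr_pdivrMr // mulr_natr mulr2n gt_min ltr_pwDl.
  have hr : h <= r.
    by rewrite ler_pdivrMr // mulr_natr mulr2n ge_min [X in _ || X]lerDl (ltW r0) orbT.
  have := dP h; rewrite -ball_normE /ball_ /= sub0r normrN gtr0_norm // => /(_ hd).
  have hn0 : h != 0 by rewrite gt_eqF.
  move=> /(_ hn0) /ltW; rewrite mulr1 add0r J0 subr0.
  rewrite [rC h^-1 * _]mulrC (Hc h h0 hr) distrC.
  exact.
apply/eqP; rewrite eq_sym -subr_eq0 -normr_le0 rC_norm -rC0 ler_rC.
apply/ler_addgt0Pl => e e0; rewrite addr0 -ler_rC -rC_norm; exact: H.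
Qed.

Variables (p : nat) (U : set 'rV[C]_p) (f : 'rV[C]_p -> C).
Hypotheses (oU : open U) (hf : holomorphic U f).

Lemma norm_basis (i : 'I_p) : `|Defs.basis R i| <= 1.
Proof.
rewrite [leLHS]/Num.Def.normr /=.
have [->|/mx_norm_neq0 [[a k] ->]] := eqVneq (mx_norm (Defs.basis R i)) 0; first exact: ler01.
by rewrite mxE; case: (_ && _); rewrite /= ?normr1 ?normr0 // ler01.
Qed.

Lemma continuous_circ_line (y : 'rV[C]_p) (i : 'I_p) (s : C) :
  continuous (fun t : R => y + (s * circ t) *: Defs.basis R i).
Proof.
have c1 : continuous (fun t : R => s * circ t : C).
  exact: continuousCM (@continuousCc R s) (@continuous_circ R).
apply: continuousVD; first by move=> t; exact: cvg_cst.
by move=> t; exact: (@cvgZr_tmp _ _ _ _ _ _ _ _ (c1 t)).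
Qed.

Lemma norm_circ_line (i : 'I_p) (s : C) t :
  `|(s * circ t) *: Defs.basis R i| <= `|s|.
Proof.
rewrite normrZ normrM norm_circ mulr1 -[leRHS]mulr1.
by apply: ler_wpM2l => //; exact: norm_basis.
Qed.

Variables (y : 'rV[C]_p) (r : R) (i : 'I_p).
Hypotheses (r0 : 0 < r) (Ur : forall h, `|h| < rC (2 * r) -> U (y + h)).

Let b s t := y + (s * circ t) *: Defs.basis R i.
Let J (s : C) := cI (fun t : R => f (b s t) * (circ t)^-1).
Let D (s : C) := cI (fun t : R => partial i f (b s t)).

Let Ub s t : `|s| < rC (2 * r) -> U (b s t).
Proof. by move=> sr; apply: Ur; apply: le_lt_trans sr; exact: norm_circ_line. Qed.

(** Differentiation under the integral sign: the displacement by k e^(2 pi i t) cancels the weight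
    e^(-2 pi i t), leaving the average of the partial derivative. *)
Let J_derive s : `|s| < rC (2 * r) -> is_derive (s : C) (1 : C) J (D s).
Proof.
move=> sr; apply: is_derive_dist => e e0.
pose L t (k : C) := (k * circ t) *: Defs.basis R i.
pose d0 := 2 * r - re `|s|.
have d00 : 0 < d0 by rewrite subr_gt0 -ltr_rC -rC_norm.
have bE s' k t : b s' t + L t k = b (s' + k) t.
  by rewrite /b /L mulrDl scalerDl addrA.
have bc : continuous (b s) by exact: continuous_circ_line.
have Lc k : continuous (fun t : R => L t k).
  rewrite (_ : (fun t => L t k) = (fun t : R => 0 + (k * circ t) *: Defs.basis R i)).
    exact: continuous_circ_line.
  by apply/funext => t; rewrite add0r.
have LK t k : `|L t k| <= rC 1 * `|k| by rewrite mul1r; exact: norm_circ_line.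
have UL t k : `|k| < rC d0 -> U (b s t + L t k).
  move=> kd; rewrite bE; apply: Ub; apply: le_lt_trans (ler_normD _ _) _.
  rewrite (_ : 2 * r = re `|s| + d0); first by rewrite rCD -rC_norm ltrD2l.
  by rewrite /d0 addrCA subrr addr0.
have [d d1 dP] := cI_param_holomorphic oU hf d00 ltr01 bc continuous_circV Lc LK UL e0.
have E1 k : cI (fun t : R => f (b s t + L t k) / circ t) = J (s + k).
  by rewrite /J; f_equal; apply/funext => t; rewrite bE.
have pc := partial_continuous_comp (j := i) hf bc (fun t : R => Ub t sr).
have E2 k : \sum_j cI (fun t : R => L t k 0 j * (partial j f (b s t) / circ t)) = k * D s.
  rewrite (bigD1 i) //= big1 => [|j ji].
    rewrite addr0 /D mulrC -(cI_Mc k pc); f_equal; apply/funext => t.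
    rewrite /L !mxE !eqxx mulr1.
    have := circ_neq0 t; set c := circ t => c0.
    by field.
  rewrite (_ : (fun t => _) = (fun=> 0)); first exact: cI_cst.
  by apply/funext => t; rewrite /L !mxE eqxx (negPf ji) mulr0 mul0r.
by exists d => // k kd; have := dP k kd; rewrite E1 E2.
Qed.

(** The function f(b s t) e^(-2 pi i t) takes the same value at t = 0 and t = 1, so its t-derivative
    integrates to 0; that integral is 2 pi i times s D(s) - J(s). *)
Let J_ode s : `|s| < rC (2 * r) -> s * D s = J s.
Proof.
move=> sr.
pose G t := f (b s t) * (circ t)^-1.
pose G' t := partial i f (b s t) * (s * (rC (2 * pi) * 'i%C * circ t)) * (circ t)^-1
  + f (b s t) * - (rC (2 * pi) * 'i%C * (circ t)^-1).
have dG t : rderive G t (G' t).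
  apply: rderiveM; last exact: rderive_circV.
  apply: (@rderive_comp R (fun w : C => f (y + w *: Defs.basis R i)) (fun t : R => s * circ t)).
    apply: is_derive_line; apply: diff_derivable; exact: (hf (Ub t sr)).1.
  have := rderiveM (rderive_cst s t) (@rderive_circ R t).
  by rewrite mul0r add0r.
have bc : continuous (b s) by exact: continuous_circ_line.
have pc := partial_continuous_comp (j := i) hf bc (fun t : R => Ub t sr).
have fc := holomorphic_continuous_comp hf bc (fun t : R => Ub t sr).
have gc := continuousCM fc continuous_circV.
have i0 : 'i%C != 0 :> C by rewrite -normr_eq0 norm_i oner_eq0.
have c0 : rC (2 * pi) * 'i%C != 0 :> C.
  by rewrite mulf_neq0 // rC_eq0 mulf_neq0 ?gt_eqF ?pi_gt0.
have E : cI G' = (D s * s - J s) * (rC (2 * pi) * 'i%C).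
  rewrite /D /J -(cI_Mc s pc) -cI_B; [|exact: continuousCM pc (@continuousCc R s)|exact: gc].
  rewrite -cI_Mc; last exact: continuousCB (continuousCM pc (@continuousCc R s)) gc.
  congr cI; apply/funext => t; rewrite /G'.
  have := circ_neq0 t; set c := circ t => c1.
  have -> : partial i f (b s t) * (s * (rC (2 * pi) * 'i%C * c)) * c^-1
     = partial i f (b s t) * (s * (rC (2 * pi) * 'i%C)).
    by rewrite -!mulrA divff // mulr1.
  by ring.
have := @cI_FTC R G' G (fun t _ => dG t).
rewrite E /G /b circ1 subrr => /eqP; rewrite mulf_eq0 (negPf c0) orbF subr_eq0 => /eqP <-.
by rewrite mulrC.
Qed.

Lemma cauchy_partial :
  partial i f y = rC r^-1 * cI (fun t : R => f (y + (rC r * circ t) *: Defs.basis R i) * (circ t)^-1).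
Proof.
have -> : partial i f y = D 0.
  rewrite /D (_ : (fun t => _) = (fun=> partial i f y)); first by rewrite cI_cst.
  by apply/funext => t; rewrite /b mul0r scale0r addr0.
by rewrite (linear_of_homogeneous r0 J_derive J_ode) mulrC.
Qed.

End CauchyFormula.

(** * Partial derivatives of holomorphic functions *)

Section PartialDerivatives.
Variable R : realType.
Local Notation C := (C R).

Lemma continuous_at_near (V W : normedModType C) (F : V -> W) (y : V) :
  (forall e : R, 0 < e -> exists2 d : R, 0 < d &
     forall h, `|h| < rC d -> `|F (y + h) - F y| <= rC e) ->
  {for y, continuous F}.
Proof.
move=> H; apply/(@cvgrPdist_le _ _ _ (nbhs y) _) => e e0.
have [d d0 dP] := H _ (re_gt0 e0).
apply/near_ball; exists d => // y' yd.
have := dP (y' - y) yd; rewrite addrCA subrr addr0 distrC -(rC_re e0); exact.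
Qed.

Lemma open_ball (V : normedModType C) (U : set V) (y : V) (k : R) : 0 < k -> open U -> U y ->
  exists2 r : R, 0 < r & forall h, `|h| < rC (k * r) -> U (y + h).
Proof.
move=> k0 oU Uy.
have /near_ball[d d0 dP] : \forall y' \near y, U y' by exact: open_nbhs_nbhs.
exists (d / k); first by rewrite divr_gt0.
move=> h; rewrite mulrC divfK ?gt_eqF // => hd; apply: dP.
by rewrite addrAC subrr add0r.
Qed.

Lemma norm_scale_le (r e : R) (a c : C) : 0 < r -> `|a - c| <= rC (e * r) ->
  `|rC r^-1 * a - rC r^-1 * c| <= rC e.
Proof.
move=> r0 ac; rewrite -mulrBr normrM norm_rC (gtr0_norm (_ : 0 < r^-1)) ?invr_gt0 //.
apply: le_trans (_ : rC r^-1 * rC (e * r) <= _).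
  by apply: ler_wpM2l ac; rewrite -rC0 ler_rC invr_ge0 ltW.
by rewrite -rCM mulrCA mulVf ?gt_eqF // mulr1.
Qed.

Variables (p : nat) (U : set 'rV[C]_p) (f : 'rV[C]_p -> C).
Hypotheses (oU : open U) (hf : holomorphic U f).

Let b (y : 'rV[C]_p) (i : 'I_p) (r : R) (t : R) := y + (rC r * circ t) *: Defs.basis R i.

Let b_le (i : 'I_p) (r : R) t : 0 < r -> `|(rC r * circ t) *: Defs.basis R i| <= rC r.
Proof.
move=> r0; apply: le_trans (norm_circ_line _ _ _) _.
by rewrite norm_rC gtr0_norm.
Qed.

(** Cauchy's formula differentiated in the centre of the circle. The radius 3 r leaves room for a
    shift of the centre by less than r and for the ball of radius 2 r on which the formula is
    applied. *)
Lemma cauchy_partial2 (y : 'rV[C]_p) (r : R) (i : 'I_p) : 0 < r ->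
  (forall h, `|h| < rC (3 * r) -> U (y + h)) ->
  differentiable (partial i f) y /\
  forall j, partial j (partial i f) y = rC r^-1 *
    cI (fun t : R => partial j f (y + (rC r * circ t) *: Defs.basis R i) * (circ t)^-1).
Proof.
move=> r0 Ur; apply: (@differentiable_row R p (partial i f) y) => e e0.
have bc : continuous (b y i r) by exact: continuous_circ_line.
have bE t h : b y i r t + h = y + h + (rC r * circ t) *: Defs.basis R i.
  by rewrite /b addrAC.
have UL t h : `|h| < rC r -> U (b y i r t + h).
  move=> hr; rewrite bE -addrA; apply: Ur; apply: le_lt_trans (ler_normD _ _) _.
  have -> : 3 * r = r + 2 * r by ring.
  rewrite rCD; apply: ltr_leD => //; apply: le_trans (b_le _ _ r0) _.
  by rewrite ler_rC ler_peMl ?(ltW r0) // ler1n.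
have Ub t : U (b y i r t) by rewrite -[b _ _ _ _]addr0; apply: UL; rewrite normr0 -rC0 ltr_rC.
have LK (t : R) (h : 'rV[C]_p) : `|h| <= rC 1 * `|h| by rewrite mul1r.
have Lc (h : 'rV[C]_p) : continuous (fun _ : R => h) by move=> t; exact: cvg_cst.
have [d d0 dP] := @cI_param_holomorphic R p U f oU hf _ (b y i r) (fun=> id) _ r 1 r0 ltr01 bc
   (@continuous_circV R) Lc LK UL (e * r) (mulr_gt0 e0 r0).
exists (Num.min d r); first by rewrite lt_min d0.
move=> h hd.
have [m1 m2] : `|h| < rC d /\ `|h| < rC r.
  by split; apply: lt_le_trans hd _; rewrite ler_rC ge_min lexx ?orbT.
have U0 k : `|k| < rC (2 * r) -> U (y + k).
  move=> kr; apply: Ur; apply: lt_le_trans kr _.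
  by rewrite ler_rC ler_wpM2r ?(ltW r0) // ler_nat.
have Uh k : `|k| < rC (2 * r) -> U (y + h + k).
  move=> kr; rewrite -addrA; apply: Ur; apply: le_lt_trans (ler_normD _ _) _.
  have -> : 3 * r = r + 2 * r by ring.
  by rewrite rCD; exact: ltrD.
rewrite (cauchy_partial oU hf i r0 U0) (cauchy_partial oU hf i r0 Uh).
have -> : \sum_j h 0 j * (rC r^-1 * cI (fun t : R => partial j f (y + (rC r * circ t) *: Defs.basis R i) / circ t))
  = rC r^-1 * \sum_j cI (fun t : R => h 0 j * (partial j f (b y i r t) / circ t)).
  rewrite mulr_sumr; apply: eq_bigr => j _; rewrite mulrCA; f_equal.
  have pc := partial_continuous_comp (j := j) hf bc Ub.
  have gc := continuousCM pc (@continuous_circV R).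
  rewrite mulrC -(cI_Mc (h 0 j) gc); f_equal; apply/funext => t.
  by rewrite mulrC.
have -> : (fun t : R => f (y + h + (rC r * circ t) *: Defs.basis R i) / circ t)
   = (fun t : R => f (b y i r t + h) / circ t) by apply/funext => t; rewrite bE.
rewrite -mulrBr -mulrBr normrM norm_rC (gtr0_norm (_ : 0 < r^-1)) ?invr_gt0 //.
apply: le_trans (_ : rC r^-1 * (rC (e * r) * `|h|) <= _).
  by apply: ler_wpM2l (dP h m1); rewrite -rC0 ler_rC invr_ge0 ltW.
by rewrite mulrA -rCM mulrCA mulVf ?gt_eqF // mulr1.
Qed.

Lemma holomorphic_partial i : holomorphic U (partial i f).
Proof.
(* Room for a shift by less than r followed by a ball of radius 3 r, since [cauchy_partial2] is used
   at y and at y + h. *)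
move=> y Uy; have [r r0 Ur] := open_ball (ltr0n _ 5 : 0 < 5 :> R) oU Uy.
have Ur3 : forall h, `|h| < rC (3 * r) -> U (y + h).
  move=> h hr; apply: Ur; apply: lt_le_trans hr _.
  by rewrite ler_rC ler_wpM2r ?(ltW r0) // ler_nat.
have [dy _] := cauchy_partial2 i r0 Ur3; split=> // j.
apply: continuous_at_near => e e0.
have Uh h : `|h| < rC r -> forall k, `|k| < rC (3 * r) -> U (y + h + k).
  move=> hr k kr; rewrite -addrA; apply: Ur; apply: le_lt_trans (ler_normD _ _) _.
  apply: lt_le_trans (ltrD hr kr) _.
  by rewrite -rCD ler_rC (_ : 5 * r = r + 3 * r + r) ?lerDl ?(ltW r0) //; ring.
have bc : continuous (b y i r) by exact: continuous_circ_line.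
have Ub t h : `|h| < rC r -> U (b y i r t + h).
  move=> hr; rewrite /b addrAC; apply: (Uh _ hr).
  apply: le_lt_trans (b_le _ _ r0) _; rewrite ltr_rC.
  by rewrite ltr_pMl // ltr1n.
have n0 : `|0 : 'rV[C]_p| < rC r by rewrite normr0 -rC0 ltr_rC.
have Ub0 t : U (b y i r t) by rewrite -[b _ _ _ _]addr0; exact: Ub.
pose G (h : 'rV[C]_p) (t : R) := partial j f (b y i r t + h) * (circ t)^-1.
have Gc h : `|h| < rC r -> continuous (G h).
  move=> hr; apply: continuousCM (@continuous_circV R).
  have bhc : continuous (fun t => b y i r t + h).
    by apply: continuousVD bc _ => t; exact: cvg_cst.
  by apply: (partial_continuous_comp (j := j) hf bhc) => t; exact: Ub.
have [|d d0 dP] := @continuous_cI_param R _ G r r0 Gc _ (e * r) (mulr_gt0 e0 r0).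
  move=> {}e {}e0 t _.
  have [d1 d10 d1P] := continuous_at_dist ((hf (Ub0 t)).2 j) (divr_gt0 e0 (ltr0n _ 2)).
  have [d2 d20 d2P] := continuous_dist_real (bc t) (divr_gt0 d10 (ltr0n _ 2)).
  exists (Num.min d2 (d1 / 2)); first by rewrite lt_min d20 divr_gt0.
  move=> t' h; rewrite lt_min => /andP[/d2P bt _] hd.
  have hd1 : `|h| < rC (d1 / 2).
    by apply: lt_le_trans hd _; rewrite ler_rC ge_min lexx orbT.
  rewrite /G addr0 -mulrBl normrM normfV norm_circ invr1 mulr1.
  apply: le_trans (ler_distD (partial j f (b y i r t)) _ _) _.
  rewrite (splitr e) rCD; apply: lerD; apply: ltW.
    apply: d1P; rewrite addrAC; apply: le_lt_trans (ler_normD _ _) _.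
    by rewrite (splitr d1) rCD; exact: ltrD.
  rewrite distrC; apply: d1P; apply: lt_le_trans bt _.
  by rewrite ler_rC ler_pdivrMr // ler_peMr ?(ltW d10) // ler1n.
exists (Num.min d r); first by rewrite lt_min d0.
move=> h hd.
have [m1 m2] : `|h| < rC d /\ `|h| < rC r.
  by split; apply: lt_le_trans hd _; rewrite ler_rC ge_min lexx ?orbT.
rewrite (cauchy_partial2 i r0 Ur3).2 (cauchy_partial2 i r0 (Uh h m2)).2.
have GE : G h = (fun t : R => partial j f (y + h + (rC r * circ t) *: Defs.basis R i) / circ t).
  by apply/funext => t; rewrite /G /b [in LHS]addrAC.
have G0E : G 0 = (fun t : R => partial j f (y + (rC r * circ t) *: Defs.basis R i) / circ t).
  by apply/funext => t; rewrite /G /b addr0.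
apply: norm_scale_le r0 _; have := dP h m1; rewrite GE G0E; exact.
Qed.

End PartialDerivatives.

(** Differentiating Cauchy's formula for the j-th partial along i puts the i-th partial under the
    integral; the result is Cauchy's formula for the j-th partial of that function. *)
Lemma partialC (R : realType) p (U : set 'rV[C R]_p) (f : 'rV[C R]_p -> C R) i j y :
  open U -> holomorphic U f -> U y ->
  partial i (partial j f) y = partial j (partial i f) y.
Proof.
move=> oU hf Uy; have [r r0 Ur] := open_ball (ltr0n _ 3 : 0 < 3 :> R) oU Uy.
have U0 k : `|k| < rC (2 * r) -> U (y + k).
  move=> kr; apply: Ur; apply: lt_le_trans kr _.
  by rewrite ler_rC ler_wpM2r ?(ltW r0) // ler_nat.
rewrite (cauchy_partial2 oU hf j r0 Ur).2.
by rewrite (cauchy_partial oU (holomorphic_partial oU hf i) j r0 U0).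
Qed.

(** * Closure rules for holomorphic functions *)

Section HolomorphicAlgebra.
Variable R : realType.
Local Notation C := (C R).

Lemma near_eq_differentiable (V W : normedModType C) (f g : V -> W) (y : V) :
  (\forall y' \near y, f y' = g y') -> differentiable f y -> differentiable g y.
Proof.
move=> fg /diff_locallyP[dc df].
have fgy : f y = g y by exact: nbhs_singleton fg.
have E : g \o shift y = cst (g y) + 'd f y +o_ (0 : V) id.
  apply/eqaddoP => e e0; have /eqaddoP/(_ e e0) fe := df.
  have /near_ball[d d0 dP] := fg.
  have [d1 d10 d1P] := (near_ball (0 : V) _).1 fe.
  apply: (near_ball (0 : V) _).2; exists (Num.min d d1); first by rewrite lt_min d0.
  move=> h; rewrite subr0 => hd.
  have [m1 m2] : `|h| < rC d /\ `|h - 0| < rC d1.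
    by rewrite subr0; split; apply: lt_le_trans hd _; rewrite ler_rC ge_min lexx ?orbT.
  have := d1P _ m2; rewrite !fctE /= -fgy dP //.
  by rewrite addrK.
have dE := diff_unique dc E.
apply/diff_locallyP; split; first by rewrite dE; exact: dc.
by rewrite dE; exact: E.
Qed.

Lemma continuous_cst_at (V W : normedModType C) (c : W) (y : V) : {for y, continuous (fun _ : V => c)}.
Proof.
apply: continuous_at_near => e e0; exists 1 => // h _.
by rewrite subrr normr0 -rC0 ler_rC ltW.
Qed.

Lemma near_eq_continuous (V W : normedModType C) (f g : V -> W) (y : V) :
  (\forall y' \near y, f y' = g y') -> {for y, continuous f} -> {for y, continuous g}.
Proof.
move=> fg fc; have fgy : f y = g y by exact: nbhs_singleton fg.
rewrite /prop_for /continuous_at -fgy; apply: cvg_trans fc.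
exact: near_eq_cvg.
Qed.

Variable p : nat.
Implicit Types (U : set 'rV[C]_p) (f g : 'rV[C]_p -> C).

(** Continuity of a partial derivative at a point depends on nearby values only, so on an open set
    it may be tested on a formula [d]. *)
Lemma holomorphic_intro (V : normedModType C) U (f : 'rV[C]_p -> V) (d : 'I_p -> 'rV[C]_p -> V) :
  open U -> (forall y, U y -> differentiable f y) ->
  (forall y i, U y -> partial i f y = d i y) ->
  (forall y i, U y -> {for y, continuous (d i)}) -> holomorphic U f.
Proof.
move=> oU df dE dc y Uy; split=> [|i]; first exact: df.
apply: near_eq_continuous (dc y i Uy).
have /(open_nbhs_nbhs) nU : open_nbhs y U by [].
by apply: filterS nU => y' Uy'; rewrite dE.
Qed.

Lemma holomorphic_local (V : normedModType C) U (f : 'rV[C]_p -> V) :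
  (forall y, U y -> exists U' (g : 'rV[C]_p -> V), [/\ open U', U' y, holomorphic U' g &
     forall y', U' y' -> f y' = g y']) -> holomorphic U f.
Proof.
move=> H y /H[U' [g [oU' U'y hg fg]]].
have nU' : nbhs y U' by exact: open_nbhs_nbhs.
have gf : \forall y' \near y, g y' = f y' by apply: filterS nU' => y' /fg.
split; first exact: near_eq_differentiable gf (hg y U'y).1.
move=> i; apply: near_eq_continuous ((hg y U'y).2 i).
apply: filterS nU' => y' U'y'; apply: near_eq_derive.
have nU'' : nbhs y' U' by exact: open_nbhs_nbhs.
by apply: filterS nU'' => z /fg.
Qed.

Lemma holomorphicS (V : normedModType C) U U' (f : 'rV[C]_p -> V) :
  U' `<=` U -> holomorphic U f -> holomorphic U' f.
Proof. by move=> UU hf y /UU; exact: hf. Qed.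

Lemma partial_cst (V : normedModType C) (c : V) i (y : 'rV[C]_p) : partial i (fun=> c) y = 0.
Proof. exact: derive_cst. Qed.

Lemma partial_invariant (V : normedModType C) i (F : 'rV[C]_p -> V) y :
  (forall h : C, F (h *: Defs.basis R i + y) = F y) -> partial i F y = 0.
Proof.
move=> H; rewrite -(partial_cst (F y) i y) /partial /derive.
have -> : (fun h : C => h^-1 *: ((F \o shift y) (h *: Defs.basis R i) - F y))
    = (fun h : C => h^-1 *: (((fun=> F y) \o shift y) (h *: Defs.basis R i) - F y)).
  by apply/funext => h /=; rewrite H.
by [].
Qed.

Lemma holomorphic_cst (V : normedModType C) U (c : V) : open U -> holomorphic U (fun=> c).
Proof.
move=> oU; apply: (@holomorphic_intro _ _ _ (fun _ _ => 0) oU).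
- by move=> y _; exact: differentiable_cst.
- by move=> y i _; exact: partial_cst.
- by move=> y i _; exact: continuous_cst_at.
Qed.

Section Binary.
Variables (U : set 'rV[C]_p) (f g : 'rV[C]_p -> C).
Hypotheses (oU : open U) (hf : holomorphic U f) (hg : holomorphic U g).

Lemma partialD i y : U y -> partial i (fun u => f u + g u) y = partial i f y + partial i g y.
Proof.
by move=> Uy; apply: deriveD; apply: diff_derivable; [exact: (hf Uy).1|exact: (hg Uy).1].
Qed.

Lemma partialB i y : U y -> partial i (fun u => f u - g u) y = partial i f y - partial i g y.
Proof.
by move=> Uy; apply: deriveB; apply: diff_derivable; [exact: (hf Uy).1|exact: (hg Uy).1].
Qed.

Lemma partialM i y : U y ->
  partial i (fun u => f u * g u) y = partial i f y * g y + f y * partial i g y.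
Proof.
move=> Uy.
have := @deriveM _ _ f g y (Defs.basis R i) (diff_derivable (hf Uy).1) (diff_derivable (hg Uy).1).
rewrite /partial => H; apply: etrans H _.
by rewrite addrC [X in X + _ = _]mulrC.
Qed.

Lemma holomorphicD : holomorphic U (fun u => f u + g u).
Proof.
apply: (@holomorphic_intro _ _ _ (fun i y => partial i f y + partial i g y) oU).
- by move=> y Uy; apply: differentiableD; [exact: (hf Uy).1|exact: (hg Uy).1].
- by move=> y i; exact: partialD.
- by move=> y i Uy; exact: (cvgCD ((hf Uy).2 i) ((hg Uy).2 i)).
Qed.

Lemma holomorphicB : holomorphic U (fun u => f u - g u).
Proof.
apply: (@holomorphic_intro _ _ _ (fun i y => partial i f y - partial i g y) oU).
- by move=> y Uy; apply: differentiableB; [exact: (hf Uy).1|exact: (hg Uy).1].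
- by move=> y i; exact: partialB.
- by move=> y i Uy; exact: (cvgCB ((hf Uy).2 i) ((hg Uy).2 i)).
Qed.

Lemma holomorphicM : holomorphic U (fun u => f u * g u).
Proof.
apply: (@holomorphic_intro _ _ _ (fun i y => partial i f y * g y + f y * partial i g y) oU).
- by move=> y Uy; apply: differentiableM; [exact: (hf Uy).1|exact: (hg Uy).1].
- by move=> y i; exact: partialM.
- move=> y i Uy.
  have fc := differentiable_continuous (hf Uy).1.
  have gc := differentiable_continuous (hg Uy).1.
  exact: (cvgCD (cvgCM ((hf Uy).2 i) gc) (cvgCM fc ((hg Uy).2 i))).
Qed.

End Binary.

Lemma partialV U f i y : holomorphic U f -> U y -> f y != 0 ->
  partial i (fun u => (f u)^-1) y = - ((f y)^-1 * (f y)^-1 * partial i f y).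
Proof.
move=> hf Uy f0; rewrite /partial deriveV //; last exact: diff_derivable (hf y Uy).1.
by rewrite expr2 invfM /GRing.scale /= mulNr.
Qed.

Lemma holomorphicV U f : open U -> holomorphic U f -> (forall y, U y -> f y != 0) ->
  holomorphic U (fun u => (f u)^-1).
Proof.
move=> oU hf f0.
apply: (@holomorphic_intro _ _ _ (fun i y => (-1) * ((f y)^-1 * (f y)^-1 * partial i f y)) oU).
- by move=> y Uy; apply: differentiableV; [exact: (hf y Uy).1|exact: f0].
- by move=> y i Uy; rewrite (partialV i hf Uy (f0 y Uy)) mulN1r.
- move=> y i Uy.
  have fc := differentiable_continuous (hf y Uy).1.
  have c1 : (fun _ : 'rV[C]_p => -1 : C) @ y --> (-1 : C) by exact: continuous_cst_at.
  have ic : (fun u => (f u)^-1) @ y --> (f y)^-1 by exact: differentiable_continuous (differentiableV (hf y Uy).1 (f0 y Uy)).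
  exact: (cvgCM c1 (cvgCM (cvgCM ic ic) ((hf y Uy).2 i))).
Qed.

Lemma holomorphic_sum (I : Type) (r : seq I) (P : pred I) U (F : I -> 'rV[C]_p -> C) :
  open U -> (forall k, P k -> holomorphic U (F k)) ->
  holomorphic U (fun y => \sum_(k <- r | P k) F k y) /\
  forall i y, U y -> partial i (fun y => \sum_(k <- r | P k) F k y) y
     = \sum_(k <- r | P k) partial i (F k) y.
Proof.
move=> oU hF; elim: r => [|k r [h1 h2]].
  rewrite (_ : (fun y => _) = (fun=> 0)); last by apply/funext => y; rewrite big_nil.
  split; first exact: holomorphic_cst.
  by move=> i y Uy; rewrite big_nil; exact: partial_cst.
case Pk: (P k); last first.
  rewrite (_ : (fun y => _) = (fun y => \sum_(k <- r | P k) F k y)).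
    by split=> // i y Uy; rewrite h2 // big_cons Pk.
  by apply/funext => y; rewrite big_cons Pk.
rewrite (_ : (fun y => _) = (fun y => F k y + \sum_(k <- r | P k) F k y)).
  split; first exact: holomorphicD oU (hF _ Pk) h1.
  by move=> i y Uy; rewrite (partialD (hF _ Pk) h1) // h2 // big_cons Pk.
by apply/funext => y; rewrite big_cons Pk.
Qed.

Lemma partial_coord (i j : 'I_p) (y : 'rV[C]_p) :
  partial i (fun u : 'rV[C]_p => u 0 j : C) y = (i == j)%:R.
Proof.
have [_ H] : differentiable (fun u : 'rV[C]_p => u 0 j : C) y /\
    forall i, partial i (fun u : 'rV[C]_p => u 0 j : C) y = (i == j)%:R.
  apply: differentiable_row => e e0; exists 1 => // h _.
  rewrite (bigD1 j) //= eqxx mulr1 big1 => [|k /negPf ->]; last by rewrite mulr0.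
  rewrite mxE addr0 [y 0 j + _]addrC addrK subrr normr0.
  by rewrite mulr_ge0 // -rC0 ler_rC ltW.
exact: H.
Qed.

Lemma holomorphic_coord U j : open U -> holomorphic U (fun u : 'rV[C]_p => u 0 j : C).
Proof.
move=> oU; apply: (@holomorphic_intro _ _ _ (fun i _ => (i == j)%:R : C) oU).
- by move=> y _; exact: differentiable_coord.
- by move=> y i _; exact: partial_coord.
- by move=> y i _; exact: continuous_cst_at.
Qed.

Lemma ler_row_norm (x : 'rV[C]_p) (c : C) : 0 <= c -> (forall j, `|x 0 j| <= c) -> `|x| <= c.
Proof.
move=> c0 H; rewrite [leLHS]/Num.Def.normr /=.
have [->|/mx_norm_neq0 [[a k] ->]] := eqVneq (mx_norm x) 0 => //=.
by rewrite (ord1 a).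
Qed.

End HolomorphicAlgebra.

(** * Affine changes of variables *)

Section AffineComposition.
Variable R : realType.
Local Notation C := (C R).
Variables (p q : nat) (U : set 'rV[C]_p) (f : 'rV[C]_p -> C) (y0 : 'rV[C]_p) (M : 'M[C]_(q, p)).
Hypotheses (oU : open U) (hf : holomorphic U f).

(** Used for the projection to the monodromy coordinates, for the restriction to a complex line, and
    for the slice of a chart at fixed times. *)
Let i0 (u : 'rV[C]_q) : 'rV[C]_p := y0 + u *m M.

Lemma mulmx_lipschitz : exists2 K : R, 0 < K & forall u : 'rV[C]_q, `|u *m M| <= rC K * `|u|.
Proof.
exists (\sum_i \sum_j re `|M i j| + 1).
  by rewrite ltr_wpDl // sumr_ge0 // => i _; rewrite sumr_ge0 // => j _; exact: re_norm_ge0.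
have K0 : 0 <= \sum_i \sum_j re `|M i j|.
  by rewrite sumr_ge0 // => i _; rewrite sumr_ge0 // => j _; exact: re_norm_ge0.
move=> u; rewrite (rC_norm u) -rCM; apply: ler_row_norm.
  by rewrite -rC0 ler_rC mulr_ge0 ?re_norm_ge0 // addr_ge0.
move=> j; rewrite mxE; apply: le_trans (ler_norm_sum _ _ _) _.
have E i : `|u 0 i * M i j| <= rC (re `|u| * re `|M i j|).
  rewrite normrM rCM -!rC_norm; apply: ler_wpM2r => //; exact: ler_coord_norm.
apply: le_trans (ler_sum _ (fun i _ => E i)) _.
have <- : rC (\sum_i re `|u| * re `|M i j|) = \sum_i rC (re `|u| * re `|M i j|).
  exact: (raddf_sum (real_complex R)).
rewrite ler_rC -mulr_sumr mulrC ler_wpM2r ?re_norm_ge0 //.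
apply: ler_wpDr => //; apply: ler_sum => i _.
rewrite (bigD1 j) // lerDl sumr_ge0 // => k _; exact: re_norm_ge0.
Qed.

Lemma continuous_affine : continuous i0.
Proof.
move=> u; have [K K0 KP] := mulmx_lipschitz.
apply: continuous_at_near => e e0; exists (e / K); first by rewrite divr_gt0.
move=> h hd; have -> : i0 (u + h) - i0 u = h *m M.
  by rewrite /i0 mulmxDl addrA [X in X - _]addrC addrK.
apply: le_trans (KP h) _; rewrite (rC_norm h) -rCM ler_rC mulrC -ler_pdivlMr //.
by apply: ltW; rewrite -ltr_rC -rC_norm.
Qed.

Lemma open_affine : open [set u | U (i0 u)].
Proof. by apply: (@open_comp _ _ i0) => // u _; exact: continuous_affine. Qed.

Lemma affine_differentiable u : U (i0 u) -> differentiable (fun u => f (i0 u)) u /\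
  forall i, partial i (fun u => f (i0 u)) u = \sum_j M i j * partial j f (i0 u).
Proof.
move=> Uu; apply: differentiable_row => e e0.
have [K K0 KP] := mulmx_lipschitz.
have [d d0 dP] := sdiff_holomorphic oU hf Uu (divr_gt0 e0 K0).
exists (d / K); first by rewrite divr_gt0.
move=> h hd.
have hM : `|h *m M| < rC d.
  apply: le_lt_trans (KP h) _; rewrite (rC_norm h) -rCM ltr_rC mulrC -ltr_pdivlMr //.
  by rewrite -ltr_rC -rC_norm.
have n0 : `|i0 u - i0 u| < rC d by rewrite subrr normr0 -rC0 ltr_rC.
have := dP _ _ n0 hM.
have -> : i0 u + h *m M = i0 (u + h) by rewrite /i0 mulmxDl addrA.
have -> : \sum_j (h *m M) 0 j * partial j f (i0 u) = \sum_i h 0 i * (\sum_j M i j * partial j f (i0 u)).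
  under eq_bigr => j _ do rewrite mxE mulr_suml.
  rewrite exchange_big /=; apply: eq_bigr => i _.
  by rewrite mulr_sumr; apply: eq_bigr => j _; rewrite mulrA.
move/le_trans; apply; apply: le_trans (_ : rC (e / K) * (rC K * `|h|) <= _).
  by apply: ler_wpM2l; [rewrite -rC0 ler_rC divr_ge0 ?ltW|exact: KP].
by rewrite mulrA -rCM divfK ?gt_eqF.
Qed.

Lemma holomorphic_affine : holomorphic [set u | U (i0 u)] (fun u => f (i0 u)).
Proof.
apply: (@holomorphic_intro _ _ _ _ _ (fun i u => \sum_j M i j * partial j f (i0 u)) open_affine).
- by move=> u Uu; exact: (affine_differentiable Uu).1.
- by move=> u i Uu; exact: (affine_differentiable Uu).2.
move=> u i Uu; elim: (index_enum _) => [|j s IH].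
  have -> : (fun u : 'rV[C]_q => \sum_(j <- [::]) M i j * partial j f (i0 u)) = (fun=> 0).
    by apply/funext => v; rewrite big_nil.
  exact: continuous_cst_at.
have -> : (fun u : 'rV[C]_q => \sum_(j <- j :: s) M i j * partial j f (i0 u))
  = (fun u => M i j * partial j f (i0 u) + \sum_(j <- s) M i j * partial j f (i0 u)).
  by apply/funext => v; rewrite big_cons.
have mc : (fun _ : 'rV[C]_q => M i j) @ u --> M i j by exact: continuous_cst_at.
have pc := continuous_comp (@continuous_affine u) ((hf Uu).2 j).
exact: (cvgCD (cvgCM mc pc) IH).
Qed.

End AffineComposition.

(** * The identity theorem in one variable *)

Section IdentityTheorem.
Variable R : realType.
Local Notation C := (C R).
Local Notation e1 := (Defs.basis R (ord0 : 'I_1)).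
Local Notation z u := ((u : 'rV[C]_1) 0 0).

Lemma openP_dist (V : normedModType C) (A : set V) :
  (forall y, A y -> exists2 d : R, 0 < d & forall y', `|y' - y| < rC d -> A y') -> open A.
Proof. by move=> H; rewrite openE => y /H ?; exact/near_ball. Qed.

Lemma open_norm_lt (V : normedModType C) (c : R) : open [set u : V | `|u| < rC c].
Proof.
apply: openP_dist => y /= yc; exists (c - re `|y|); first by rewrite subr_gt0 -ltr_rC -rC_norm.
move=> y' yy; rewrite -[y'](subrK y); apply: le_lt_trans (ler_normD _ _) _.
have -> : c = (c - re `|y|) + re `|y| by rewrite subrK.
by rewrite rCD -rC_norm ltrD2r.
Qed.

Lemma row1E (u : 'rV[C]_1) : u = z u *: e1.
Proof. by rewrite {1}(row_basisE u) big_ord1. Qed.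

Lemma norm_e1 : `|e1| = 1.
Proof.
apply/eqP; rewrite eq_le norm_basis /=.
by have := ler_coord_norm e1 0; rewrite mxE !eqxx normr1.
Qed.

Lemma norm_row1 (u : 'rV[C]_1) : `|u| = `|z u|.
Proof. by rewrite {1}(row1E u) normrZ norm_e1 mulr1. Qed.

Lemma continuous_segment_bound (g : R -> C) : continuous g ->
  exists M : R, forall t : R, 0 <= t <= 1 -> `|g t| <= rC M.
Proof.
move=> gc.
have nc : continuous (fun t => re `|g t|).
  move=> t; have n1 := continuous_comp (gc t) (@norm_continuous _ _ (g t)).
  exact: (continuous_comp n1 (@continuous_re R `|g t|)).
have wc : {within `[(0 : R), 1], continuous (fun t => re `|g t|)} by exact: continuous_subspaceT.
have [c _ cP] := EVT_max ler01 wc.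
exists (re `|g c|) => t t01; rewrite rC_norm ler_rC; apply: cP.
by rewrite in_itv.
Qed.

Section Kernel.
Variables (R0 r : R) (psi : 'rV[C]_1 -> C).
Hypotheses (r1 : 1 < r) (rR : r < R0).
Hypothesis hpsi : holomorphic [set u : 'rV[C]_1 | `|u| < rC R0] psi.

Let zt (t : R) : C := rC r * circ t.

Let r0 : 0 < r. Proof. exact: lt_trans ltr01 r1. Qed.

Let norm_zt t : `|zt t| = rC r.
Proof. by rewrite normrM norm_circ mulr1 norm_rC gtr0_norm. Qed.

Let zt1 t : zt t - 1 != 0.
Proof.
rewrite subr_eq0; apply/eqP => E; have := norm_zt t; rewrite E normr1 -rC1.
by case=> E1; move: r1; rewrite -E1 ltxx.
Qed.

(** With z = r e^(2 pi i t), the differential dz / (z - 1) of Cauchy's integral formula at the point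
    1 is 2 pi i times this weight times dt. *)
Definition cauchy_weight (t : R) : C := zt t * (zt t - 1)^-1.
Local Notation w := cauchy_weight.

Let continuous_zt : continuous zt.
Proof. exact: continuousCM (@continuousCc R (rC r)) (@continuous_circ R). Qed.

Lemma continuous_cauchy_weight : continuous w.
Proof.
apply: (continuousCM continuous_zt) => t.
have c1 := continuousCB continuous_zt (@continuousCc R 1).
have iv := differentiable_continuous ((derivable1_diffP _ _).1
  (@ex_derive _ _ _ _ _ _ _ (is_derive_inv (zt1 t)))).
exact: (continuous_comp (c1 t) iv).
Qed.

(** The map z / (z - 1) sends the exterior of the unit disc into the half-plane Re > 1/2: after
    clearing denominators the inequality compares x^2 + y^2 with 1. *)
Lemma re_cauchy_weight t : 2^-1 <= re (w t).
Proof.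
rewrite /w; have := zt1 t; have := norm_zt t; case: (zt t) => x y.
move=> nz nz1.
have nxy : x ^+ 2 + y ^+ 2 = r ^+ 2.
  apply: (@complexI R); have := add_Re2_Im2 (x +i* y : C)%C => /= ->.
  by rewrite nz /rC rmorphXn.
have d0 : 0 < (x - 1) ^+ 2 + y ^+ 2.
  rewrite lt_neqAle addr_ge0 ?sqr_ge0 // andbT eq_sym.
  rewrite paddr_eq0 ?sqr_ge0 // !sqrf_eq0; apply/negP => /andP[/eqP x1 /eqP y1].
  by move/eqP: nz1; apply; apply/eqP; rewrite eq_complex /= x1 y1 oppr0 addr0 !eqxx.
have -> : re ((x +i* y : C)%C * ((x +i* y : C)%C - 1)^-1) = (x * (x - 1) + y ^+ 2) / ((x - 1) ^+ 2 + y ^+ 2).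
  by rewrite /= oppr0 addr0; field; rewrite gt_eqF.
rewrite ler_pdivlMr // mulrC ler_pdivrMr //.
have r2 : 1 <= r ^+ 2 by rewrite expr_ge1 ?ltW.
rewrite -nxy in r2; nra.
Qed.

Let F (s : C) := cI (fun t : R => psi ((1 + s * (zt t - 1)) *: e1) * w t).

(** The circle is contracted to the point 1 by 1 + s (z - 1). In the s-derivative the factor z - 1
    cancels the denominator of the weight, leaving the integral of psi' times z. It vanishes: for s
    nonzero it is a multiple of the integral of a t-derivative along a closed curve, for s = 0 a
    multiple of the integral of z. *)
Let F_cst : F 1 = F 0.
Proof.
pose b (s : C) t := (1 + s * (zt t - 1)) *: e1.
have bc s : continuous (b s).
  have c1 : continuous (fun t => 1 + s * (zt t - 1) : C).
    apply: (continuousCD (@continuousCc R 1)); apply: (continuousCM (@continuousCc R s)).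
    exact: continuousCB continuous_zt (@continuousCc R 1).
  by move=> t; exact: (@cvgZr_tmp _ _ _ _ _ _ _ _ (c1 t)).
have bs (s : R) t : 0 <= s <= 1 -> `|1 + rC s * (zt t - 1)| <= rC r.
  move=> /andP[s0 s1].
  have -> : 1 + rC s * (zt t - 1) = rC (1 - s) + rC s * zt t by rewrite rCB rC1; ring.
  apply: le_trans (ler_normD _ _) _.
  rewrite normrM norm_zt !norm_rC (ger0_norm s0) ger0_norm ?subr_ge0 // -rCM -rCD ler_rC.
  by move: r1 => /ltW; nra.
have Ub (s : R) t : 0 <= s <= 1 -> `|b (rC s) t| < rC R0.
  move=> s01; rewrite normrZ norm_e1 mulr1; apply: le_lt_trans (bs s t s01) _.
  by rewrite ltr_rC.
pose D (s : C) := cI (fun t => partial 0 psi (b s t) * zt t).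
have zn t : `|zt t - 1| <= rC (r + 1).
  by apply: le_trans (ler_normB _ _) _; rewrite norm_zt normr1 rCD.
have dF (s : R) : 0 <= s <= 1 -> is_derive (rC s : C) (1 : C) F (D (rC s)).
  move=> s01; apply: is_derive_dist => e e0.
  pose L t (k : C) := (k * (zt t - 1)) *: e1.
  have bE t k : b (rC s) t + L t k = b (rC s + k) t.
    by rewrite /b /L -scalerDl -addrA -mulrDl.
  have Lc k : continuous (fun t => L t k).
    have c1 : continuous (fun t => k * (zt t - 1) : C).
      apply: (continuousCM (@continuousCc R k)).
      exact: continuousCB continuous_zt (@continuousCc R 1).
    by move=> t; exact: (@cvgZr_tmp _ _ _ _ _ _ _ _ (c1 t)).
  have K0 : 0 < r + 1 by rewrite addr_gt0.
  have LK t k : `|L t k| <= rC (r + 1) * `|k|.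
    by rewrite normrZ norm_e1 mulr1 normrM mulrC; apply: ler_wpM2r.
  have d00 : 0 < (R0 - r) / (r + 1) by rewrite divr_gt0 // subr_gt0.
  have UL t k : `|k| < rC ((R0 - r) / (r + 1)) -> [set u : 'rV[C]_1 | `|u| < rC R0] (b (rC s) t + L t k).
    move=> kd /=; apply: le_lt_trans (ler_normD _ _) _.
    have -> : R0 = r + (R0 - r) by rewrite addrC subrK.
    rewrite rCD; apply: ler_ltD.
      by rewrite normrZ norm_e1 mulr1; exact: bs.
    apply: le_lt_trans (LK _ _) _; rewrite (rC_norm k) -rCM ltr_rC mulrC -ltr_pdivlMr //.
    by rewrite -ltr_rC -rC_norm.
  have [d d0 dP] := cI_param_holomorphic (open_norm_lt _ R0) hpsi d00 K0 (bc (rC s))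
    continuous_cauchy_weight Lc LK UL e0.
  have E1 k : cI (fun t : R => psi (b (rC s) t + L t k) * w t) = F (rC s + k).
    by rewrite /F; apply: (congr1 (@cI R)); apply/funext => t; rewrite bE.
  have pc := partial_continuous_comp (j := 0) hpsi (bc (rC s)) (fun t => Ub s t s01).
  have E2 k : \sum_j cI (fun t : R => L t k 0 j * (partial j psi (b (rC s) t) * w t)) = k * D (rC s).
    rewrite big_ord1 /D mulrC -(cI_Mc k (continuousCM pc continuous_zt)); f_equal; apply/funext => t.
    rewrite /L !mxE !eqxx mulr1 /w.
    by have := zt1 t; set a := zt t => a1; field.
  by exists d => // k kd; have := dP k kd; rewrite E1 E2.
have D0 (s : R) : 0 <= s <= 1 -> D (rC s) = 0.
  move=> s01.
  have i0 : 'i%C != 0 :> C by rewrite -normr_eq0 norm_i oner_eq0.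
  have c0 : rC (2 * pi) * 'i%C != 0 :> C.
    by rewrite mulf_neq0 // rC_eq0 mulf_neq0 ?gt_eqF ?pi_gt0.
  have dz t : rderive zt t (rC (2 * pi) * 'i%C * zt t).
    have := rderiveM (rderive_cst (rC r) t) (@rderive_circ R t).
    by rewrite mul0r add0r mulrCA.
  have pc := partial_continuous_comp (j := 0) hpsi (bc (rC s)) (fun t => Ub s t s01).
  have zt01 : zt 1 = zt 0 by rewrite /zt circ1.
  have [s0|s0] := eqVneq s 0.
    have bs0 t : b (rC s) t = e1 by rewrite s0 /b mul0r addr0 scale1r.
    have Z : cI zt = 0.
      apply: (mulIf c0); rewrite mul0r -(cI_Mc _ continuous_zt).
      have := @cI_FTC R (fun t => zt t * (rC (2 * pi) * 'i%C)) zt.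
      rewrite zt01 subrr; apply => t _.
      by rewrite mulrC; exact: dz.
    rewrite /D -[RHS](mul0r (partial 0 psi e1)) -[in RHS]Z -(cI_Mc _ continuous_zt).
    by f_equal; apply/funext => t; rewrite bs0 mulrC.
  have cs0 : rC s * (rC (2 * pi) * 'i%C) != 0 :> C by rewrite mulf_neq0 // rC_eq0.
  apply: (mulIf cs0); rewrite mul0r /D -(cI_Mc _ (continuousCM pc continuous_zt)).
  pose G t := psi (b (rC s) t).
  have := @cI_FTC R (fun t => partial 0 psi (b (rC s) t) * zt t * (rC s * (rC (2 * pi) * 'i%C))) G.
  rewrite /G /b zt01 subrr; apply => t _.
  have db : rderive (fun t => 1 + rC s * (zt t - 1)) t (rC s * (rC (2 * pi) * 'i%C * zt t)).
    have h1 := rderiveD (dz t) (rderive_cst (- 1) t).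
    have h2 := rderiveM (rderive_cst (rC s) t) h1.
    have := rderiveD (rderive_cst 1 t) h2.
    by rewrite mul0r !add0r addr0.
  have dpsi : is_derive (1 + rC s * (zt t - 1) : C) (1 : C) (fun a : C => psi (0 + a *: e1)) (partial 0 psi (b (rC s) t)).
    have := @is_derive_line R _ psi 0 e1 (1 + rC s * (zt t - 1)).
    rewrite add0r; apply; apply: diff_derivable; exact: (hpsi (Ub s t s01)).1.
  have := rderive_comp dpsi db.
  rewrite /comp; under eq_fun do rewrite add0r.
  congr (rderive _ _ _); ring.
suff Z : forall t : R, 0 <= t <= 1 -> rderive (fun t => F (rC t)) t 0.
  exact: rderive_cst01 Z.
move=> t t01; have := rderive_comp (dF t t01) (@rderive_rC R t).
by rewrite (D0 t t01) mul0r.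
Qed.

(** Cauchy's integral formula at 1, with the integral of the weight as its normalization;
    [re_cauchy_weight] shows that integral to be nonzero. *)
Lemma kernel_formula : psi e1 * cI w = cI (fun t : R => psi (zt t *: e1) * w t).
Proof.
have F1 : F 1 = cI (fun t : R => psi (zt t *: e1) * w t).
  have E t : 1 + 1 * (zt t - 1) = zt t by rewrite mul1r addrC subrK.
  by rewrite /F; apply: (congr1 (@cI R)); apply/funext => t; rewrite E.
have F0 : F 0 = cI (fun t : R => w t * psi e1).
  have E t : 1 + 0 * (zt t - 1) = 1 by rewrite mul0r addr0.
  by rewrite /F; apply: (congr1 (@cI R)); apply/funext => t; rewrite E scale1r [RHS]mulrC.
by rewrite -F1 F_cst F0 (cI_Mc _ continuous_cauchy_weight) mulrC.
Qed.

Lemma cI_weight_neq0 : cI w != 0.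
Proof.
apply/eqP => E; have := cI_re_ge continuous_cauchy_weight (fun t _ => re_cauchy_weight t).
by rewrite E /= leNgt invr_gt0 ltr0n.
Qed.

End Kernel.

Variable R0 : R.
Hypothesis R01 : 1 < R0.
Local Notation U := [set u : 'rV[C]_1 | `|u| < rC R0].

Let oU : open U. Proof. exact: open_norm_lt. Qed.

(** Near 0 the quotient is identically 0, because [f] is, so no removable singularity arises. *)
Lemma holomorphic_divz (f : 'rV[C]_1 -> C) (rho : R) : 0 < rho -> holomorphic U f ->
  (forall u, `|u| < rC rho -> f u = 0) ->
  holomorphic U (fun u => f u * (z u)^-1).
Proof.
move=> rho0 hf f0; apply: holomorphic_local => y Uy.
have [y0|y0] := eqVneq (z y) 0.
  exists [set u | `|u| < rC rho], (fun=> 0); split.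
  - exact: open_norm_lt.
  - by rewrite /= norm_row1 y0 normr0 -rC0 ltr_rC.
  - by apply: holomorphic_cst; exact: open_norm_lt.
  - by move=> u /f0 ->; rewrite mul0r.
pose U' := U `&` [set u : 'rV[C]_1 | z u != 0].
have oU' : open U'.
  apply: openI oU _; apply: openP_dist => u /= u0; exists (re `|z u|).
    by rewrite -ltr_rC -rC_norm normr_gt0.
  move=> u' uu; apply/eqP => E; move: uu.
  rewrite norm_row1 !mxE E sub0r normrN -rC_norm ltxx //.
have hf' : holomorphic U' f by apply: holomorphicS hf => u [].
have hV : holomorphic U' (fun u : 'rV[C]_1 => (z u)^-1).
  by apply: (holomorphicV oU' (holomorphic_coord 0 oU')) => u [].
exists U', (fun u => f u * (z u)^-1); split.
- exact: oU'.
- by split.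
- exact: (holomorphicM oU' hf' hV).
- by [].
Qed.

Lemma holomorphic_divzX (f : 'rV[C]_1 -> C) (rho : R) k : 0 < rho -> holomorphic U f ->
  (forall u, `|u| < rC rho -> f u = 0) ->
  holomorphic U (fun u => f u * ((z u)^-1) ^+ k).
Proof.
move=> rho0 hf f0; elim: k => [|k IH].
  rewrite (_ : (fun u => _) = f) //.
  by apply/funext => u; rewrite expr0 mulr1.
have := holomorphic_divz rho0 IH.
have -> : (fun u : 'rV[C]_1 => f u * (z u)^-1 ^+ k * (z u)^-1)
    = (fun u => f u * (z u)^-1 ^+ k.+1).
  by apply/funext => u; rewrite exprSr mulrA.
by apply => u /f0 ->; rewrite mul0r.
Qed.

(* f / z^k is holomorphic for all k and O(r^-k) on a circle of radius r > 1, so it is O(r^-k) at 1. *)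
Lemma identity_theorem (f : 'rV[C]_1 -> C) (rho : R) : 0 < rho -> holomorphic U f ->
  (forall u, `|u| < rC rho -> f u = 0) -> f e1 = 0.
Proof.
move=> rho0 hf f0.
pose r := (1 + R0) / 2.
have r1 : 1 < r by rewrite ltr_pdivlMr // mulr_natr mulr2n ltrD2l.
have rR : r < R0 by rewrite ltr_pdivrMr // mulr_natr mulr2n ltrD2r.
have r0 : 0 < r := lt_trans ltr01 r1.
have nz t : `|rC r * circ t| = rC r.
  by rewrite normrM norm_circ mulr1 norm_rC gtr0_norm.
have zc : continuous (fun t => (rC r * circ t) *: e1).
  have c1 := continuousCM (@continuousCc R (rC r)) (@continuous_circ R).
  by move=> t; exact: (@cvgZr_tmp _ _ _ _ _ _ _ _ (c1 t)).
have Uz t : U ((rC r * circ t) *: e1).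
  by rewrite /= normrZ norm_e1 mulr1 nz ltr_rC.
have gc : continuous (fun t => f ((rC r * circ t) *: e1) * cauchy_weight r t).
  exact: continuousCM (holomorphic_continuous_comp hf zc Uz) (continuous_cauchy_weight r1).
have [M MP] := continuous_segment_bound gc.
have M0 : 0 <= M.
  have t0 : 0 <= (0 : R) <= 1 by rewrite lexx ler01.
  by rewrite -ler_rC; apply: le_trans (MP 0 t0); exact: normr_ge0.
(* The bound M for f times the weight on the circle acquires the factor r^-k when f is divided by
   z^k, while at the point 1 the division changes nothing. *)
have bd k : `|f e1 * cI (cauchy_weight r)| <= rC (2 * (M * r^-1 ^+ k)).
  have hk := holomorphic_divzX k rho0 hf f0.
  have := kernel_formula r1 rR hk; rewrite mxE !eqxx invr1 expr1n mulr1 => ->.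
  have kc : continuous (fun t => f ((rC r * circ t) *: e1) * (z ((rC r * circ t) *: e1))^-1 ^+ k * cauchy_weight r t).
    exact: continuousCM (holomorphic_continuous_comp hk zc Uz) (continuous_cauchy_weight r1).
  apply: cI_norm kc _ => t t01.
  rewrite mulrAC !mxE !eqxx mulr1 normrM rCM; apply: ler_pM => //; first exact: MP.
  rewrite normrX normfV nz -rCV; have -> : rC (r^-1 ^+ k) = rC r^-1 ^+ k by rewrite /rC rmorphXn.
  by [].
apply/eqP; have := cI_weight_neq0 r1; set K := cI _ => K0.
suff : f e1 * K == 0 by rewrite mulf_eq0 (negPf K0) orbF.
rewrite -normr_le0 rC_norm -rC0 ler_rC leNgt; apply/negP => X0.
set X := re _ in X0.
have rV1 : `|r^-1| < 1 by rewrite gtr0_norm ?invr_gt0 // invf_lt1.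
have := cvg_expr rV1; move/(@cvgrPdist_lt _ R^o).
(* Some k makes r^-k smaller than X / (2 M + 1), which contradicts X <= 2 M r^-k. *)
have e0 : 0 < X / (2 * M + 1) by rewrite divr_gt0 // ltr_wpDl // mulr_ge0.
move=> /(_ _ e0) [k _ /(_ k (leqnn k))] /=.
rewrite sub0r normrN ger0_norm ?exprn_ge0 ?invr_ge0 ?(ltW r0) // => kX.
have := bd k; rewrite rC_norm ler_rC -/X; apply/negP; rewrite -ltNge.
have M1 : 0 < 2 * M + 1 by rewrite ltr_wpDl // mulr_ge0.
move: kX; rewrite ltr_pdivlMr //; apply: le_lt_trans.
have : 0 <= r^-1 ^+ k by rewrite exprn_ge0 // invr_ge0 ltW.
by set q := r^-1 ^+ k => q0; nra.
Qed.

(* Glueing g^2 on {S} with 0 elsewhere gives a holomorphic function. *)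
Lemma locally_constant_off_zeros (g : 'rV[C]_1 -> C) (S : 'rV[C]_1 -> Prop) :
  holomorphic U g ->
  (forall u, U u -> g u != 0 -> exists2 d : R, 0 < d &
     forall u', `|u' - u| < rC d -> (S u' <-> S u)) ->
  g 0 != 0 -> g e1 != 0 -> S e1 -> S 0.
Proof.
move=> hg lS g0 g1 S1; apply: contrapT => nS0.
pose T (u : 'rV[C]_1) := (g u != 0) && `[< S u >].
(* Both the value and the differential of g^2 vanish at the zeros of g, the only places where [T]
   can jump, so the cut-off function stays of class C^1. *)
pose f u := if T u then g u * g u else 0.
pose d (i : 'I_1) u := if T u then partial i g u * g u + g u * partial i g u else 0.
have hgg := holomorphicM oU hg hg.
have nT u : U u -> g u != 0 -> exists2 d : R, 0 < d & forall u', `|u' - u| < rC d -> T u' = T u.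
  move=> Uu gu; have [d1 d10 d1P] := lS u Uu gu.
  have gc := differentiable_continuous (hg u Uu).1.
  have nz : 0 < re `|g u| by rewrite -ltr_rC -rC_norm normr_gt0.
  have [d2 d20 d2P] := continuous_at_dist gc nz.
  exists (Num.min d1 d2); first by rewrite lt_min d10.
  move=> u' uu.
  have [m1 m2] : `|u' - u| < rC d1 /\ `|u' - u| < rC d2.
    by split; apply: lt_le_trans uu _; rewrite ler_rC ge_min lexx ?orbT.
  rewrite /T gu /=; have -> /= : g u' != 0.
    apply/eqP => E; have := d2P u' m2; rewrite E sub0r normrN -rC_norm.
    by rewrite ltxx.
  by apply/asboolP/asboolP => /(d1P u' m1).
have Tz u : g u = 0 -> T u = false by rewrite /T => ->; rewrite eqxx.
have f_near u : U u -> g u != 0 ->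
    (T u -> \forall u' \near u, g u' * g u' = f u') /\ (~~ T u -> \forall u' \near u, 0 = f u').
  move=> Uu gu; have [d1 d10 d1P] := nT u Uu gu.
  by split=> Tu; apply/near_ball; exists d1 => // u' /d1P Tu'; rewrite /f Tu' ?Tu ?(negPf Tu).
have zero u : U u -> g u = 0 -> differentiable f u /\ forall i, partial i f u = 0.
  move=> Uu gu.
  have [df dE] : differentiable f u /\ forall i, partial i f u = (fun=> 0) i.
    (* At a zero of g the inequality |f| <= |g^2| passes the expansion of g^2, with differential 0,
       on to f. *)
    apply: differentiable_row => e e0.
    have n0 : `|u - u| < rC 1 by rewrite subrr normr0 -rC0 ltr_rC.
    have [d1 d10 d1P] := sdiff_holomorphic oU hgg Uu e0.
    exists d1 => // h hd.
    have n1 : `|u - u| < rC d1 by rewrite subrr normr0 -rC0 ltr_rC.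
    have := d1P u h n1 hd.
    rewrite !big_ord1 (partialM hg hg) // gu !mulr0 mul0r addr0 mulr0 !subr0 => H.
    have -> : f u = 0 by rewrite /f Tz.
    rewrite !subr0; apply: le_trans H.
    by rewrite /f; case: (T _) => //; rewrite normr0.
  by split.
have hf : holomorphic U f.
  apply: (@holomorphic_intro _ _ _ _ _ d oU).
  - move=> u Uu; have [gu|gu] := eqVneq (g u) 0; first exact: (zero u Uu gu).1.
    have [h1 h2] := f_near u Uu gu; have [Tu|Tu] := boolP (T u).
      exact: near_eq_differentiable (h1 Tu) (hgg u Uu).1.
    exact: near_eq_differentiable (h2 Tu) (differentiable_cst _ _).
  - move=> u i Uu; have [gu|gu] := eqVneq (g u) 0; first by rewrite (zero u Uu gu).2 /d Tz.
    have [h1 h2] := f_near u Uu gu; rewrite /d; have [Tu|Tu] := boolP (T u).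
      by rewrite -(partialM hg hg i Uu); apply/esym; apply: near_eq_derive; exact: h1.
    rewrite -(partial_cst (0 : C) i u); apply/esym; apply: near_eq_derive; exact: h2.
  - move=> u i Uu.
    have gc := differentiable_continuous (hg u Uu).1.
    have dc : {for u, continuous (fun u => partial i g u * g u + g u * partial i g u)}.
      exact: (cvgCD (cvgCM ((hg u Uu).2 i) gc) (cvgCM gc ((hg u Uu).2 i))).
    have [gu|gu] := eqVneq (g u) 0.
      apply: continuous_at_near => e e0; have [d1 d10 d1P] := continuous_at_dist dc e0.
      exists d1 => // h hd; rewrite {2}/d Tz // subr0.
      have := d1P (u + h); rewrite [u + h]addrC addrK => /(_ hd).
      have Z : partial i g u * g u + g u * partial i g u = 0 by rewrite gu mulr0 mul0r addr0.
      rewrite Z subr0 => H; rewrite /d; case: (T _); first exact: ltW.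
      by rewrite normr0 -rC0 ler_rC ltW.
    have [d1 d10 d1P] := nT u Uu gu.
    have [Tu|Tu] := boolP (T u).
      apply: near_eq_continuous dc; apply/near_ball; exists d1 => // u' /d1P Tu'.
      by rewrite /d Tu' Tu.
    apply: near_eq_continuous (@continuous_cst_at _ _ _ (0 : C) u).
    by apply/near_ball; exists d1 => // u' /d1P Tu'; rewrite /d Tu' (negPf Tu).
have U0 : U 0 by rewrite /= normr0 -rC0 ltr_rC (lt_trans ltr01 R01).
have [rho rho0 rhoP] := nT 0 U0 g0.
have := identity_theorem rho0 hf.
have -> : f e1 = g e1 * g e1 by rewrite /f /T g1 /= (asboolT S1).
have H u : `|u| < rC rho -> f u = 0.
  move=> ur; have := rhoP u; rewrite subr0 => /(_ ur); rewrite /f => ->.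
  by rewrite /T (asboolF nS0) andbF.
by move=> /(_ H) /eqP; rewrite mulf_eq0 (negPf g1).
Qed.

End IdentityTheorem.

(** * Matrix-valued holomorphic functions *)

Section MatrixFunctions.
Variables (R : realType) (p : nat).
Local Notation C := (C R).

(** Entrywise counterpart of [holomorphic], equivalent to it on open sets; products, traces and
    inverses thereby reduce to scalar calculus. *)
Definition mxhol m n (U : set 'rV[C]_p) (F : 'rV[C]_p -> 'M[C]_(m, n)) : Prop :=
  forall a b, holomorphic U (fun y => F y a b : C).

Definition pmx m n (i : 'I_p) (F : 'rV[C]_p -> 'M[C]_(m, n)) (y : 'rV[C]_p) : 'M[C]_(m, n) :=
  \matrix_(a, b) partial i (fun u => F u a b : C) y.

Lemma pmx_entry m n (F : 'rV[C]_p -> 'M[C]_(m, n)) i y a b :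
  pmx i F y a b = partial i (fun u => F u a b : C) y.
Proof. by rewrite mxE. Qed.

Lemma partial_entry m n (F : 'rV[C]_p -> 'M[C]_(m, n)) i y a b : differentiable F y ->
  partial i (fun u => F u a b : C) y = (partial i F y) a b.
Proof.
move=> /(diff_derivable (v := Defs.basis R i)) /cvg_ex[l cl].
have -> : partial i F y = l by exact: cvg_lim cl.
have cc := cvg_comp _ _ cl (@coord_continuous C m n a b l).
rewrite /partial /derive; apply: cvg_lim => //.
apply: cvg_trans cc; apply: near_eq_cvg; near=> h.
by rewrite /= !mxE.
Unshelve. all: by end_near. Qed.

Lemma mxhol_of_holomorphic m n U (F : 'rV[C]_p -> 'M[C]_(m, n)) : open U ->
  holomorphic U F -> mxhol U F.
Proof.
move=> oU hF a b; apply: (@holomorphic_intro _ _ _ _ _ (fun i y => (partial i F y) a b) oU).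
- move=> y Uy; apply: (@differentiable_comp _ _ _ _ F (fun N : 'M[C]_(m, n) => N a b : C)).
    exact: (hF y Uy).1.
  exact: differentiable_coord.
- by move=> y i Uy; apply: partial_entry; exact: (hF y Uy).1.
- move=> y i Uy.
  exact: (continuous_comp ((hF y Uy).2 i) (@coord_continuous C m n a b _)).
Qed.

Lemma pmxE m n U (F : 'rV[C]_p -> 'M[C]_(m, n)) i y :
  holomorphic U F -> U y -> partial i F y = pmx i F y.
Proof.
move=> hF Uy; apply/matrixP => a b; rewrite mxE.
by rewrite (partial_entry _ _ _ (hF y Uy).1).
Qed.

Lemma ler_mx_norm m n (x : 'M[C]_(m, n)) (c : C) : 0 <= c ->
  (forall a b, `|x a b| <= c) -> `|x| <= c.
Proof.
move=> c0 H; rewrite [leLHS]/Num.Def.normr /=.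
by have [->|/mx_norm_neq0 [[a k] ->]] := eqVneq (mx_norm x) 0.
Qed.

Lemma continuous_mx m n (F : 'rV[C]_p -> 'M[C]_(m, n)) y :
  (forall a b, {for y, continuous (fun u => F u a b : C)}) -> {for y, continuous F}.
Proof.
move=> H; apply: continuous_at_near => e e0.
have [d d0 dP] := @near_forall_fin _ _ _ y (fun (ab : 'I_m * 'I_n) y' => `|F y' ab.1 ab.2 - F y ab.1 ab.2| < rC e)
  (fun ab => continuous_at_dist (H ab.1 ab.2) e0).
exists d => // h hd; apply: ler_mx_norm; first by rewrite -rC0 ler_rC ltW.
move=> a b; rewrite !mxE; apply: ltW; apply: (dP _ _ (a, b)).
by rewrite addrAC subrr add0r.
Qed.

Lemma holomorphic_of_mxhol m n U (F : 'rV[C]_p -> 'M[C]_(m, n)) : open U ->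
  mxhol U F -> holomorphic U F.
Proof.
move=> oU hF.
have dF y : U y -> differentiable F y.
  move=> Uy; have -> : F = \sum_(ab : 'I_m * 'I_n) (fun u => F u ab.1 ab.2 *: (delta_mx ab.1 ab.2 : 'M[C]_(m, n))).
    apply/funext => u; rewrite fct_sumE {1}(matrix_sum_delta (F u)) pair_bigA.
    by [].
  elim/big_ind : _ => [|f g df dg|ab _].
  - exact: differentiable_cst.
  - exact: differentiableD.
  - apply: differentiableZl; exact: (hF ab.1 ab.2 y Uy).1.
apply: (@holomorphic_intro _ _ _ _ _ (fun i => pmx i F) oU).
- exact: dF.
- move=> y i Uy; apply/matrixP => a b; rewrite mxE.
  by rewrite (partial_entry _ _ _ (dF y Uy)).
- move=> y i Uy; apply: continuous_mx => a b.
  rewrite (_ : (fun u => _) = partial i (fun u => F u a b : C)).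
    exact: (hF a b y Uy).2.
  by apply/funext => u; rewrite mxE.
Qed.

Section Calculus.
Variable U : set 'rV[C]_p.
Hypothesis oU : open U.

Lemma partial_eqU (V : normedModType C) (f g : 'rV[C]_p -> V) i y :
  (forall u, U u -> f u = g u) -> U y -> partial i f y = partial i g y.
Proof.
move=> fg Uy; apply: near_eq_derive.
have nU : nbhs y U by exact: open_nbhs_nbhs.
by apply: filterS nU => u /fg.
Qed.

Lemma pmx_eqU m n (F G : 'rV[C]_p -> 'M[C]_(m, n)) i y :
  (forall u, U u -> F u = G u) -> U y -> pmx i F y = pmx i G y.
Proof.
move=> FG Uy; apply/matrixP => a b; rewrite [LHS]pmx_entry [RHS]pmx_entry.
by apply: partial_eqU Uy => u Uu; rewrite FG.
Qed.

Lemma mxhol_eqU m n (F G : 'rV[C]_p -> 'M[C]_(m, n)) :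
  (forall u, U u -> F u = G u) -> mxhol U G -> mxhol U F.
Proof.
move=> FG hG a b; apply: holomorphic_local => y Uy.
exists U, (fun u => G u a b : C); split=> //.
by move=> u /FG ->.
Qed.

Lemma mxhol_cst m n (A : 'M[C]_(m, n)) : mxhol U (fun=> A).
Proof. by move=> a b; exact: holomorphic_cst. Qed.

Lemma pmx_cst m n (A : 'M[C]_(m, n)) i y : pmx i (fun=> A) y = 0.
Proof. by apply/matrixP => a b; rewrite !mxE partial_cst. Qed.

Lemma mxhol_mul m n r (F : 'rV[C]_p -> 'M[C]_(m, n)) (G : 'rV[C]_p -> 'M[C]_(n, r)) :
  mxhol U F -> mxhol U G -> mxhol U (fun y => F y *m G y) /\
  forall i y, U y -> pmx i (fun y => F y *m G y) y = pmx i F y *m G y + F y *m pmx i G y.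
Proof.
move=> hF hG.
have E a b : (fun y => (F y *m G y) a b) = (fun y => \sum_k F y a k * G y k b).
  by apply/funext => y; rewrite mxE.
have H a b := @holomorphic_sum R p _ (index_enum 'I_n) xpredT U (fun k y => F y a k * G y k b)
    oU (fun k _ => holomorphicM oU (hF a k) (hG k b)).
split=> [a b|i y Uy]; first by rewrite E; exact: (H a b).1.
apply/matrixP => a b; rewrite pmx_entry E (H a b).2 // !mxE -big_split; apply: eq_bigr => k _.
by rewrite (partialM (hF a k) (hG k b)) // !mxE.
Qed.

Lemma mxhol_scale m n (c : 'rV[C]_p -> C) (F : 'rV[C]_p -> 'M[C]_(m, n)) :
  holomorphic U c -> mxhol U F -> mxhol U (fun y => c y *: F y) /\
  forall i y, U y -> pmx i (fun y => c y *: F y) y = partial i c y *: F y + c y *: pmx i F y.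
Proof.
move=> hc hF.
have E a b : (fun y => (c y *: F y) a b) = (fun y => c y * F y a b).
  by apply/funext => y; rewrite mxE.
split=> [a b|i y Uy]; first by rewrite E; exact: (holomorphicM oU hc (hF a b)).
by apply/matrixP => a b; rewrite pmx_entry E (partialM hc (hF a b)) // !mxE.
Qed.

Lemma mxhol_sum m n (I : Type) (r : seq I) (P : pred I) (F : I -> 'rV[C]_p -> 'M[C]_(m, n)) :
  (forall k, P k -> mxhol U (F k)) ->
  mxhol U (fun y => \sum_(k <- r | P k) F k y) /\
  forall i y, U y -> pmx i (fun y => \sum_(k <- r | P k) F k y) y
     = \sum_(k <- r | P k) pmx i (F k) y.
Proof.
move=> hF.
have E a b : (fun y => (\sum_(k <- r | P k) F k y) a b) = (fun y => \sum_(k <- r | P k) F k y a b).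
  by apply/funext => y; rewrite summxE.
have H a b := @holomorphic_sum R p _ r P U (fun k y => F k y a b) oU (fun k Pk => hF k Pk a b).
split=> [a b|i y Uy]; first by rewrite E; exact: (H a b).1.
apply/matrixP => a b; rewrite pmx_entry E (H a b).2 // summxE; apply: eq_bigr => k _.
by rewrite pmx_entry.
Qed.

Lemma mxhol_pmx m n (F : 'rV[C]_p -> 'M[C]_(m, n)) i : mxhol U F -> mxhol U (pmx i F).
Proof.
move=> hF a b; rewrite (_ : (fun y => _) = partial i (fun u => F u a b : C)).
  exact: holomorphic_partial oU (hF a b) i.
by apply/funext => u; rewrite mxE.
Qed.

Lemma pmxC m n (F : 'rV[C]_p -> 'M[C]_(m, n)) i j y : mxhol U F -> U y ->
  pmx i (pmx j F) y = pmx j (pmx i F) y.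
Proof.
move=> hF Uy; apply/matrixP => a b; rewrite [LHS]pmx_entry [RHS]pmx_entry.
have E k : (fun u => pmx k F u a b) = partial k (fun u => F u a b : C).
  by apply/funext => u; rewrite pmx_entry.
apply: etrans (congr1 (fun f => partial i f y) (E j)) _.
apply: etrans (partialC i j oU (hF a b) Uy) _.
exact: (congr1 (fun f => partial j f y) (esym (E i))).
Qed.

Lemma mxhol_tr n (F : 'rV[C]_p -> 'M[C]_n) : mxhol U F ->
  holomorphic U (fun y => \tr (F y) : C) /\
  forall i y, U y -> partial i (fun y => \tr (F y) : C) y = \tr (pmx i F y).
Proof.
move=> hF; have [h1 h2] := @holomorphic_sum R p _ (index_enum 'I_n) xpredT U (fun k y => F y k k)
    oU (fun k _ => hF k k).
split; first exact: h1.
move=> i y Uy; rewrite /mxtrace h2 //; apply: eq_bigr => k _.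
by rewrite mxE.
Qed.

Lemma holomorphic_prod (I : Type) (r : seq I) (F : I -> 'rV[C]_p -> C) :
  (forall k, holomorphic U (F k)) -> holomorphic U (fun y => \prod_(k <- r) F k y).
Proof.
move=> hF; elim: r => [|k r IH].
  rewrite (_ : (fun y => _) = (fun=> 1)); first exact: holomorphic_cst.
  by apply/funext => y; rewrite big_nil.
rewrite (_ : (fun y => _) = (fun y => F k y * \prod_(k <- r) F k y)).
  exact: holomorphicM oU (hF k) IH.
by apply/funext => y; rewrite big_cons.
Qed.

Lemma holomorphic_det n (F : 'rV[C]_p -> 'M[C]_n) : mxhol U F ->
  holomorphic U (fun y => \det (F y) : C).
Proof.
move=> hF; rewrite /determinant.
apply: (@holomorphic_sum R p _ _ _ U (fun (s : {perm 'I_n}) y => (-1) ^+ s * \prod_i F y i (s i)) oU _).1.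
move=> s _; apply: holomorphicM oU _ _; first exact: holomorphic_cst.
by apply: holomorphic_prod => k; exact: hF.
Qed.

(** Holomorphy comes from the adjugate formula; the derivative is then found by differentiating F
    F^-1 = 1. *)
Lemma mxhol_inv n (F : 'rV[C]_p -> 'M[C]_n) : mxhol U F ->
  (forall y, U y -> F y \in unitmx) -> mxhol U (fun y => invmx (F y)) /\
  forall i y, U y -> pmx i (fun y => invmx (F y)) y = - (invmx (F y) *m pmx i F y *m invmx (F y)).
Proof.
move=> hF uF.
have hI : mxhol U (fun y => invmx (F y)).
  apply: (@mxhol_eqU _ _ _ (fun y => (\det (F y))^-1 *: \adj (F y))).
    by move=> y Uy; rewrite /invmx uF.
  apply: (mxhol_scale _ _).1.
    apply: holomorphicV oU (holomorphic_det hF) _ => y Uy.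
    by have := uF y Uy; rewrite unitmxE unitfE.
  move=> a b; rewrite (_ : (fun y => _) = (fun y => (-1) ^+ (b + a) * \det (row' b (col' a (F y))))).
    apply: holomorphicM oU _ _; first exact: holomorphic_cst.
    apply: holomorphic_det => c d.
    rewrite (_ : (fun y => _) = (fun y => F y (lift b c) (lift a d) : C)); first exact: hF.
    by apply/funext => y; rewrite !mxE.
  by apply/funext => y; rewrite mxE.
split=> // i y Uy.
have E := (mxhol_mul hF hI).2 i y Uy.
have Z : pmx i (fun y => F y *m invmx (F y)) y = 0.
  rewrite (@pmx_eqU _ _ _ (fun=> 1%:M)) ?pmx_cst // => u Uu.
  by rewrite mulmxV // uF.
rewrite Z in E.
have := congr1 (mulmx (invmx (F y))) E; rewrite mulmx0 mulmxDr [X in _ + X]mulmxA mulVmx ?uF //.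
by rewrite mul1mx mulmxA => /eqP; rewrite eq_sym addrC addr_eq0 => /eqP.
Qed.

End Calculus.

End MatrixFunctions.

Lemma sum_option (V : nmodType) (I : finType) (F : option I -> V) :
  \sum_(x : option I) F x = F None + \sum_(i : I) F (Some i).
Proof.
rewrite (bigD1 None) //=; congr (_ + _).
rewrite (reindex_omap Some id) /=; last by case.
by apply: eq_bigl => i; rewrite eqxx.
Qed.

(** * Commutators under the trace *)

Section CommutatorIdentities.
Variables (F : fieldType) (n N : nat) (a : 'I_n -> F) (B : 'I_n -> 'M[F]_N).
Hypothesis a_inj : forall i j, i != j -> a i != a j.

Let c i j := (a i - a j)^-1.

Definition bracket (X Y : 'M[F]_N) := X *m Y - Y *m X.

Lemma tr_bracketC (X Y Z : 'M[F]_N) : \tr (X *m bracket Y Z) = \tr (bracket Z X *m Y).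
Proof.
rewrite mulmxBr mulmxBl !linearB /= !mulmxA; congr (_ - _).
by rewrite mxtrace_mulC mulmxA.
Qed.

Lemma tr_bracket_l (X Y : 'M[F]_N) : \tr (bracket X Y *m X) = 0.
Proof. by rewrite /bracket mulmxBl linearB /= -mulmxA mxtrace_mulC subrr. Qed.

Lemma tr_bracket_r (X Y : 'M[F]_N) : \tr (bracket X Y *m Y) = 0.
Proof. by rewrite /bracket mulmxBl linearB /= -[Y *m X *m Y]mulmxA [\tr (Y *m _)]mxtrace_mulC subrr. Qed.

Lemma bracketN (X Y : 'M[F]_N) : bracket X Y = - bracket Y X.
Proof. by rewrite /bracket opprB. Qed.

(** Right-hand side of the isomonodromy equations for the derivative of [B k] in the time of index
    [l]. *)
Definition schlesinger (l k : 'I_n) : 'M[F]_N :=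
  if l == k then - \sum_(m < n | m != l) c m l *: bracket (B m) (B l)
  else c l k *: bracket (B l) (B k).

(** The sum is the part of dH_k/da_l due to the motion of the residues. By invariance of the trace
    form each term is a combination of the traces [t j] of [B_l, B_k] B_j, which vanish for j = l
    and j = k. For any other j the coefficient is 0 because 1/(a_l - a_k) - 1/(a_l - a_j) = (a_k -
    a_j) / ((a_l - a_k)(a_l - a_j)). *)
Lemma schlesinger_cancel (l k : 'I_n) : l != k ->
  \sum_(j < n | j != k) c k j * \tr (schlesinger l k *m B j + B k *m schlesinger l j) = 0.
Proof.
move=> lk; pose t j := \tr (bracket (B l) (B k) *m B j).
have tl : t l = 0 by exact: tr_bracket_l.
have tk : t k = 0 by exact: tr_bracket_r.
rewrite (bigD1 l lk) /=.
have -> : \tr (schlesinger l k *m B l + B k *m schlesinger l l) = - \sum_(m < n | (m != k) && (m != l)) c m l * t m.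
  rewrite linearD /= {1}/schlesinger (negPf lk) -scalemxAl linearZ /= tr_bracket_l mulr0 add0r.
  rewrite /schlesinger eqxx mulmxN linearN /= mulmx_sumr linear_sum /=; congr (- _).
  rewrite (bigD1 k) 1?eq_sym //= -scalemxAr linearZ /= tr_bracketC.
  rewrite [\tr _]tr_bracket_r mulr0 add0r; apply: eq_big => m; first by rewrite andbC.
  by move=> _; rewrite -scalemxAr linearZ /= tr_bracketC.
rewrite mulrN mulr_sumr -sumrN -big_split big1 //= => j /andP[jk jl].
rewrite linearD /= /schlesinger (negPf lk) eq_sym (negPf jl) -scalemxAl -scalemxAr !linearZ /=.
rewrite [bracket (B l) (B j)]bracketN mulmxN linearN /= tr_bracketC -/(t j).
have h1 : a k - a l != 0 by rewrite subr_eq0 a_inj // eq_sym.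
have h2 : a l - a j != 0 by rewrite subr_eq0 a_inj // eq_sym.
have h3 : a k - a j != 0 by rewrite subr_eq0 a_inj // eq_sym.
have h4 : a j - a l != 0 by rewrite subr_eq0 a_inj.
have h5 : a l - a k != 0 by rewrite subr_eq0 a_inj.
by rewrite /c; field; rewrite h1 h2 h3 h4 h5.
Qed.

End CommutatorIdentities.

(** One summand in the comparison of dJ_k/da_l with dH_l/dm_k: [t] is a coefficient 1/(a_l - a_j),
    [s] the one with its indices exchanged, [z] the m-derivative of [t]. *)
Lemma tr_exchange (F : fieldType) (N : nat) (X Y X' Y' : 'M[F]_N) (s t z : F) :
  z = 0 -> s = - t ->
  - \tr (X *m (s *: Y')) + \tr (Y *m (t *: X')) = z * \tr (X *m Y) + t * \tr (X' *m Y + X *m Y').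
Proof.
move=> -> ->; rewrite -!scalemxAr !linearZ /= linearD /= [\tr (Y *m _)]mxtrace_mulC.
by ring.
Qed.

Local Opaque partial pmx.

(** * Exterior derivative of the form in local coordinates *)

Section LocalForm.
Variables (R : realType) (n d N : nat).
Local Notation C := (C R).
Local Notation pt := 'rV[C]_(n + d).
Variables (U : set pt) (B : 'I_n -> pt -> 'M[C]_N) (g Th : option 'I_n -> pt -> 'M[C]_N).

Definition time (k : 'I_n) (y : pt) : C := y 0 (lshift d k).
Local Notation c k j y := ((time k y - time j y)^-1).

(* (d g_k / d a_l) g_k^-1 *)
Definition connection (l k : 'I_n) (y : pt) : 'M[C]_N :=
  if l == k then - \sum_(m < n | m != k) c m k y *: B m y else c l k y *: B l y.

Hypotheses (oU : open U) (hB : forall k, mxhol U (B k))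
  (hg : forall nu, mxhol U (g nu)) (hTh : forall nu, mxhol U (Th nu))
  (ug : forall nu y, U y -> g nu y \in unitmx)
  (time_inj : forall y, U y -> forall i j, i != j -> time i y != time j y)
  (dTh : forall nu l y, U y -> pmx (lshift d l) (Th nu) y = 0)
  (Bg : forall k y, U y -> B k y = g (Some k) y *m Th (Some k) y *m invmx (g (Some k) y))
  (dg : forall l k y, U y -> pmx (lshift d l) (g (Some k)) y = connection l k y *m g (Some k) y)
  (dgN : forall l y, U y -> pmx (lshift d l) (g None) y = 0)
  (dB : forall l k y, U y ->
     pmx (lshift d l) (B k) y = schlesinger (fun i => time i y) (fun i => B i y) l k).

(* omega = sum_k Hform k da_k + sum_k Jform k dm_k *)
Definition Hform (k : 'I_n) (y : pt) : C :=
  \sum_(j < n | j != k) c k j y * \tr (B k y *m B j y).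

Definition Jterm nu (k : 'I_d) (y : pt) : C :=
  \tr (Th nu y *m invmx (g nu y) *m pmx (rshift n k) (g nu) y).

Definition Jform (k : 'I_d) (y : pt) : C := \sum_(nu : option 'I_n) Jterm nu k y.

Lemma holomorphic_c k j : k != j -> holomorphic U (fun y => c k j y) /\
  forall i y, U y -> partial i (fun y => c k j y) y
    = - (c k j y * c k j y * ((i == lshift d k)%:R - (i == lshift d j)%:R)).
Proof.
move=> kj.
have h1 : holomorphic U (time k) by exact: holomorphic_coord.
have h2 : holomorphic U (time j) by exact: holomorphic_coord.
have h3 := holomorphicB oU h1 h2.
have nz y : U y -> time k y - time j y != 0 by move=> Uy; rewrite subr_eq0 time_inj.
split=> [|i y Uy]; first exact: holomorphicV oU h3 nz.
by rewrite (partialV i h3 Uy (nz y Uy)) (partialB h1 h2) // !partial_coord.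
Qed.

Lemma partial_m_c (k : 'I_d) l j y : l != j -> U y ->
  partial (rshift n k) (fun y => c l j y) y = 0.
Proof.
move=> lj Uy; rewrite (holomorphic_c lj).2 //.
have E (m : 'I_n) : (rshift n k == lshift d m) = false.
  by apply/eqP => /(congr1 val) /= E; have := ltn_ord m; rewrite -E ltnNge leq_addr.
by rewrite !E subrr mulr0 oppr0.
Qed.

Lemma holomorphic_trBB k j : holomorphic U (fun y => \tr (B k y *m B j y) : C) /\
  forall i y, U y -> partial i (fun y => \tr (B k y *m B j y) : C) y
    = \tr (pmx i (B k) y *m B j y + B k y *m pmx i (B j) y).
Proof.
have [h1 h2] := mxhol_mul oU (hB k) (hB j); have [h3 h4] := mxhol_tr oU h1.
by split=> // i y Uy; rewrite h4 // h2.
Qed.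

Lemma holomorphic_H k : holomorphic U (Hform k) /\
  forall i y, U y -> partial i (Hform k) y = \sum_(j < n | j != k)
    (partial i (fun y => c k j y) y * \tr (B k y *m B j y)
     + c k j y * \tr (pmx i (B k) y *m B j y + B k y *m pmx i (B j) y)).
Proof.
have H j : j != k -> holomorphic U (fun y => c k j y * \tr (B k y *m B j y)).
  rewrite eq_sym => kj; exact: holomorphicM oU (holomorphic_c kj).1 (holomorphic_trBB k j).1.
have [h1 h2] := holomorphic_sum (index_enum 'I_n) oU H.
split=> // i y Uy; rewrite h2 //; apply: eq_bigr => j; rewrite eq_sym => kj.
by rewrite (partialM (holomorphic_c kj).1 (holomorphic_trBB k j).1) // (holomorphic_trBB k j).2.
Qed.

Lemma holomorphic_Jterm nu k : holomorphic U (Jterm nu k).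
Proof.
have hI := (mxhol_inv oU (hg nu) (fun y => @ug nu y)).1.
have h1 := (mxhol_mul oU (hTh nu) hI).1.
have h2 := (mxhol_mul oU h1 (mxhol_pmx oU (rshift n k) (hg nu))).1.
exact: (mxhol_tr oU h2).1.
Qed.

Lemma holomorphic_J k : holomorphic U (Jform k) /\
  forall i y, U y -> partial i (Jform k) y = \sum_(nu : option 'I_n) partial i (Jterm nu k) y.
Proof. exact: holomorphic_sum oU (fun nu _ => holomorphic_Jterm nu k). Qed.

(** The two terms with K undifferentiated cancel: one comes from the derivative of g^-1, the other
    from that of K g in the direction of m_k. What remains is brought to this order by cyclicity of
    the trace. *)
Lemma partial_Jterm nu i k (K : pt -> 'M[C]_N) y : mxhol U K ->
  (forall u, U u -> pmx i (Th nu) u = 0) ->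
  (forall u, U u -> pmx i (g nu) u = K u *m g nu u) -> U y ->
  partial i (Jterm nu k) y = \tr (g nu y *m Th nu y *m invmx (g nu y) *m pmx (rshift n k) K y).
Proof.
move=> hK dT dgK Uy; set j := rshift n k.
have [hI dI] := mxhol_inv oU (hg nu) (fun y => @ug nu y).
have [h1 d1] := mxhol_mul oU (hTh nu) hI.
have hj := mxhol_pmx oU j (hg nu).
have [h2 d2] := mxhol_mul oU h1 hj.
have uy := ug nu Uy.
rewrite (mxhol_tr oU h2).2 // d2 // d1 // dT // mul0mx add0r dI //.
have -> : pmx i (pmx j (g nu)) y = pmx j K y *m g nu y + K y *m pmx j (g nu) y.
  apply: etrans (pmxC oU i j (hg nu) Uy) _.
  apply: etrans (pmx_eqU oU j dgK Uy) _.
  exact: (mxhol_mul oU hK (hg nu)).2.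
rewrite dgK // mulmxDr !mulmxN !mulNmx.
rewrite !mulmxA (mulmxK uy) [X in _ + X]addrC addrA addNr add0r.
by rewrite mxtrace_mulC !mulmxA.
Qed.

Lemma mxhol_connection l k : mxhol U (connection l k).
Proof.
rewrite /connection; case: eqVneq => [_|lk].
  have hs := (@mxhol_sum R (n + d) U oU N N 'I_n (index_enum _) (fun m => m != k)
    (fun m y => c m k y *: B m y) (fun m mk => (mxhol_scale oU (holomorphic_c mk).1 (hB m)).1)).1.
  rewrite (_ : (fun y => _) = (fun y => (-1) *: \sum_(m < n | m != k) c m k y *: B m y)).
    exact: (mxhol_scale oU (holomorphic_cst (-1 : C) oU) hs).1.
  by apply/funext => y; rewrite scaleN1r.
exact: (mxhol_scale oU (holomorphic_c lk).1 (hB l)).1.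
Qed.

Lemma pmx_connection l k j y : U y -> pmx (rshift n j) (connection l k) y =
  if l == k then - \sum_(m < n | m != k) c m k y *: pmx (rshift n j) (B m) y
  else c l k y *: pmx (rshift n j) (B l) y.
Proof.
move=> Uy.
have sc m : m != k -> pmx (rshift n j) (fun y => c m k y *: B m y) y = c m k y *: pmx (rshift n j) (B m) y.
  by move=> mk; rewrite (mxhol_scale oU (holomorphic_c mk).1 (hB m)).2 // partial_m_c // scale0r add0r.
rewrite /connection; case: eqVneq => [_|lk]; last exact: sc.
have [hs ds] := (@mxhol_sum R (n + d) U oU N N 'I_n (index_enum _) (fun m => m != k)
    (fun m y => c m k y *: B m y) (fun m mk => (mxhol_scale oU (holomorphic_c mk).1 (hB m)).1)).
rewrite (_ : (fun y => _) = (fun y => (-1) *: \sum_(m < n | m != k) c m k y *: B m y)).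
  rewrite (mxhol_scale oU (holomorphic_cst (-1 : C) oU) hs).2 // partial_cst scale0r add0r ds //.
  by rewrite scaleN1r; congr (- _); apply: eq_bigr => m mk; exact: sc.
by apply/funext => u; rewrite scaleN1r.
Qed.

(* The components of d omega along da_l /\ dm_k vanish. *)
Lemma partial_a_J l k y : U y ->
  partial (lshift d l) (Jform k) y = partial (rshift n k) (Hform l) y.
Proof.
move=> Uy; rewrite (holomorphic_J k).2 // sum_option.
(* The frame at infinity does not move with the times, so K = 0. *)
have E0 : partial (lshift d l) (Jterm None k) y = 0.
  rewrite (@partial_Jterm None (lshift d l) k (fun=> 0)) ?pmx_cst ?mulmx0 ?mxtrace0 //.
  - exact: mxhol_cst.
  - by move=> u Uu; rewrite dTh.
  - by move=> u Uu; rewrite dgN // mul0mx.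
have E j : partial (lshift d l) (Jterm (Some j) k) y = \tr (B j y *m pmx (rshift n k) (connection l j) y).
  rewrite (@partial_Jterm (Some j) (lshift d l) k (connection l j)) //.
  - by rewrite -Bg.
  - exact: mxhol_connection.
  - by move=> u Uu; rewrite dTh.
  - by move=> u Uu; rewrite dg.
apply: etrans (f_equal2 +%R E0 (eq_bigr _ (fun j _ => E j))) _.
rewrite add0r; under eq_bigr => j _ do rewrite pmx_connection //.
rewrite (bigD1 l) //= eqxx (holomorphic_H l).2 //.
have -> : \tr (B l y *m - \sum_(m < n | m != l) c m l y *: pmx (rshift n k) (B m) y)
    = \sum_(m < n | m != l) - \tr (B l y *m (c m l y *: pmx (rshift n k) (B m) y)).
  rewrite -sumrN mulmx_sumr linear_sum; apply: eq_bigr => m _.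
  by rewrite mulmxN linearN.
(* The j-th summand of the diagonal coefficient at a_l is paired with the coefficient at a_j; as
   1/(a_j - a_l) = - 1/(a_l - a_j), together they form the derivative of Tr(B_l B_j). *)
rewrite -big_split /=.
apply: eq_bigr => j jl; have lj : l != j by rewrite eq_sym.
rewrite (negPf lj); apply: tr_exchange; first exact: partial_m_c.
by rewrite -invrN opprB.
Qed.

(* The components of d omega along da_l /\ da_k vanish. *)
Lemma partial_a_H l k y : U y ->
  partial (lshift d l) (Hform k) y = partial (lshift d k) (Hform l) y.
Proof.
move=> Uy; have [-> //|lk] := eqVneq l k.
(* By [schlesinger_cancel] only the explicit dependence on a_i is left, through the coefficient
   1/(a_j - a_i). *)
have E i j : i != j -> partial (lshift d i) (Hform j) y = c i j y * c i j y * \tr (B i y *m B j y).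
  move=> ij; rewrite (holomorphic_H j).2 // big_split /=.
  under [X in _ + X]eq_bigr => m _ do rewrite !dB //.
  rewrite (@schlesinger_cancel _ n N (fun i => time i y) (fun i => B i y) (time_inj Uy) i j ij) addr0.
  have lE (s t : 'I_n) : (lshift d s == lshift d t) = (s == t) by exact: (inj_eq (@lshift_inj _ _)).
  rewrite (bigD1 i ij) big1 /= => [|m /andP[mj mi]].
    have ji : j != i by rewrite eq_sym.
    rewrite (holomorphic_c ji).2 // !lE eqxx (negPf ij) sub0r mulrN1 opprK addr0.
    by rewrite mxtrace_mulC; congr (_ * _); rewrite -(opprB (time i y)) invrN mulrNN.
  have jm : j != m by rewrite eq_sym.
  rewrite (holomorphic_c jm).2 // !lE (negPf ij) [i == m]eq_sym (negPf mi) subrr.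
  by rewrite mulr0 oppr0 mul0r.
have kl : k != l by rewrite eq_sym.
apply: etrans (E l k lk) (etrans _ (esym (E k l kl))).
by rewrite mxtrace_mulC; congr (_ * _); rewrite -(opprB (time k y)) invrN mulrNN.
Qed.

Definition Wform (k l : 'I_d) (y : pt) : C :=
  partial (rshift n k) (Jform l) y - partial (rshift n l) (Jform k) y.

Lemma holomorphic_W k l : holomorphic U (Wform k l).
Proof.
by apply: holomorphicB oU _ _; apply: (holomorphic_partial oU); exact: (holomorphic_J _).1.
Qed.

Lemma partial_W k l i y : U y -> partial i (Wform k l) y =
  partial i (partial (rshift n k) (Jform l)) y - partial i (partial (rshift n l) (Jform k)) y.
Proof.
move=> Uy; rewrite (partialB _ _ _ Uy) //; apply: (holomorphic_partial oU); exact: (holomorphic_J _).1.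
Qed.

Lemma partial_a_W k l i y : U y -> partial (lshift d i) (Wform k l) y = 0.
Proof.
move=> Uy; rewrite partial_W //.
have E k' l' : partial (lshift d i) (partial (rshift n k') (Jform l')) y
   = partial (rshift n k') (partial (rshift n l') (Hform i)) y.
  apply: etrans (partialC _ _ oU (holomorphic_J l').1 Uy) _.
  by apply: (partial_eqU oU) Uy => u Uu; exact: partial_a_J.
apply/eqP; rewrite subr_eq0; apply/eqP.
have C1 := partialC (rshift n k) (rshift n l) oU (holomorphic_H i).1 Uy.
have C2 := etrans (E k l) C1.
exact: (etrans C2 (esym (E l k))).
Qed.

(** The six second derivatives of J cancel in pairs by symmetry. *)
Lemma W_closed i j k y : U y ->
  partial (rshift n i) (Wform j k) y + partial (rshift n j) (Wform k i) y
  + partial (rshift n k) (Wform i j) y = 0.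
Proof.
move=> Uy; rewrite !partial_W //.
have S a b e : partial (rshift n a) (partial (rshift n b) (Jform e)) y
   = partial (rshift n b) (partial (rshift n a) (Jform e)) y.
  exact: partialC oU (holomorphic_J e).1 Uy.
have K (a b e a' b' e' : C) : a = a' -> b = b' -> e = e' -> a - b + (e - a') + (b' - e') = 0.
  by move=> -> -> ->; ring.
exact: K (S i j k) (S i k j) (S j k i).
Qed.

End LocalForm.

(** In the sum over pairs j < m, da_k occurs with sign + when m = k and with sign - when j = k.
    Antisymmetry of [c] gives the second kind the shape of the first, and every index other than k
    is met once. *)
Lemma sum_dln_coef (F : fieldType) (n : nat) (t c : 'I_n -> 'I_n -> F) (k : 'I_n) :
  (forall m j, t m j = t j m) -> (forall m j, c m j = - c j m) ->
  \sum_(m < n) \sum_(j < n | (j < m)%N) t m j * c m j * ((m == k)%:R - (j == k)%:R)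
  = \sum_(j < n | j != k) c k j * t k j.
Proof.
move=> tC cN; rewrite (bigD1 k) //= eqxx [RHS](bigID (fun j : 'I_n => (j < k)%N)) /=.
congr (_ + _).
  apply: eq_big => [j|j jk]; first by rewrite -val_eqE /=; case: ltngtP.
  have -> : (j == k) = false by apply/eqP => jE; move: jk; rewrite jE ltnn.
  by rewrite subr0 mulr1 mulrC.
have E (m : 'I_n) : m != k ->
    \sum_(j < n | (j < m)%N) t m j * c m j * ((m == k)%:R - (j == k)%:R)
     = if (k < m)%N then c k m * t k m else 0.
  move=> /negPf ->; rewrite big_mkcond (bigD1 k) //= eqxx sub0r mulrN1 big1 ?addr0.
    by case: ifP => // _; rewrite tC [c m k]cN mulrN opprK mulrC.
  by move=> j /negPf ->; rewrite subrr mulr0 if_same.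
rewrite (eq_bigr _ E) -big_mkcondr /=; apply: eq_bigl => m.
by rewrite -leqNgt -val_eqE /=; case: ltngtP.
Qed.

(** * Functions on the universal cover read in charts *)

Section Chart.
Variables (R : realType) (n N d : nat) (X Y : topologicalType)
  (pi : X -> 'rV[C R]_n) (rho : Y -> 'rV[C R]_n * C R) (q : Y -> X)
  (ell : option 'I_n -> X * C R -> Y)
  (W : set 'rV[C R]_d) (D : set (X * 'rV[C R]_d))
  (theta : option 'I_n -> 'rV[C R]_d -> 'rV[C R]_N)
  (Cm : option 'I_n -> 'rV[C R]_d -> 'M[C R]_N)
  (Ginf : 'rV[C R]_d -> 'M[C R]_N)
  (A G : option 'I_n -> X -> 'rV[C R]_d -> 'M[C R]_N)
  (Phi : Y -> 'rV[C R]_d -> 'M[C R]_N).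
Hypotheses (mk : marking pi rho q ell)
  (im : isomonodromic_family pi rho q ell W D theta Cm Ginf A G Phi).
Local Notation C := (C R).
Local Notation pt := 'rV[C]_(n + d).

Let rproj : 'M[C]_(n + d, d) := col_mx 0 1%:M.

Let rprojE (y : pt) : rsubmx y = 0 + y *m rproj.
Proof. by rewrite add0r -[in RHS](hsubmxK y) mul_row_col mulmx0 mulmx1 add0r. Qed.

Let lproj : 'M[C]_(n + d, n) := col_mx 1%:M 0.

Let lprojE (y : pt) : lsubmx y = 0 + y *m lproj.
Proof. by rewrite add0r -[in RHS](hsubmxK y) mul_row_col mulmx0 mulmx1 addr0. Qed.

Lemma continuous_rsubmx : continuous (rsubmx : pt -> 'rV[C]_d).
Proof.
have -> : (rsubmx : pt -> 'rV[C]_d) = (fun y => 0 + y *m rproj) by apply/funext => y; exact: rprojE.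
exact: continuous_affine.
Qed.

Lemma continuous_lsubmx : continuous (lsubmx : pt -> 'rV[C]_n).
Proof.
have -> : (lsubmx : pt -> 'rV[C]_n) = (fun y => 0 + y *m lproj) by apply/funext => y; exact: lprojE.
exact: continuous_affine.
Qed.

Lemma rsubmx_basis (l : 'I_n) (h : C) (y : pt) :
  rsubmx (h *: Defs.basis R (lshift d l) + y) = rsubmx y.
Proof.
apply/rowP => j; rewrite !mxE /= (_ : _ == _ = false) ?mulr0 ?add0r //.
by apply/eqP => /(congr1 val) /= E; have := ltn_ord l; rewrite -E ltnNge leq_addr.
Qed.

Lemma section_times V s a : local_section pi V s -> V a -> @times R n a.
Proof.
move=> [_ _ ps] Va; have [[_ rT _] _] := mk_times mk.
by rewrite -rT -(ps a Va); exists (s a).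
Qed.

Section WithSection.
Variables (V : set 'rV[C]_n) (s : 'rV[C]_n -> X).
Hypothesis sec : local_section pi V s.
Local Notation U := (chart_dom D V s).

Lemma section_continuous a : V a -> s @ a --> s a.
Proof.
move=> Va; have [oV cs _] := sec.
rewrite continuous_open_subspace // in cs.
exact: cs (mem_set Va).
Qed.

Lemma open_chart_dom : open U.
Proof.
have [oV cs _] := sec.
rewrite openE => y [Vy Dy].
have lc := @continuous_lsubmx y.
have sc := continuous_comp lc (section_continuous Vy).
have rc := @continuous_rsubmx y.
have nD : nbhs (s (lsubmx y), rsubmx y) D by apply: open_nbhs_nbhs; split => //; exact: im_D im.
have nV : nbhs (lsubmx y) V by exact: open_nbhs_nbhs.
have pc : (fun y' : pt => (s (lsubmx y'), rsubmx y')) @ y --> (s (lsubmx y), rsubmx y).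
  exact: cvg_pair sc rc.
by apply: filterI; [exact: lc nV|exact: pc nD].
Qed.

Let B k := in_chart (A (Some k)) s : pt -> 'M[C]_N.
Let g nu := in_chart (G nu) s : pt -> 'M[C]_N.
Definition Theta nu (y : pt) : 'M[C]_N := diag_mx (theta nu (rsubmx y)).

Lemma mxhol_chart_A nu : mxhol U (in_chart (A nu) s : pt -> 'M[C]_N).
Proof. exact: mxhol_of_holomorphic open_chart_dom (im_A_hol im nu sec). Qed.

Lemma mxhol_chart_G nu : mxhol U (g nu).
Proof. exact: mxhol_of_holomorphic open_chart_dom (im_G_hol im nu sec). Qed.

Lemma chart_W y : U y -> W (rsubmx y).
Proof. by move=> [_ Dy]; exact: (im_DW im Dy). Qed.

Lemma mxhol_Theta nu : mxhol U (Theta nu).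
Proof.
move=> a b.
have hW : holomorphic W (fun m => theta nu m 0 a : C).
  exact: mxhol_of_holomorphic (im_W im) (im_theta_hol im nu) 0 a.
have := @holomorphic_affine R d (n + d) W (fun m => theta nu m 0 a : C) 0 rproj (im_W im) hW.
have [ab|ab] := eqVneq a b.
  move=> h1; rewrite (_ : (fun y => _) = (fun y => theta nu (0 + y *m rproj) 0 a : C)).
    by apply: holomorphicS h1 => y Uy; rewrite /= -rprojE; exact: chart_W.
  by apply/funext => y; rewrite mxE ab eqxx mulr1n rprojE.
move=> _; rewrite (_ : (fun y => _) = (fun=> 0)); first exact: holomorphic_cst open_chart_dom.
by apply/funext => y; rewrite mxE (negPf ab).
Qed.

Lemma pmx_Theta nu l y : U y -> pmx (lshift d l) (Theta nu) y = 0.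
Proof.
move=> Uy; apply/matrixP => a b; rewrite pmx_entry [RHS]mxE; apply: partial_invariant => h.
by rewrite /Theta rsubmx_basis.
Qed.

Lemma chart_G_unit nu y : U y -> g nu y \in unitmx.
Proof. by move=> [_ Dy]; exact: im_G_unit im nu _ _ Dy. Qed.

Lemma timeE k (y : pt) : time k y = lsubmx y 0 k.
Proof. by rewrite mxE. Qed.

Lemma chart_time_inj y : U y -> forall i j, i != j -> time i y != time j y.
Proof. by move=> [Vy _] i j ij; rewrite !timeE; exact: section_times sec Vy i j ij. Qed.

Lemma chart_diag k y : U y -> B k y = g (Some k) y *m Theta (Some k) y *m invmx (g (Some k) y).
Proof. by move=> [_ Dy]; exact: im_diag im (Some k) _ _ Dy. Qed.

Lemma pmx_chart_G l k y : U y ->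
  pmx (lshift d l) (g (Some k)) y = connection B l k y *m g (Some k) y.
Proof.
move=> Uy; have uy := chart_G_unit (Some k) Uy.
rewrite -(pmxE (lshift d l) (im_G_hol im (Some k) sec) Uy) /connection.
rewrite -[LHS](mulmxKV uy); congr (_ *m _).
have [->|lk] := eqVneq l k.
  have := im_dG_diag im k sec Uy; rewrite /partial_a => ->; congr (- _).
  by apply: eq_bigr => m _; rewrite !timeE.
by have := im_dG im sec Uy lk; rewrite /partial_a => ->; rewrite !timeE.
Qed.

Lemma pmx_chart_Ginf l y : U y -> pmx (lshift d l) (g None) y = 0.
Proof.
move=> Uy.
have E u : U u -> g None u = Ginf (rsubmx u) by move=> [_ Du]; exact: im_Ginf im _ _ Du.
rewrite (pmx_eqU open_chart_dom (lshift d l) E Uy).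
apply/matrixP => a b; rewrite pmx_entry [RHS]mxE; apply: partial_invariant => h.
by rewrite rsubmx_basis.
Qed.

Lemma pmx_chart_A l k y : U y ->
  pmx (lshift d l) (B k) y = schlesinger (fun i => time i y) (fun i => B i y) l k.
Proof.
move=> Uy; rewrite -(pmxE (lshift d l) (im_A_hol im (Some k) sec) Uy) /schlesinger.
have [->|lk] := eqVneq l k.
  have := im_dA_diag im k sec Uy; rewrite /partial_a => ->; congr (- _).
  by apply: eq_bigr => m _; rewrite !timeE.
by have := im_dA im sec Uy lk; rewrite /partial_a => ->; rewrite !timeE.
Qed.

Definition chart_J := Jform g Theta.
Definition chart_H := Hform B.
Definition chart_W2 := Wform g Theta.

Lemma omega_a k y : U y -> omega theta A G s y 0 (lshift d k) = chart_H k y.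
Proof.
move=> Uy; rewrite /omega !mxE !summxE.
rewrite [X in _ + X]big1 ?addr0; last by move=> nu _; rewrite row_mxEl mxE.
pose t m j : C := \tr (B m y *m B j y).
have tC m j : t m j = t j m by rewrite /t mxtrace_mulC.
pose c m j : C := (time m y - time j y)^-1.
have E (m : 'I_n) : (\sum_(nu < n | (nu < m)%N) \tr (in_chart (A (Some m)) s y *m in_chart (A (Some nu)) s y)
        *: dln_diff m nu y) 0 (lshift d k)
    = \sum_(nu < n | (nu < m)%N) t m nu * c m nu * ((m == k)%:R - (nu == k)%:R).
  rewrite summxE; apply: eq_bigr => j _; rewrite !mxE /= mulrA.
  by rewrite !(inj_eq (@lshift_inj _ _)) ![k == _]eq_sym.
rewrite (eq_bigr _ (fun m _ => E m)); apply: sum_dln_coef => // m j.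
by rewrite /c -invrN opprB.
Qed.

Lemma omega_m k y : U y -> omega theta A G s y 0 (rshift n k) = chart_J k y.
Proof.
move=> Uy; rewrite /omega !mxE !summxE.
rewrite [X in X + _]big1 ?add0r => [|m _].
  apply: eq_bigr => nu _; rewrite row_mxEr mxE /Jterm /partial_m.
  by rewrite (pmxE (rshift n k) (im_G_hol im nu sec) Uy).
rewrite summxE big1 // => j _; rewrite !mxE /=.
have E (i : 'I_n) : (rshift n k == lshift d i) = false.
  by apply/eqP => /(congr1 val) /= E; have := ltn_ord i; rewrite -E ltnNge leq_addr.
by rewrite !E subrr !mulr0.
Qed.

Let oU := open_chart_dom.
Let hB k : mxhol U (B k) := @mxhol_chart_A (Some k).

Lemma chart_holomorphic_J k : holomorphic U (chart_J k).
Proof. exact: (holomorphic_J oU mxhol_chart_G mxhol_Theta chart_G_unit k).1. Qed.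

Lemma chart_holomorphic_H k : holomorphic U (chart_H k).
Proof. exact: (holomorphic_H oU hB chart_time_inj k).1. Qed.

Lemma chart_holomorphic_W2 k l : holomorphic U (chart_W2 k l).
Proof. exact: (holomorphic_W oU mxhol_chart_G mxhol_Theta chart_G_unit k l). Qed.

Lemma chart_partial_a_W2 k l i y : U y -> partial (lshift d i) (chart_W2 k l) y = 0.
Proof.
exact: (partial_a_W oU hB mxhol_chart_G mxhol_Theta chart_G_unit chart_time_inj pmx_Theta
  chart_diag pmx_chart_G pmx_chart_Ginf k l i).
Qed.

Lemma chart_W2_closed i j k y : U y ->
  partial (rshift n i) (chart_W2 j k) y + partial (rshift n j) (chart_W2 k i) y
  + partial (rshift n k) (chart_W2 i j) y = 0.
Proof. exact: (W_closed oU mxhol_chart_G mxhol_Theta chart_G_unit i j k). Qed.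

Lemma omega_holomorphic : holomorphic U (omega theta A G s).
Proof.
apply: (holomorphic_of_mxhol oU) => a j; rewrite (ord1 a).
case: (split_ordP j) => k ->; apply: holomorphic_local => y Uy.
  exists U, (chart_H k); split=> //; [exact: chart_holomorphic_H|].
  by move=> u Uu; exact: omega_a.
exists U, (chart_J k); split=> //; [exact: chart_holomorphic_J|].
by move=> u Uu; exact: omega_m.
Qed.

Lemma ext_d_omega y : U y -> ext_d (omega theta A G s) y =
  block_mx 0 0 0 (\matrix_(k, l) chart_W2 k l y).
Proof.
move=> Uy.
have Ea i k : partial i (fun u => omega theta A G s u 0 (lshift d k) : C) y = partial i (chart_H k) y.
  by apply: (partial_eqU oU) Uy => u Uu; exact: omega_a.
have Em i k : partial i (fun u => omega theta A G s u 0 (rshift n k) : C) y = partial i (chart_J k) y.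
  by apply: (partial_eqU oU) Uy => u Uu; exact: omega_m.
have aJ l k : partial (lshift d l) (chart_J k) y = partial (rshift n k) (chart_H l) y.
  exact: (partial_a_J oU hB mxhol_chart_G mxhol_Theta chart_G_unit chart_time_inj pmx_Theta
    chart_diag pmx_chart_G pmx_chart_Ginf l k Uy).
have aH l k : partial (lshift d l) (chart_H k) y = partial (lshift d k) (chart_H l) y.
  exact: (partial_a_H oU hB chart_time_inj pmx_chart_A l k Uy).
have sub (a b a' b' r : C) : a = a' -> b = b' -> a' - b' = r -> a - b = r by move=> -> ->.
apply/matrixP => i j; rewrite [LHS]mxE.
case: (split_ordP i) => k ->; case: (split_ordP j) => l ->.
- rewrite block_mxEul mxE; apply: (sub _ _ _ _ _ (Ea _ _) (Ea _ _)).
  by apply/eqP; rewrite subr_eq0; apply/eqP; exact: aH.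
- rewrite block_mxEur mxE; apply: (sub _ _ _ _ _ (Em _ _) (Ea _ _)).
  by apply/eqP; rewrite subr_eq0; apply/eqP; exact: aJ.
- rewrite block_mxEdl mxE; apply: (sub _ _ _ _ _ (Ea _ _) (Em _ _)).
  by apply/eqP; rewrite subr_eq0; apply/eqP; exact: esym (aJ _ _).
- by rewrite block_mxEdr mxE; apply: (sub _ _ _ _ _ (Em _ _) (Em _ _)).
Qed.

End WithSection.

(** * Local sections of the covering *)

Let cov : covering_map pi (@times R n) := (mk_times mk).1.

Let pi_cont : continuous pi. Proof. by have [] := cov. Qed.

(** By continuity both sections stay in the sheet through their common value, over an evenly covered
    neighbourhood, and within a sheet a point is determined by its image. *)
Lemma local_section_agree V s V' s' a : local_section pi V s -> local_section pi V' s' ->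
  V a -> V' a -> s a = s' a -> \forall b \near a, [/\ V b, V' b & s b = s' b].
Proof.
move=> S S' Va V'a E.
have [[oV _ ps] [oV' _ ps']] := (S, S').
have [_ rT ev] := cov.
have [V0 [V0a V0T [I [t [ts to tu]]]]] := ev a (section_times S Va).
have V0sa : V0 (pi (s a)) by rewrite ps.
have [i [Oa _]] := tu (s a) V0sa.
have n1 : \forall b \near a, (t i @` V0) (s b).
  by apply: (section_continuous S Va); exact: open_nbhs_nbhs.
have n2 : \forall b \near a, (t i @` V0) (s' b).
  by apply: (section_continuous S' V'a); apply: open_nbhs_nbhs; rewrite -E.
have n3 : nbhs a V by exact: open_nbhs_nbhs.
have n4 : nbhs a V' by exact: open_nbhs_nbhs.
have [_ _ pt'] := ts i.
have sheet x : (t i @` V0) x -> x = t i (pi x) by move=> [v Vv <-]; rewrite pt'.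
apply: filterS (filterI (filterI n1 n2) (filterI n3 n4)) => b [[ob1 ob2] [Vb V'b]].
split; [exact: Vb | exact: V'b |].
by rewrite (sheet _ ob1) (sheet _ ob2) (ps _ Vb) (ps' _ V'b).
Qed.

Lemma section_through x : exists Vs : set 'rV[C]_n * ('rV[C]_n -> X),
  [/\ local_section pi Vs.1 Vs.2, Vs.1 (pi x) & Vs.2 (pi x) = x].
Proof.
have [_ rT ev] := cov.
have Tx : @times R n (pi x) by rewrite -rT; exists x.
have [V0 [V0a V0T [I [t [ts to tu]]]]] := ev (pi x) Tx.
have [i [[v Vv tv] _]] := tu x V0a.
exists (V0, t i); split=> //=; have [_ _ pt'] := ts i.
by rewrite -tv pt'.
Qed.

(** Near [x] the section agrees with that of the sheet containing [x]; the sheet is open, and there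
    its section inverts [pi] from both sides. *)
Lemma near_section x V s : local_section pi V s -> V (pi x) -> s (pi x) = x ->
  \forall x' \near x, V (pi x') /\ s (pi x') = x'.
Proof.
move=> S Vx sx; have [_ rT ev] := cov.
have Tx : @times R n (pi x) by rewrite -rT; exists x.
have [V0 [V0a V0T [I [t [ts to tu]]]]] := ev (pi x) Tx.
have [i [Ox _]] := tu x V0a.
have [_ _ pt'] := ts i.
have sheet x' : (t i @` V0) x' -> t i (pi x') = x' by move=> [v Vv <-]; rewrite pt'.
have E : s (pi x) = t i (pi x) by rewrite sx sheet.
have n1 : \forall x' \near x, [/\ V (pi x'), V0 (pi x') & s (pi x') = t i (pi x')].
  exact: (@pi_cont x _ (local_section_agree S (ts i) Vx V0a E)).
have n2 : nbhs x (t i @` V0) by exact: open_nbhs_nbhs.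
apply: filterS (filterI n1 n2) => x' [[Vx' _ Ex'] Ox'].
by rewrite Ex' sheet.
Qed.

(** Values and derivatives see only the germ of the section, so the components do not change from
    one chart to another. *)
Lemma chart_W2_germ (O : set pt) s s' k l y : open O -> O y ->
  (forall u, O u -> s (lsubmx u) = s' (lsubmx u)) ->
  chart_W2 s k l y = chart_W2 s' k l y.
Proof.
move=> oO Oy E.
have EG nu u : O u -> in_chart (G nu) s u = in_chart (G nu) s' u.
  by move=> Ou; rewrite /in_chart E.
have EJ e u : O u -> chart_J s e u = chart_J s' e u.
  move=> Ou; apply: eq_bigr => nu _.
  have P := pmx_eqU oO (rshift n e) (EG nu) Ou.
  exact: (f_equal2 (fun g1 g2 => \tr (Theta nu u *m invmx g1 *m g2)) (EG nu u Ou) P).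
have K e f := partial_eqU oO (rshift n e) (EJ f) Oy.
exact: (f_equal2 (fun a b : C => a - b) (K k l) (K l k)).
Qed.

(** An arbitrary choice: by [curvatureE], at points of [D] every section through [x] yields the same
    components. *)
Definition section_at x : 'rV[C]_n -> X := (sval (cid (section_through x))).2.

(* The dm /\ dm components of d omega, as a function on the universal cover. *)
Definition curvature x (m : 'rV[C]_d) : 'M[C]_d :=
  \matrix_(k, l) chart_W2 (section_at x) k l (row_mx (pi x) m).

Lemma curvatureE V s y : local_section pi V s -> chart_dom D V s y ->
  (\matrix_(k, l) chart_W2 s k l y) = curvature (s (lsubmx y)) (rsubmx y).
Proof.
move=> S [Vy Dy]; have [oV _ ps] := S.
set x := s _; have [S' Vx sx] := svalP (cid (section_through x)).
rewrite -/(section_at x) in S' sx.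
have px : pi x = lsubmx y by rewrite ps.
have E : s (lsubmx y) = section_at x (lsubmx y).
  by apply: etrans (esym sx) _; rewrite px.
have Vx' : (sval (cid (section_through x))).1 (lsubmx y).
  by move: Vx; case: (sval _) => V' ? /=; rewrite px.
have := local_section_agree S S' Vy Vx' E; rewrite /prop_near1 nbhsE => -[V0 [oV0 V0a] V0P].
have yx : row_mx (pi x) (rsubmx y) = y by rewrite px hsubmxK.
apply: eq_mx => k l; apply: etrans _ (f_equal (chart_W2 (section_at x) k l) (esym yx)).
apply: (@chart_W2_germ [set u : pt | V0 (lsubmx u)]); [|exact: V0a|].
  by apply: (@open_comp _ _ (lsubmx : pt -> 'rV[C]_n)) => // u _; exact: continuous_lsubmx.
by move=> u /V0P[].
Qed.

(** The segment from (a, m) to (b, m) has no monodromy component, and the time derivatives of the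
    components vanish along it. *)
Lemma curvature_locally_constant V s a m : local_section pi V s -> V a -> D (s a, m) ->
  exists2 e : R, 0 < e & forall b : 'rV[C]_n, `|b - a| < rC e ->
    [/\ V b, D (s b, m) & curvature (s b) m = curvature (s a) m].
Proof.
move=> S Va Da; pose U := chart_dom D V s; pose y : pt := row_mx a m.
have oU := open_chart_dom S.
have Uy : U y by rewrite /U /chart_dom /= row_mxKl row_mxKr.
have /near_ball[e e0 eP] : \forall y' \near y, U y' by exact: open_nbhs_nbhs.
exists e; first exact: e0.
move=> b ba; pose h : pt := row_mx (b - a) 0.
have nh : `|h| <= `|b - a|.
  apply: ler_row_norm => // j; case: (split_ordP j) => i ->.
    by rewrite row_mxEl; exact: ler_coord_norm.
  by rewrite row_mxEr mxE normr0.
have yb : y + h = row_mx b m by rewrite /y /h add_row_mx addrC subrK addr0.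
have Us (t : R) : 0 <= t <= 1 -> U (y + rC t *: h).
  move=> /andP[t0 t1]; apply: eP; rewrite addrAC subrr add0r normrZ norm_rC ger0_norm //.
  apply: le_lt_trans ba; apply: le_trans nh.
  by rewrite -[leRHS]mul1r ler_wpM2r // -rC1 ler_rC.
have Ub : U (row_mx b m).
  by rewrite -yb -[h]scale1r -rC1; apply: Us; rewrite ler01 lexx.
have := Ub; rewrite /U /chart_dom /= row_mxKl row_mxKr => -[Vb Db].
split; [exact: Vb | exact: Db |].
have := curvatureE S Ub; rewrite row_mxKl row_mxKr => <-.
have := curvatureE S Uy; rewrite row_mxKl row_mxKr => <-.
apply: eq_mx => k l; apply: etrans (f_equal (chart_W2 s k l) (esym yb)) _.
have hW := chart_holomorphic_W2 S k l.
have D0 (t : R) : 0 <= t <= 1 -> 'D_h (chart_W2 s k l) (y + rC t *: h) = 0.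
  move=> t01; rewrite (derive_rowE _ (hW _ (Us t t01)).1) big1 // => j _.
  case: (split_ordP j) => i ->.
    have Z := chart_partial_a_W2 S k l i (Us t t01).
    exact: etrans (f_equal2 *%R erefl Z) (mulr0 _).
  by rewrite row_mxEr mxE mul0r.
have := @MVI_line R _ (chart_W2 s k l) y h 0 0.
rewrite mulr0 subr0 => H; apply/eqP; rewrite -subr_eq0 -normr_le0; apply: H.
  by move=> t t01; apply: diff_derivable; exact: (hW _ (Us t t01)).1.
by move=> t t01; rewrite D0 // subr0 normr0.
Qed.

(** The problem is solvable at the non-zeros of the common denominator, and these are dense. *)
Lemma D_dense m (x : X) (O : set X) : W m -> nbhs x O -> exists2 x', O x' & D (x', m).
Proof.
move=> Wm nO; have [V [s [h [S [Vx sx] _ [cl Dh] _]]]] := im_mero im x Wm.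
have n1 : \forall b \near pi x, O (s b).
  by apply: (section_continuous S Vx); rewrite sx.
have [b [[Vb hb] Ob]] := cl _ Vx _ n1.
by exists (s b); last exact: Dh.
Qed.

(** The point [x0] may itself be a pole: the value is shared by all nearby points of D_m, even if
    the polar locus were to separate them. *)
Lemma curvature_near (x0 : X) m : W m -> exists c, \forall x \near x0, D (x, m) -> curvature x m = c.
Proof.
move=> Wm; have [V [s [h [S [Vx sx] hh [cl Dh] _]]]] := im_mero im x0 Wm.
have [oV _ ps] := S.
set a0 := pi x0 in Vx sx *.
have /near_ball[e e0 eP] : \forall b \near a0, V b by exact: open_nbhs_nbhs.
(* For a and b within r of a0 and |u| < 2, the point a + u (b - a) lies within r + 4 r of a0, hence
   in V. *)
pose r := e / 8.
have r0 : 0 < r by rewrite divr_gt0.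
have conn a b : `|a - a0| < rC r -> `|b - a0| < rC r -> h a != 0 -> h b != 0 ->
    curvature (s a) m = curvature (s b) m.
  move=> ar br ha hb; pose M : 'M[C]_(1, n) := b - a.
  have uM (u : 'rV[C]_1) : u *m M = u 0 0 *: M.
    by apply/rowP => j; rewrite mxE big_ord1 [RHS]mxE.
  have nM : `|M| <= rC (2 * r).
    have -> : M = (b - a0) + (a0 - a) by rewrite addrA subrK.
    apply: le_trans (ler_normD _ _) _; rewrite mulr2n mulrDl mul1r rCD.
    by apply: lerD; apply: ltW => //; rewrite distrC.
  have Vu (u : 'rV[C]_1) : `|u| < rC 2 -> V (a + u *m M).
    move=> u2; apply: eP; rewrite addrAC uM; apply: le_lt_trans (ler_normD _ _) _.
    have -> : e = r + 7 * r by rewrite /r; field.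
    rewrite rCD; apply: ltr_leD ar _; rewrite normrZ -norm_row1.
    apply: le_trans (_ : rC 2 * rC (2 * r) <= _); first by apply: ler_pM => //; exact: ltW.
    by rewrite -rCM ler_rC; move: (ltW r0); lra.
  have hg : holomorphic [set u : 'rV[C]_1 | `|u| < rC 2] (fun u => h (a + u *m M)).
    by apply: holomorphicS (holomorphic_affine (y0 := a) (M := M) oV hh) => u; exact: Vu.
  have R2 : 1 < (2 : R) by rewrite ltr1n.
  have := @locally_constant_off_zeros R 2 R2 (fun u => h (a + u *m M))
    (fun u => curvature (s (a + u *m M)) m = curvature (s b) m) hg.
  rewrite mul0mx addr0.
  have -> : a + Defs.basis R ord0 *m M = b.
    by rewrite uM mxE !eqxx scale1r addrC subrK.
  apply=> // u u2 hu.
  have [e1 e10 e1P] := curvature_locally_constant S (Vu u u2) (Dh _ (Vu u u2) hu).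
  exists (e1 / (2 * r)); first by rewrite divr_gt0 // mulr_gt0.
  move=> u' uu; have [|_ _ ->//] := e1P (a + u' *m M).
  rewrite [a + u' *m M]addrC addrKA -mulmxBl uM normrZ -norm_row1.
  have n2 : 0 < 2 * r by rewrite mulr_gt0.
  apply: le_lt_trans (_ : `|u' - u| * rC (2 * r) < _); first exact: ler_wpM2l.
  rewrite (_ : e1 = e1 / (2 * r) * (2 * r)); last by rewrite divfK // gt_eqF.
  by rewrite [X in _ < X]rCM ltr_pM2r // -rC0 ltr_rC.
have nr : \forall b \near a0, `|b - a0| < rC r by apply/near_ball; exists r.
have [b0 [[Vb0 hb0] b0r]] := cl _ Vx _ nr.
exists (curvature (s b0) m).
have n1 := near_section S Vx sx.
have n2 := @pi_cont x0 _ nr.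
apply: filterS (filterI n1 n2) => x [[Vpx spx] pxr] Dx.
rewrite -{1}spx; rewrite -spx in Dx.
(* Although x is in D_m, h may vanish at its image; moving to a nearby non-zero b1 of h leaves the
   curvature unchanged. *)
have [e1 e10 e1P] := curvature_locally_constant S Vpx Dx.
have n3 : \forall b \near pi x, `|b - pi x| < rC e1 by apply/near_ball; exists e1.
have n4 : \forall b \near pi x, `|b - a0| < rC r.
  apply/near_ball; exists (r - re `|pi x - a0|); first by rewrite subr_gt0 -ltr_rC -rC_norm.
  move=> b bx; have -> : b - a0 = (b - pi x) + (pi x - a0) by rewrite addrA subrK.
  apply: le_lt_trans (ler_normD _ _) _.
  have -> : r = (r - re `|pi x - a0|) + re `|pi x - a0| by rewrite subrK.
  by rewrite rCD -rC_norm ltrD2r.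
have [b1 [[Vb1 hb1] [/e1P[_ _ <-] b1r]]] := cl _ Vpx _ (filterI n3 n4).
exact: conn.
Qed.

(** * Constancy along paths *)

Lemma rderive_locally_constant (F : R -> C) (t : R) :
  (\forall t' \near t, F t' = F t) -> rderive F t 0.
Proof.
move=> H; have [e e0 eP] := (iffLR (@nbhs_ballP _ R^o _ _)) H.
apply: (@cvg_trans _ ((fun=> 0 : C) @ (0 : R)^')); last exact: cvg_cst.
apply: near_eq_cvg; rewrite near_withinE; apply/(@nbhs_ballP _ R^o); exists e => // h.
rewrite -ball_normE /= sub0r normrN => he _.
rewrite eP ?subrr ?mulr0 // -ball_normE /= opprD addNKr normrN //.
Qed.

(** A path is continuous within [0, 1] only; composing it with this retraction gives a function on
    all of R, so that two-sided derivatives make sense at the ends. *)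
Definition clamp (t : R) : R := if t <= 0 then 0 else if 1 <= t then 1 else t.

Lemma clamp01 t : 0 <= clamp t <= 1.
Proof. by rewrite /clamp; case: (leP t 0) => ?; case: (leP 1 t) => ?; apply/andP; split; lra. Qed.

Lemma clamp_lipschitz t t' : `|clamp t' - clamp t| <= `|t' - t|.
Proof.
rewrite ler_norml /clamp.
have := ler_norm (t' - t); have := ler_norm (- (t' - t)); rewrite normrN.
by case: (leP t 0) => ?; case: (leP 1 t) => ?; case: (leP t' 0) => ?; case: (leP 1 t') => ? ? ?;
  apply/andP; split; lra.
Qed.

(** The local value [c] exists at every point of the cover. It is locally constant because the
    neighbourhoods attached to two close points share a point of the dense set D_m, so it is
    constant along any path. *)
Lemma curvature_const m x x' : D (x, m) -> D (x', m) -> curvature x m = curvature x' m.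
Proof.
move=> Dx Dx'; have Wm := im_DW im Dx.
have [_ paths _] := (mk_times mk).2.
have [g [gc g0 g1]] := paths x x'.
pose c x0 := sval (cid (curvature_near x0 Wm)).
have cP x0 : \forall x \near x0, D (x, m) -> curvature x m = c x0 := svalP (cid (curvature_near x0 Wm)).
have cD x0 : D (x0, m) -> curvature x0 m = c x0 by move=> D0; exact: (nbhs_singleton (cP x0)).
have cloc x0 : \forall x1 \near x0, c x1 = c x0.
  have := nbhs_interior (cP x0); apply: filterS => x1 n1.
  have [z [z1 z2] Dz] := D_dense Wm (filterI n1 (cP x1)).
  by rewrite -z1 // -z2.
pose f t := c (g (clamp t)).
have floc t : \forall t' \near t, f t' = f t.
  have ct : `[(0 : R), 1]%classic (clamp t) by rewrite /= in_itv /=; exact: clamp01.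
  have := (subspace_continuousP _ _).1 gc _ ct _ (cloc (g (clamp t))).
  move=> H; have [e e0 eP] := (iffLR (@nbhs_ballP _ R^o _ _)) H.
  apply/(@nbhs_ballP _ R^o); exists e => // t'; rewrite -ball_normE /= => tt.
  apply: eP; last by rewrite /= in_itv /=; exact: clamp01.
  by rewrite -ball_normE /=; apply: le_lt_trans (clamp_lipschitz _ _) tt.
(* A complex-valued indicator, so that constancy on [0, 1] follows from a vanishing derivative. *)
pose F t : C := (f t != f 0)%:R.
have dF t : 0 <= t <= 1 -> rderive F t 0.
  move=> _; apply: rderive_locally_constant.
  by apply: filterS (floc t) => t' E; rewrite /F E.
have := rderive_cst01 dF; rewrite /F eqxx /= => /eqP.
rewrite pnatr_eq0 eqb0 negbK => /eqP.
have c1 : clamp 1 = 1 by rewrite /clamp leNgt ltr01 lexx.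
have c0 : clamp 0 = 0 by rewrite /clamp lexx.
rewrite /f c1 c0 g0 g1 => E.
by apply: etrans (cD x Dx) _; apply: etrans (esym E) _; exact: esym (cD x' Dx').
Qed.

(** * The 2-form on the space of monodromy data *)

Definition reduced_form (m : 'rV[C]_d) : 'M[C]_d :=
  if pselect (exists x, D (x, m)) is left H then curvature (sval (cid H)) m else 0.

Lemma reduced_formE x m : D (x, m) -> reduced_form m = curvature x m.
Proof.
rewrite /reduced_form => Dx; case: pselect => [H|[]]; last by exists x.
apply: curvature_const => //; exact: svalP (cid H).
Qed.

Lemma reduced_form_anti m : (reduced_form m)^T = - reduced_form m.
Proof.
rewrite /reduced_form; case: pselect => [H|_]; last by rewrite trmx0 oppr0.
by apply/matrixP => k l; rewrite !mxE /chart_W2 /Wform opprB.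
Qed.

Let mproj : 'M[C]_(d, n + d) := row_mx 0 1%:M.

Lemma reduced_form_local m0 : W m0 -> exists V s a,
  [/\ local_section pi V s, chart_dom D V s (row_mx a 0 + m0 *m mproj) &
   forall m, chart_dom D V s (row_mx a 0 + m *m mproj) ->
    forall k l, reduced_form m k l = chart_W2 s k l (row_mx a 0 + m *m mproj)].
Proof.
move=> Wm; have [[x _] _ _] := (mk_times mk).2.
have [x0 _ D0] := D_dense Wm (@filterT _ (nbhs x) _).
have [[V s] /= [S Vx sx]] := section_through x0.
have E (m : 'rV[C]_d) : row_mx (pi x0) 0 + m *m mproj = row_mx (pi x0) m.
  by rewrite mul_mx_row mulmx0 mulmx1 add_row_mx addr0 add0r.
exists V, s, (pi x0); split=> //.
  by rewrite E /chart_dom /= row_mxKl row_mxKr sx.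
move=> m; rewrite E => Um k l.
have := curvatureE S Um; rewrite row_mxKl row_mxKr sx => H.
have := Um; rewrite /chart_dom /= row_mxKl row_mxKr sx => -[_ Dm].
by rewrite (reduced_formE Dm) -H mxE.
Qed.

Lemma reduced_form_holomorphic : holomorphic W reduced_form.
Proof.
apply: (holomorphic_of_mxhol (im_W im)) => k l; apply: holomorphic_local => m0 Wm.
have [V [s [a [S U0 E]]]] := reduced_form_local Wm.
have oU := open_chart_dom S.
exists [set m | chart_dom D V s (row_mx a 0 + m *m mproj)], (fun m => chart_W2 s k l (row_mx a 0 + m *m mproj)).
split.
- exact: (open_affine (y0 := row_mx a 0) (M := mproj) oU).
- exact: U0.
- exact: (holomorphic_affine oU (chart_holomorphic_W2 S k l)).
- by move=> m Um; exact: E.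
Qed.

Lemma reduced_form_closed : closed_2form W reduced_form.
Proof.
move=> m0 Wm i j k; have [V [s [a [S U0 E]]]] := reduced_form_local Wm.
have oU := open_chart_dom S; have oW := open_affine (y0 := row_mx a 0) (M := mproj) oU.
have P e f f' : partial e (fun u => reduced_form u f f' : C) m0
    = partial (rshift n e) (chart_W2 s f f') (row_mx a 0 + m0 *m mproj).
  apply: etrans (partial_eqU oW e (fun m Um => E m Um f f') U0) _.
  have [_ H] := affine_differentiable oU (chart_holomorphic_W2 S f f') U0.
  (* The slice m -> (a, m) sends the e-th basis vector to that of the e-th monodromy coordinate, so
     a single term of the chain rule survives. *)
  rewrite H big_split_ord /= big1 ?add0r => [|l _]; last by rewrite row_mxEl mxE mul0r.
  rewrite (bigD1 e) //= row_mxEr mxE eqxx mul1r big1 ?addr0 // => l le.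
  by rewrite row_mxEr mxE eq_sym (negPf le) mul0r.
have K (x1 x2 x3 y1 y2 y3 : C) : x1 = y1 -> x2 = y2 -> x3 = y3 -> y1 + y2 + y3 = 0 -> x1 + x2 + x3 = 0.
  by move=> -> -> ->.
apply: K (P i j k) (P j k i) (P k i j) _.
exact: (chart_W2_closed S i j k U0).
Qed.

End Chart.
Theorem proposition2p3 (R : realType) (n N d : nat) (X Y : topologicalType)
    (pi : X -> 'rV[C R]_n) (rho : Y -> 'rV[C R]_n * C R) (q : Y -> X)
    (ell : option 'I_n -> X * C R -> Y)
    (W : set 'rV[C R]_d) (D : set (X * 'rV[C R]_d))
    (theta : option 'I_n -> 'rV[C R]_d -> 'rV[C R]_N)
    (Cm : option 'I_n -> 'rV[C R]_d -> 'M[C R]_N)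
    (Ginf : 'rV[C R]_d -> 'M[C R]_N)
    (A G : option 'I_n -> X -> 'rV[C R]_d -> 'M[C R]_N)
    (Phi : Y -> 'rV[C R]_d -> 'M[C R]_N) :
  marking pi rho q ell ->
  isomonodromic_family pi rho q ell W D theta Cm Ginf A G Phi ->
  (forall V s, local_section pi V s ->
     holomorphic (chart_dom D V s) (omega theta A G s)) /\
  exists Om : 'rV[C R]_d -> 'M[C R]_d,
    [/\ holomorphic W Om,
        forall m, W m -> (Om m)^T = - Om m,
        closed_2form W Om &
        forall V s y, local_section pi V s -> chart_dom D V s y ->
          ext_d (omega theta A G s) y = pullback_M Om y].
Proof.
move=> mk im; split; first by move=> V s S; exact: (omega_holomorphic mk im S).
exists (reduced_form D theta G mk); split.
- exact: (reduced_form_holomorphic mk im).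
- by move=> m _; exact: reduced_form_anti.
- exact: (reduced_form_closed mk im).
- move=> V s y S Uy; rewrite (ext_d_omega mk im S Uy) /pullback_M.
  congr block_mx; apply: etrans (curvatureE theta G mk S Uy) _.
  exact: esym (reduced_formE mk im Uy.2).
Qed.
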